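(* Let $W=(W^1,\dots,W^d)$ be a standard $d$-dimensional Brownian motion, let $0\le s<t$, $h:=t-s$ and $u:=\frac12(s+t)$. Let $W_{s,t}$ be the path increment and $H_{s,t}$ the (rescaled) space-time Lévy area of $W$ over $[s,t]$, and let $n_{s,t}$ be the random vector with entries $n_{s,t}^i:=\mathrm{sgn}\big(H_{s,u}^i-H_{u,t}^i\big)$. Then for every $i\in\{1,\dots,d\}$, almost surely, $$\mathbb{E}\bigg[\int_s^t\big(W_{s,r}^i\big)^2dr\,\Big|\,W_{s,t},H_{s,t},n_{s,t}\bigg]=\tfrac13h\big(W_{s,t}^i\big)^2+h\,W_{s,t}^iH_{s,t}^i+\tfrac65h\big(H_{s,t}^i\big)^2+\tfrac1{15}h^2-\frac{1}{4\sqrt{6\pi}}\,n_{s,t}^i\,h^{3/2}\,W_{s,t}^i .$$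
   Context: Notation: $W_{a,b}:=W_b-W_a$. For $0\le a<b$, the (rescaled) space-time Lévy area over $[a,b]$ is $$H_{a,b}:=\frac1{b-a}\int_a^b\Big(W_{a,r}-\frac{r-a}{b-a}W_{a,b}\Big)dr\in\mathbb{R}^d .$$ *)

(* Defs.v *)
From HB Require Import structures.
From mathcomp Require Import all_boot all_order all_algebra.
From mathcomp Require Import all_classical all_reals all_analysis.
Import Order.TTheory GRing.Theory Num.Theory.
Import numFieldNormedType.Exports.

Set Implicit Arguments.
Unset Strict Implicit.
Unset Printing Implicit Defensive.

Local Open Scope classical_set_scope.
Local Open Scope ring_scope.

Section probability_notions.
Context {disp : measure_display} {T : measurableType disp} {R : realType}.
Variable P : probability T R.

(* The sigma-algebra on T generated by the real random variables X i, i in D. *)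
Definition sigma_gen (I : Type) (D : set I) (X : I -> T -> R) : set (set T) :=
  <<s \bigcup_(i in D) preimage_set_system setT (X i) measurable >>.

(* When every F i contains setT, the product rule for all subfamilies follows
   from this one by taking the remaining events equal to setT. *)
Definition mutually_independent (m : nat) (F : 'I_m -> set (set T)) : Prop :=
  forall A : 'I_m -> set T, (forall i, F i (A i)) ->
    P (\bigcap_(i in [set: 'I_m]) A i) = (\prod_(i < m) P (A i))%E.

(* Y is a version of E[X | G], for a sub-sigma-algebra G of the measurable
   sets of T. *)
Definition is_condexp (G : set (set T)) (X Y : T -> R) : Prop :=
  [/\ P.-integrable [set: T] (EFin \o X),
      P.-integrable [set: T] (EFin \o Y),
      forall B : set R, measurable B -> G (Y @^-1` B) &
      forall A : set T, G A ->
        (\int[P]_(w in A) (Y w)%:E = \int[P]_(w in A) (X w)%:E)%E].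

(* Some version of E[X | G]; versions are almost surely equal.  The default
   value 0 is reached only if there is no version, i.e. if X is not
   integrable. *)
Definition condexp (G : set (set T)) (X : T -> R) : T -> R :=
  xget (cst 0) [set Y | is_condexp G X Y].

(* B t w is the value at time t >= 0; negative times are irrelevant.
   The second argument of normal_prob is the standard deviation. *)
Definition brownian_motion (B : R -> T -> R) : Prop :=
  [/\ forall t : R, 0 <= t -> measurable_fun [set: T] (B t),
      {ae P, forall w, B 0 w = 0},
      forall w, {within `[0, +oo[%classic, continuous (fun t => B t w)},
      forall a b : R, 0 <= a -> a < b -> forall A : set R, measurable A ->
        P ((fun w => B b w - B a w) @^-1` A) =
        normal_prob 0 (Num.sqrt (b - a)) A &
      forall (m : nat) (t : nat -> R), 0 <= t 0%N ->
        (forall j, (j < m)%N -> t j <= t j.+1) ->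
        mutually_independent (fun j : 'I_m =>
          preimage_set_system setT (fun w => B (t j.+1) w - B (t j) w)
            measurable)].

(* Independent one-dimensional Brownian motions as coordinates. *)
Definition brownian_motion_dim (d : nat) (W : 'I_d -> R -> T -> R) : Prop :=
  (forall i, brownian_motion (W i)) /\
  mutually_independent (fun i => sigma_gen `[0, +oo[%classic (W i)).

End probability_notions.

Section path_functionals.
Context {T : Type} {R : realType} {d : nat}.
Variable W : 'I_d -> R -> T -> R.

Definition incr (a b : R) (i : 'I_d) (w : T) : R := W i b w - W i a w.

Definition levy_area (a b : R) (i : 'I_d) (w : T) : R :=
  (b - a)^-1 *
  \int[@lebesgue_measure R]_(r in `[a, b])
    (incr a r i w - (r - a) / (b - a) * incr a b i w).

Definition levy_sign (s t : R) (i : 'I_d) (w : T) : R :=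
  let u := (s + t) / 2 in Num.sg (levy_area s u i w - levy_area u t i w).

End path_functionals.

(* Main.v *)
Require Import Defs.
From HB Require Import structures.
From mathcomp Require Import all_boot all_order all_algebra.
From mathcomp Require Import all_classical all_reals all_analysis.
From mathcomp Require Import finmap measurable_realfun ring lra.
Import Order.TTheory GRing.Theory Num.Theory.
Import numFieldNormedType.Exports.
Local Open Scope classical_set_scope.
Local Open Scope ring_scope.

(** Fix a coordinate and put u = (s + t) / 2, h = t - s. For s <= r <= t the
    increment W r - W s decomposes as
      coef_incr r * W_{s,t} + coef_area r * H_{s,t}
        + coef_skew r * (H_{s,u} - H_{u,t}) + residual r,
    where the four summands are independent centered Gaussians: H_{s,t} and
    H_{s,u} - H_{u,t} have variance h / 12. Independence is read off the joint
    characteristic function, computed from Riemann sums of the areas and the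
    independence of Brownian increments; Fourier inversion against Gaussian
    kernels and a pi-lambda argument turn it into independence of laws.
    Tested against a product of bounded functions of W_{s,t}, H_{s,t} and
    n_{s,t}, the square of the decomposition, integrated over r, has explicit
    moments. Since |H_{s,u} - H_{u,t}| is independent of its sign, with mean
    2 * sqrt (h / 12) / sqrt (2 * pi), the product of W_{s,t} and the skew area
    yields the sign term of the formula. The other coordinates are independent of
    the chosen one, so the identity extends to all rectangles in the
    d-dimensional data, which form a pi-system generating the conditioning
    sigma-algebra. *)

Set Implicit Arguments.
Unset Strict Implicit.
Unset Printing Implicit Defensive.

(** * Real-valued integrals *)

(** Everything stays real-valued: integrals of [cos (th * V + ph)] with a free phase replace complex
    characteristic functions, and the phase [- pi / 2] recovers the sine part. Laws are treated as
    signed measures: a weight [Z] carries what is known about the other variables, so joint laws are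
    identified one coordinate at a time, without product measures on a Euclidean space. The residual
    depends on [r], so independence is established for each [r] separately, and only the weighted
    second moment is integrated over [r]. The sign of the skew area says nothing about its square,
    which therefore enters through its mean [h / 12] alone. This exactly offsets the share of the
    skew area subtracted in the variance of the residual, so no square of the skew coefficient
    survives and the sign acts only through a cross term. *)

Lemma normr_indic_le1 {T : Type} {R : realType} (A : set T) (x : T) :
  `|\1_A x : R| <= 1.
Proof. by rewrite indicE; case: (_ \in _); rewrite ?normr1 ?normr0. Qed.

Section real_integral.
Context {d : measure_display} {T : measurableType d} {R : realType}.
Variable mu : {measure set T -> \bar R}.
Implicit Types (D : set T) (f g : T -> R).

Lemma le_integrable_real D f g : measurable D -> measurable_fun D f ->
  (forall x, D x -> `|f x| <= g x) -> mu.-integrable D (EFin \o g) ->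
  mu.-integrable D (EFin \o f).
Proof.
move=> mD mf fg; apply: le_integrable => //; first exact/measurable_EFinP.
by move=> x Dx /=; rewrite lee_fin (le_trans (fg x Dx))// ler_norm.
Qed.

Lemma integrable_measurable_real D f : mu.-integrable D (EFin \o f) ->
  measurable_fun D f.
Proof. by move=> /measurable_int/measurable_EFinP. Qed.

Lemma integrable_norm_real D f : mu.-integrable D (EFin \o f) ->
  mu.-integrable D (EFin \o (fun x => `|f x|)).
Proof. exact: integrable_norm. Qed.

Lemma integrableZl_real D f (r : R) : measurable D ->
  mu.-integrable D (EFin \o f) -> mu.-integrable D (EFin \o (fun x => r * f x)).
Proof. by move=> mD /(integrableZl mD r). Qed.

Lemma integrableD_real D f g : measurable D ->
  mu.-integrable D (EFin \o f) -> mu.-integrable D (EFin \o g) ->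
  mu.-integrable D (EFin \o (fun x => f x + g x)).
Proof. by move=> mD intf intg; exact: (integrableD mD intf intg). Qed.

Lemma integrableB_real D f g : measurable D ->
  mu.-integrable D (EFin \o f) -> mu.-integrable D (EFin \o g) ->
  mu.-integrable D (EFin \o (fun x => f x - g x)).
Proof. by move=> mD intf intg; exact: (integrableB mD intf intg). Qed.

Lemma integrableMb D f g (M : R) : measurable D ->
  mu.-integrable D (EFin \o f) -> measurable_fun D g ->
  (forall x, `|g x| <= M) -> mu.-integrable D (EFin \o (fun x => f x * g x)).
Proof.
move=> mD intf mg gM.
apply: (@le_integrable_real _ _ (fun x => M * `|f x|)) => //.
- by apply: measurable_funM => //; exact: integrable_measurable_real intf.
- by move=> x _; rewrite normrM mulrC ler_wpM2r.
- exact/integrableZl_real/integrable_norm_real.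
Qed.

Lemma cvg_Rintegral_dominated D (f_ : nat -> T -> R) f g : measurable D ->
  (forall n, measurable_fun D (f_ n)) ->
  (forall x, D x -> f_ n x @[n --> \oo] --> f x) ->
  mu.-integrable D (EFin \o g) ->
  (forall n x, D x -> `|f_ n x| <= g x) ->
  \int[mu]_(x in D) f_ n x @[n --> \oo] --> \int[mu]_(x in D) f x.
Proof.
move=> mD mf f_f intg fg; apply: fine_cvg.
have mlim : measurable_fun D f by exact: (measurable_fun_cvg mf).
have intf : mu.-integrable D (EFin \o f).
  apply: (@le_integrable_real _ _ g) => // x Dx.
  have h : `|f_ n x| @[n --> \oo] --> `|f x| by apply: cvg_norm; exact: f_f.
  by apply: (cvgr_to_le h); near=> n; exact: fg.
rewrite fineK; last exact: integrable_fin_num.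
apply: (@dominated_cvg _ _ _ mu D mD (fun n x => (f_ n x)%:E) _ (EFin \o g)).
- by move=> n; exact/measurable_EFinP.
- by move=> x Dx; apply: cvg_EFin; [exact: nearW|exact: f_f].
- by [].
- by [].
- by move=> n x Dx /=; rewrite lee_fin fg.
Unshelve. all: by end_near. Qed.

Lemma integrable_sum_real (I : Type) (r : seq I) D (F : I -> T -> R) :
  measurable D -> (forall i, mu.-integrable D (EFin \o F i)) ->
  mu.-integrable D (EFin \o (fun x => \sum_(i <- r) F i x)).
Proof.
move=> mD intF; elim: r => [|i r IH].
  under [X in _.-integrable _ (_ \o X)]eq_fun do rewrite big_nil.
  exact: integrable0.
under [X in _.-integrable _ (_ \o X)]eq_fun do rewrite big_cons.
exact: integrableD_real.
Qed.

Lemma Rintegral_sum (I : Type) (r : seq I) D (F : I -> T -> R) :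
  measurable D -> (forall i, mu.-integrable D (EFin \o F i)) ->
  \int[mu]_(x in D) (\sum_(i <- r) F i x) =
  \sum_(i <- r) \int[mu]_(x in D) F i x.
Proof.
move=> mD intF; elim: r => [|i r IH].
  rewrite big_nil (_ : (fun x => _) = cst 0) ?Rintegral_cst ?mul0r//.
  by apply/funext => x; rewrite big_nil.
rewrite big_cons -IH -RintegralD//; last exact: integrable_sum_real.
by apply: eq_Rintegral => x _; rewrite big_cons.
Qed.

End real_integral.

(** * Gaussian densities *)

Section gaussian_cf.
Context {R : realType}.
Notation lam := (@lebesgue_measure R).

Lemma continuousT_measurable (f : R -> R) : continuous f ->
  measurable_fun [set: R] f.
Proof. exact: continuous_measurable_fun. Qed.

Lemma is_derive_continuous (f df : R -> R) :
  (forall x : R, is_derive x (1 : R) f (df x)) -> continuous f.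
Proof.
by move=> dfx x; apply/differentiable_continuous/derivable1_diffP; case: (dfx x).
Qed.

Lemma cvg0_of_bounded_mul (u : nat -> R) (C : R) :
  (forall n, `|n%:R * u n| <= C) -> u n @[n --> \oo] --> (0 : R).
Proof.
move=> uC; rewrite -(cvg_shiftS u); apply/norm_cvg0P.
apply: (@squeeze_cvgr _ _ _ _ (fun=> 0) (fun n => C * n.+1%:R^-1)).
- near=> n; rewrite normr_ge0/= ler_pdivlMr ?ltr0n//.
  by have := uC n.+1; rewrite normrM mulrC (ger0_norm (ler0n _ _)).
- exact: cvg_cst.
- rewrite -[X in _ --> X](mulr0 C); apply: cvgMl_tmp.
  exact: cvg_harmonic.
Unshelve. all: by end_near. Qed.

(** Integration by parts on the whole line: over [[- n.+1, n.+1]] the integral is a difference of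
    values of [F] at the end points, and the bound on [x * F x] makes these of order 1/n. The
    dominating [g] lets the intervals grow. *)
Lemma Rintegral_derive_eq0 (F f g : R -> R) (C : R) :
  (forall x : R, is_derive x (1 : R) F (f x)) -> continuous f ->
  lam.-integrable [set: R] (EFin \o g) -> (forall x, `|f x| <= g x) ->
  (forall x, `|x * F x| <= C) -> \int[lam]_x f x = 0.
Proof.
move=> dF cf intg fg FC.
have Fy : F n%:R @[n --> \oo] --> (0 : R) by apply: cvg0_of_bounded_mul => n.
have FNy : F (- n%:R) @[n --> \oo] --> (0 : R).
  by apply: (@cvg0_of_bounded_mul _ C) => n; rewrite -normrN -mulNr.
have mf : measurable_fun [set: R] f by exact: continuousT_measurable.
have cF : continuous F := is_derive_continuous dF.
have h : \int[lam]_(x in [set: R]) (f x * \1_(`[- n.+1%:R, n.+1%:R]) x) @[n --> \oo]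
    --> \int[lam]_x f x.
  apply: (@cvg_Rintegral_dominated _ _ _ lam setT
    (fun n x => f x * \1_(`[- n.+1%:R, n.+1%:R]) x) f g) => //.
  - by move=> n; apply: measurable_funM => //; exact: measurable_indic.
  - move=> x _; apply: cvg_near_cst; near=> n.
    rewrite indicE mem_set ?mulr1//= in_itv/= -ler_norml.
    near: n; exists (Num.truncn `|x|) => // n /= xn.
    rewrite (le_trans (ltW (truncnS_gt _)))// ler_nat ltnS.
    exact: xn.
  - move=> n x _; rewrite normrM (le_trans _ (fg x))// ler_piMr//.
    by rewrite indicE; case: (_ \in _); rewrite ?normr1 ?normr0.
have E n : \int[lam]_(x in [set: R]) (f x * \1_(`[- n.+1%:R, n.+1%:R]) x) =
    F n.+1%:R - F (- n.+1%:R).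
  rewrite -[RHS]/(fine (F n.+1%:R - F (- n.+1%:R))%:E) EFinB.
  rewrite -(@continuous_FTC2 _ f F); first last.
  - by move=> x _; rewrite derive1E; case: (dF x).
  - split.
    + by move=> x _; case: (dF x).
    + by apply: cvg_at_right_filter; exact: cF.
    + by apply: cvg_at_left_filter; exact: cF.
  - exact: continuous_subspaceT.
  - by rewrite gtrN.
  rewrite [RHS]Rintegral_mkcond; apply: eq_Rintegral => x _.
  rewrite indicE patchE; case: ifP; rewrite ?mulr1 ?mulr0//.
move: h; under eq_fun do rewrite E.
have : F n.+1%:R - F (- n.+1%:R) @[n --> \oo] --> (0 - 0 : R).
  by apply: cvgB; [move: Fy|move: FNy];
    rewrite -(cvg_shiftS (fun n => F _)).
rewrite subr0 => h1 h2.
exact: (cvg_unique _ h2 h1).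
Unshelve. all: by end_near. Qed.

Variable s : R.
Hypothesis s0 : s != 0.

Let G := @normal_fun R 0 s.

Let GE x : G x = expR (- (x ^+ 2 / (s ^+ 2 *+ 2))).
Proof. by rewrite /G /normal_fun subr0 mulNr. Qed.

(* Half of the Gaussian decay absorbs the polynomial factors. *)
Let K x := expR (- (x ^+ 2 / (s ^+ 2 *+ 4))).

Let intK : lam.-integrable [set: R] (EFin \o K).
Proof.
have r0 : Num.sqrt 2 * s != 0 by rewrite mulf_neq0.
have := @integrable_normal_pdf R 0 (Num.sqrt 2 * s).
move=> /(@integrableZl _ _ _ lam _ measurableT
  ((normal_peak (Num.sqrt 2 * s))^-1)).
apply: eq_integrable => // x _ /=.
rewrite normal_pdfE// -EFinM; congr EFin.
rewrite mulrA mulVf ?mul1r ?gt_eqF ?normal_peak_gt0//.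
rewrite /K /normal_fun subr0 mulNr exprMn sqr_sqrtr// mulr_natl -mulrnA.
by [].
Qed.

Let K2G x : G x = K x ^+ 2.
Proof.
rewrite GE /K [RHS]expr2 -expRD; congr expR.
by rewrite -opprD; congr -%R; field; rewrite /=.
Qed.

(** The inequality [1 + y <= expR y] at [y = x ^+ 2 / (s ^+ 2 *+ 4)]; both polynomial bounds on [G]
    below come from it, since [G] is the square of [K]. *)
Let le1K x : (1 + x ^+ 2 / (s ^+ 2 *+ 4)) * K x <= 1.
Proof.
rewrite /K expRN ler_pdivrMr ?expR_gt0// mul1r.
exact: expR_ge1Dx.
Qed.

Let K_ge0 x : 0 <= K x. Proof. exact: expR_ge0. Qed.
Let K_le1 x : K x <= 1.
Proof.
by rewrite -expR0 ler_expR oppr_le0 divr_ge0 ?sqr_ge0 ?mulrn_wge0 ?sqr_ge0.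
Qed.

Let xG x : `|x * G x| <= `|s| * 2 * K x.
Proof.
rewrite K2G expr2 mulrA normrM (ger0_norm (K_ge0 x)) ler_wpM2r//.
rewrite normrM (ger0_norm (K_ge0 x)).
have := le1K x.
have -> : x ^+ 2 / (s ^+ 2 *+ 4) = (`|x| / (`|s| *+ 2)) ^+ 2.
  by rewrite expr_div_n real_normK ?num_real// exprMn_n real_normK ?num_real.
set y := _ / _ => h.
have -> : `|x| = `|s| * 2 * y by rewrite /y; field; rewrite normr_eq0.
rewrite -(mulrA (`|s| * 2)) ler_piMr ?mulr_ge0//.
apply: le_trans h; rewrite ler_wpM2r//.
nra.
Qed.

Let x2G x : `|x ^+ 2 * G x| <= s ^+ 2 * 4 * K x.
Proof.
rewrite K2G normrM !ger0_norm ?sqr_ge0//.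
rewrite (expr2 (K x)) mulrA ler_wpM2r//.
have := le1K x; pose y := x ^+ 2 / (s ^+ 2 *+ 4); rewrite -/y => h.
have y0 : 0 <= y by rewrite divr_ge0 ?sqr_ge0 ?mulrn_wge0 ?sqr_ge0.
have -> : x ^+ 2 * K x = s ^+ 2 * 4 * (y * K x) by rewrite /y; field.
have c0 : 0 <= s ^+ 2 * 4 by apply: mulr_ge0 => //; exact: sqr_ge0.
rewrite ler_piMr//.
by apply: le_trans h; rewrite ler_wpM2r// lerDr.
Qed.

Let mG : measurable_fun [set: R] G. Proof. exact: measurable_normal_fun. Qed.
Let intG : lam.-integrable [set: R] (EFin \o G).
Proof.
apply: le_integrable_real intK => // x _; rewrite K2G ger0_norm ?sqr_ge0//.
by rewrite expr2 ler_piMr.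
Qed.

Let contG : continuous G.
Proof.
move=> x; rewrite /continuous_at.
have -> : G = (fun x => (normal_peak s)^-1 * normal_pdf 0 s x).
  apply/funext => z; rewrite normal_pdfE//= mulrA mulVf ?mul1r//.
  by rewrite gt_eqF// normal_peak_gt0.
by apply: cvgMl_tmp; exact: continuous_normal_pdf.
Qed.

Let s3 : 0 <= s ^+ 2 * 4.
Proof. by apply: mulr_ge0 => //; exact: sqr_ge0. Qed.

Let G_ge0 x : 0 <= G x. Proof. exact: expR_ge0. Qed.

Let intxG : lam.-integrable [set: R] (EFin \o (fun x => x * G x)).
Proof.
apply: (@le_integrable_real _ _ _ lam setT _ (fun x => `|s| * 2 * K x)) => //.
  exact: measurable_funM.
exact: integrableZl_real.
Qed.

Let trig_le (th ph x : R) (f : R -> R) : `|f x * sin (th * x + ph)| <= `|f x|.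
Proof.
rewrite normrM ler_piMr// ler_norml.
by rewrite sin_geN1 sin_le1.
Qed.

Lemma integrable_sqr_normal_fun :
  lam.-integrable [set: R] (EFin \o (fun x => x ^+ 2 * G x)).
Proof.
apply: (@le_integrable_real _ _ _ lam setT _ (fun x => s ^+ 2 * 4 * K x)) => //.
  by apply: measurable_funM => //; exact: measurable_funX.
exact: integrableZl_real.
Qed.

(** The difference of the two integrands is the derivative of [s ^+ 2 * (x * G x)], which vanishes
    at infinity. *)
Lemma gaussian_second_moment : \int[lam]_x (x ^+ 2 * G x) = s ^+ 2 * \int[lam]_x G x.
Proof.
have intx2 := integrable_sqr_normal_fun.
have ints : lam.-integrable [set: R] (EFin \o (fun x => s ^+ 2 * G x)).
  exact: integrableZl_real.
apply/esym/eqP; rewrite -RintegralZl// -subr_eq0 -RintegralB//; apply/eqP.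
apply: (@Rintegral_derive_eq0 (fun x => s ^+ 2 * (x * G x)) _
  (fun x => s ^+ 2 * G x + s ^+ 2 * 4 * K x) (s ^+ 2 * (s ^+ 2 * 4))).
- move=> x; apply: is_derive_eq.
  by rewrite /GRing.scale/= /G /normal_fun; field.
- move=> x; apply: cvgB; first by apply: cvgMl_tmp; exact: contG.
  by apply: cvgM; [exact: exprn_continuous|exact: contG].
- rewrite (_ : _ \o _ = (EFin \o (fun x => s ^+ 2 * G x))%R \+
    (EFin \o (fun x => s ^+ 2 * 4 * K x))%R)//.
  by apply: integrableD => //; exact: integrableZl_real.
- move=> x; rewrite (le_trans (ler_normB _ _))// lerD//.
  by rewrite ger0_norm// mulr_ge0// sqr_ge0.
- move=> x; rewrite mulrCA normrM ger0_norm ?sqr_ge0// ler_wpM2l ?sqr_ge0//.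
  by rewrite mulrA -expr2 (le_trans (x2G x))// ler_piMr.
Qed.

(** Integration by parts with primitive [s ^+ 2 * (G x * sin (th * x + ph))]: the factor [x]
    produced by differentiating in the frequency is traded for the factor [s ^+ 2 * th]. *)
Let ibp_trig (th ph : R) : \int[lam]_x (x * G x * sin (th * x + ph)) =
  s ^+ 2 * th * \int[lam]_x (G x * cos (th * x + ph)).
Proof.
have mlin : measurable_fun [set: R] (fun x => th * x + ph).
  by apply: measurable_funD => //; exact: measurable_funM.
have int1 : lam.-integrable [set: R] (EFin \o (fun x => x * G x * sin (th * x + ph))).
  apply: (@integrableMb _ _ _ lam setT _ _ 1) => //.
    exact: (measurableT_comp (continuousT_measurable (@continuous_sin R)) mlin).
  by move=> x; rewrite ler_norml sin_geN1 sin_le1.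
have int2 : lam.-integrable [set: R] (EFin \o (fun x => G x * cos (th * x + ph))).
  apply: (@integrableMb _ _ _ lam setT _ _ 1) => //.
    exact: (measurableT_comp (continuousT_measurable (@continuous_cos R)) mlin).
  by move=> x; rewrite ler_norml cos_geN1 cos_le1.
have int3 : lam.-integrable [set: R] (EFin \o (fun x => s ^+ 2 * th * (G x * cos (th * x + ph)))).
  exact: integrableZl_real.
apply/esym/eqP; rewrite -RintegralZl// -subr_eq0 -RintegralB//; apply/eqP.
apply: (@Rintegral_derive_eq0 (fun x => s ^+ 2 * (G x * sin (th * x + ph))) _
  (fun x => `|s ^+ 2 * th * (G x * cos (th * x + ph))| + `|x * G x * sin (th * x + ph)|)
  (s ^+ 2 * (`|s| * 2))).
- move=> x; apply: is_derive_eq.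
  by rewrite /GRing.scale/= /G /normal_fun; field.
- have clin : continuous (fun x : R => th * x + ph).
    by move=> x; apply: cvgD; [exact: cvgMl_tmp|exact: cvg_cst].
  have csin : continuous (fun x : R => sin (th * x + ph)).
    by move=> x; apply: continuous_comp; [exact: clin|exact: continuous_sin].
  have ccos : continuous (fun x : R => cos (th * x + ph)).
    by move=> x; apply: continuous_comp; [exact: clin|exact: continuous_cos].
  move=> x; apply: cvgB.
    by apply: cvgMl_tmp; apply: cvgM; [exact: contG|exact: ccos].
  apply: cvgM; [|exact: csin].
  by apply: cvgM; [exact: cvg_id|exact: contG].
- by apply: integrableD_real => //; exact: integrable_norm_real.
- by move=> x; rewrite (le_trans (ler_normB _ _)).
- move=> x; rewrite mulrCA normrM ger0_norm ?sqr_ge0// ler_wpM2l ?sqr_ge0//.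
  rewrite mulrA (le_trans (trig_le th ph x (fun x => x * G x)))//.
  rewrite (le_trans (xG x))//.
  by rewrite ler_piMr.
Qed.

Let C (ph th : R) := \int[lam]_x (G x * cos (th * x + ph)).

Let mlin (th ph : R) : measurable_fun [set: R] (fun x => th * x + ph).
Proof. by apply: measurable_funD => //; exact: measurable_funM. Qed.

Let intC (ph th : R) :
  lam.-integrable [set: R] (EFin \o (fun x => G x * cos (th * x + ph))).
Proof.
apply: (@integrableMb _ _ _ lam setT _ _ 1) => //.
  exact: (measurableT_comp (continuousT_measurable (@continuous_cos R)) (mlin th ph)).
by move=> x; rewrite cos_max.
Qed.

(** Differentiation under the integral followed by [ibp_trig]: the transform solves a linear
    first-order equation in the frequency, at fixed phase. *)
Let dC (ph th : R) : is_derive th (1 : R) (C ph) (- (s ^+ 2 * th) * C ph th).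
Proof.
have P1 (x y : R) : partial1of2 (fun th x => G x * cos (th * x + ph)) x y =
    - (y * G y * sin (x * y + ph)).
  rewrite partial1of2E; set f := (fun _ => _).
  suff : is_derive x (1 : R) f (- (y * G y * sin (x * y + ph))) by case.
  rewrite /f; apply: is_derive_eq.
  by rewrite /GRing.scale/=; ring.
have D : h^-1 *: (C ph (h + th) - C ph th) @[h --> 0^'] -->
    - (s ^+ 2 * th) * C ph th.
  rewrite mulNr -ibp_trig -mulN1r -RintegralZl//; last first.
    apply: (@integrableMb _ _ _ lam setT _ _ 1) => //.
      exact: (measurableT_comp (continuousT_measurable (@continuous_sin R)) (mlin th ph)).
    by move=> x; rewrite sin_max.
  rewrite [X in _ --> X](_ : _ = \int[lam]_y
      partial1of2 (fun th x => G x * cos (th * x + ph)) th y); last first.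
    by apply: eq_Rintegral => y _; rewrite P1 mulN1r.
  (* The dominating function does not involve the frequency, so the window of radius 1 around [th]
     is an arbitrary choice. *)
  apply: (@cvg_differentiation_under_integral _ _ _ lam _ setT _ th (th - 1)
     (th + 1) _ _ _ (fun x => `|s| * 2 * K x)) => //.
  - by rewrite /= in_itv/=; apply/andP; split; lra.
  - by move=> y; rewrite mulr_ge0.
  - exact: integrableZl_real.
  - by move=> x y _ _; rewrite P1 normrN (le_trans (trig_le _ _ _ (fun x => x * G x))).
apply: DeriveDef.
  apply/cvg_ex; eexists; under eq_fun do rewrite [_%:A]mulr1.
  exact: D.
by apply/cvg_lim => //; under eq_fun do rewrite [_%:A]mulr1; exact: D.
Qed.

(** The integrating factor [expR (s ^+ 2 * t ^+ 2 / 2)] turns [f] into a function with zero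
    derivative. *)
Let ode (f : R -> R) :
  (forall t : R, is_derive t (1 : R) f (- (s ^+ 2 * t) * f t)) ->
  forall t, f t = f 0 * expR (- (s ^+ 2 * t ^+ 2 / 2)).
Proof.
move=> df t.
have H : f t * expR (s ^+ 2 * t ^+ 2 / 2) = f 0 * expR (s ^+ 2 * 0 ^+ 2 / 2).
  apply: (@is_derive_0_is_cst _ (fun t => f t * expR (s ^+ 2 * t ^+ 2 / 2))).
  move=> x; have dfx := df x; apply: is_derive_eq.
  by rewrite /GRing.scale/=; field.
rewrite -[LHS](mulfK (lt0r_neq0 (expR_gt0 (s ^+ 2 * t ^+ 2 / 2)))) H.
by rewrite expr0n/= mulr0 mul0r expR0 mulr1 expRN.
Qed.

Lemma gaussian_cos (th ph : R) : \int[lam]_x (G x * cos (th * x + ph)) =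
  cos ph * expR (- (s ^+ 2 * th ^+ 2 / 2)) * \int[lam]_x G x.
Proof.
rewrite -[LHS]/(C ph th) (ode (dC ph)).
have -> : C ph 0 = cos ph * \int[lam]_x G x.
  rewrite -RintegralZl//; apply: eq_Rintegral => x _.
  by rewrite mul0r add0r mulrC.
by rewrite -!mulrA; congr *%R; rewrite mulrC.
Qed.

End gaussian_cf.

(** * Exchange of real-valued integrals *)

Section Fubini_real.
Context {d1 d2 : measure_display} {T1 : measurableType d1}
  {T2 : measurableType d2} {R : realType}.
Variables (m1 : {sigma_finite_measure set T1 -> \bar R})
  (m2 : {sigma_finite_measure set T2 -> \bar R}).

(** The bound [h] on the inner absolute integrals yields integrability on the product by Tonelli;
    integrability of every section makes the real and the extended integrals agree pointwise, not
    just almost everywhere. *)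
Lemma Rintegral_Fubini (f : T1 -> T2 -> R) (h : T1 -> R) :
  measurable_fun [set: T1 * T2] (fun z => f z.1 z.2) ->
  (forall x, m2.-integrable [set: T2] (EFin \o f x)) ->
  (forall y, m1.-integrable [set: T1] (EFin \o (f ^~ y))) ->
  m1.-integrable [set: T1] (EFin \o h) ->
  (forall x, \int[m2]_y `|f x y| <= h x) ->
  \int[m1]_x \int[m2]_y f x y = \int[m2]_y \int[m1]_x f x y.
Proof.
move=> mf int2 int1 inth fh.
pose F := fun z : T1 * T2 => (f z.1 z.2)%:E.
have mF : measurable_fun [set: T1 * T2] F by exact/measurable_EFinP.
have intF : (m1 \x m2)%E.-integrable [set: T1 * T2] F.
  apply/integrable12ltyP => //.
  have /integrableP[_] := inth; apply: le_lt_trans.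
  apply: ge0_le_integral => //=.
  - by move=> x _; exact: integral_ge0.
  - by apply: (measurable_fun_fubini_tonelli_F (fun z => `|F z|%E)) => //;
      exact: measurableT_comp.
  - by apply/measurable_EFinP/measurableT_comp => //;
      exact: integrable_measurable_real inth.
  - move=> x _; have := fh x; rewrite -lee_fin => fhx.
    apply: (@le_trans _ _ (h x)%:E); last by rewrite lee_fin ler_norm.
    apply: le_trans fhx; rewrite /Rintegral fineK//.
    exact: (integrable_fin_num measurableT (integrable_norm_real (int2 x))).
rewrite /Rintegral; congr fine.
transitivity (\int[m1]_x \int[m2]_y F (x, y))%E.
  apply: eq_integral => x _; rewrite fineK//.
  exact: (integrable_fin_num measurableT (int2 x)).
rewrite Fubini//; apply: eq_integral => y _; rewrite fineK//.
exact: (integrable_fin_num measurableT (int1 y)).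
Qed.

(** The roles are crossed: [h] bounds the integrals over the first variable, while the conclusion
    concerns the integral over the second. *)
Lemma integrable_Rintegral (f : T1 -> T2 -> R) (h : T2 -> R) :
  measurable_fun [set: T1 * T2] (fun z => f z.1 z.2) ->
  (forall x, m2.-integrable [set: T2] (EFin \o f x)) ->
  (forall y, m1.-integrable [set: T1] (EFin \o (f ^~ y))) ->
  m2.-integrable [set: T2] (EFin \o h) ->
  (forall y, \int[m1]_x `|f x y| <= h y) ->
  m1.-integrable [set: T1] (EFin \o (fun x => \int[m2]_y f x y)).
Proof.
move=> mf int2 int1 inth fh.
pose F := fun z : T1 * T2 => (f z.1 z.2)%:E.
have mF : measurable_fun [set: T1 * T2] F by exact/measurable_EFinP.
have intF : (m1 \x m2)%E.-integrable [set: T1 * T2] F.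
  apply/integrable21ltyP => //.
  have /integrableP[_] := inth; apply: le_lt_trans.
  apply: ge0_le_integral => //=.
  - by move=> y _; exact: integral_ge0.
  - by apply: (measurable_fun_fubini_tonelli_G (fun z => `|F z|%E)) => //;
      exact: measurableT_comp.
  - by apply/measurable_EFinP/measurableT_comp => //;
      exact: integrable_measurable_real inth.
  - move=> y _; have := fh y; rewrite -lee_fin => fhy.
    apply: (@le_trans _ _ (h y)%:E); last by rewrite lee_fin ler_norm.
    apply: le_trans fhy; rewrite /Rintegral fineK//.
    exact: (integrable_fin_num measurableT (integrable_norm_real (int1 y))).
have := integrable_fubini_F intF; apply: eq_integrable => // x _.
rewrite /fubini_F /= /Rintegral fineK//.
exact: (integrable_fin_num measurableT (int2 x)).
Qed.

End Fubini_real.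

Section normal_pdf_lemmas.
Context {R : realType}.
Notation lam := (@lebesgue_measure R).

Lemma Rintegral_normal_pdf (m s : R) : \int[lam]_x normal_pdf m s x = 1.
Proof. by rewrite /Rintegral integral_normal_pdf. Qed.

Lemma Rintegral_normal_pdf_le1 (m s : R) (D : set R) : measurable D ->
  \int[lam]_(x in D) normal_pdf m s x <= 1.
Proof.
move=> mD; rewrite -(Rintegral_normal_pdf m s).
apply: fine_le.
- apply: integrable_fin_num => //.
  by apply: integrableS (integrable_normal_pdf m s).
- apply: integrable_fin_num => //; exact: integrable_normal_pdf.
apply: ge0_subset_integral => //.
  by apply/measurable_EFinP; exact: measurable_normal_pdf.
by move=> x _; rewrite lee_fin normal_pdf_ge0.
Qed.

Lemma normal_pdfC (m s x : R) : s != 0 -> normal_pdf m s x = normal_pdf x s m.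
Proof.
by move=> s0; rewrite !normal_pdfE// /normal_fun -sqrrN opprB.
Qed.

Lemma integrable_normal_fun (s : R) : s != 0 ->
  lam.-integrable setT (EFin \o normal_fun 0 s).
Proof.
move=> s0; have := @integrableZl_real _ _ _ _ _ _ (normal_peak s)^-1 measurableT
  (integrable_normal_pdf 0 s).
apply: eq_integrable => // x _; rewrite /= normal_pdfE// mulrA.
by rewrite mulVf ?mul1r// gt_eqF// normal_peak_gt0.
Qed.

Lemma normal_pdf_cos (s th ph : R) : s != 0 ->
  \int[lam]_x (normal_pdf 0 s x * cos (th * x + ph)) =
  cos ph * expR (- (s ^+ 2 * th ^+ 2 / 2)).
Proof.
move=> s0; have intf := integrable_normal_fun s0.
have E : normal_peak s * \int[lam]_x normal_fun 0 s x = 1.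
  rewrite -RintegralZl// -[RHS](Rintegral_normal_pdf 0 s).
  by apply: eq_Rintegral => x _; rewrite normal_pdfE.
have mlin : measurable_fun [set: R] (fun x => th * x + ph).
  by apply: measurable_funD => //; exact: measurable_funM.
have intc : lam.-integrable setT
    (EFin \o (fun x => @normal_fun R 0 s x * cos (th * x + ph))).
  apply: (@integrableMb _ _ _ lam setT _ _ 1) => //.
    exact: (measurableT_comp (continuousT_measurable (@continuous_cos R)) mlin).
  by move=> x; rewrite cos_max.
transitivity (\int[lam]_x (normal_peak s * (normal_fun 0 s x * cos (th * x + ph)))).
  by apply: eq_Rintegral => x _; rewrite normal_pdfE// mulrA.
rewrite (RintegralZl _ measurableT intc) (gaussian_cos s0).
by rewrite mulrCA E mulr1.
Qed.

(* Doubling the variance costs the factor sqrt 2 and gains the exponential. *)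
Lemma normal_pdf_tail (m s e : R) (D : set R) : s != 0 -> 0 <= e ->
  measurable D -> (forall x, D x -> e <= `|x - m|) ->
  \int[lam]_(x in D) normal_pdf m s x <=
    Num.sqrt 2 * expR (- (e ^+ 2 / (s ^+ 2 *+ 4))).
Proof.
move=> s0 e0 mD De.
set c := _ * expR _; have c0 : 0 <= c by rewrite mulr_ge0// expR_ge0.
have r0 : Num.sqrt 2 * s != 0 by rewrite mulf_neq0.
have intp t : lam.-integrable D (EFin \o normal_pdf m t).
  by apply: integrableS (integrable_normal_pdf m t).
have intpT t : lam.-integrable setT (EFin \o normal_pdf m t).
  exact: integrable_normal_pdf.
apply: (@le_trans _ _ (\int[lam]_(x in D) (c * normal_pdf m (Num.sqrt 2 * s) x))).
  apply: le_Rintegral => //; first exact: integrableZl_real.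
  move=> x /De xe; rewrite !normal_pdfE// /c.
  have -> : normal_peak s = Num.sqrt 2 * normal_peak (Num.sqrt 2 * s).
    rewrite /normal_peak.
    have -> : (Num.sqrt 2 * s) ^+ 2 * pi *+ 2 = 2 * (s ^+ 2 * pi *+ 2).
      by rewrite exprMn sqr_sqrtr//; ring.
    by rewrite sqrtrM// invfM mulrA divff ?mul1r.
  rewrite [leRHS]mulrACA ler_wpM2l ?mulr_ge0 ?normal_peak_ge0//.
  rewrite /normal_fun -expRD ler_expR -subr_ge0.
  have -> : (Num.sqrt 2 * s) ^+ 2 = 2 * s ^+ 2 by rewrite exprMn sqr_sqrtr.
  have xe2 : e ^+ 2 <= (x - m) ^+ 2.
    by rewrite -(real_normK (num_real (x - m))) ler_sqr// nnegrE.
  rewrite [X in 0 <= X](_ : _ = ((x - m) ^+ 2 - e ^+ 2) / (s ^+ 2 *+ 4)).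
    by rewrite divr_ge0 ?subr_ge0// mulrn_wge0// sqr_ge0.
  by field.
rewrite RintegralZl// ler_piMr//; exact: Rintegral_normal_pdf_le1.
Qed.

End normal_pdf_lemmas.

(** * Fourier inversion and uniqueness of weighted laws *)

Section fourier_inversion.
Context {d : measure_display} {T : measurableType d} {R : realType}.
Notation lam := (@lebesgue_measure R).

(** The Fourier transform of the signed law of [V] with density [Z], in real form: the phases [0]
    and [- pi / 2] give its cosine and sine parts. *)
Definition cos_transform (mu : {measure set T -> \bar R}) (Z V : T -> R) (th ph : R) : R :=
  \int[mu]_w (Z w * cos (th * V w + ph)).

(* The weighted law of [V] convolved with the centered Gaussian of standard
   deviation [s = (n + 1)^-2], on the half-line above [b + (n + 1)^-1]; the margin
   dominates [s], so that a point mass at [b] is lost in the limit. *)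
Definition inversion (cf : R -> R -> R) (b : R) (n : nat) : R :=
  let s := n.+1%:R^-1 ^+ 2 in
  \int[lam]_(v in `]b + n.+1%:R^-1, +oo[)
    (normal_peak s * \int[lam]_x (normal_pdf 0 1 x * cf (x / s) (- (x / s * v)))).

Variable mu : {sigma_finite_measure set T -> \bar R}.
Variables Z V : T -> R.
Hypothesis intZ : mu.-integrable [set: T] (EFin \o Z).
Hypothesis mV : measurable_fun [set: T] V.

Let mZ : measurable_fun [set: T] Z.
Proof. exact: integrable_measurable_real intZ. Qed.

(** Up to [normal_peak s], a Gaussian kernel is the cosine transform of a Gaussian in the frequency.
    Exchanging the two integrals shows that smoothing by it sees [Z] and [V] only through
    [cos_transform]. *)
Let smooth_pointwise (s v : R) : s != 0 ->
  \int[mu]_w (Z w * normal_pdf (V w) s v) =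
  normal_peak s * \int[lam]_x (normal_pdf 0 1 x *
    cos_transform mu Z V (x / s) (- (x / s * v))).
Proof.
move=> s0.
pose f w x := Z w * (normal_pdf 0 1 x * cos (x / s * V w + - (x / s * v))).
have mcosx w : measurable_fun [set: R] (fun x => cos (x / s * V w - (x / s * v))).
  apply: (measurableT_comp (continuousT_measurable (@continuous_cos R))).
  by apply: measurable_funB; apply: measurable_funM => //; exact: measurable_funM.
have mcosw x : measurable_fun [set: T] (fun w => cos (x / s * V w - (x / s * v))).
  apply: (measurableT_comp (continuousT_measurable (@continuous_cos R))).
  by apply: measurable_funB => //; exact: measurable_funM.
have intpdf (w : T) : lam.-integrable setT (EFin \o
    (fun x => normal_pdf 0 1 x * cos (x / s * V w - (x / s * v)))).
  apply: (@integrableMb _ _ _ lam setT _ _ 1) => //.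
  - exact: integrable_normal_pdf.
  - exact: mcosx.
  - by move=> x; rewrite cos_max.
have int2 w : lam.-integrable setT (EFin \o f w) by exact: integrableZl_real.
have int1 x : mu.-integrable setT (EFin \o (f ^~ x)).
  rewrite (_ : _ \o _ = EFin \o (fun w => normal_pdf 0 1 x *
     (Z w * cos (x / s * V w - (x / s * v))))); last first.
    by apply/funext => w; rewrite /f /= mulrCA.
  apply: integrableZl_real => //.
  by apply: (@integrableMb _ _ _ mu setT _ _ 1) => // w; rewrite cos_max.
have F := @Rintegral_Fubini _ _ _ _ _ mu lam f (fun w => `|Z w|).
have E w : \int[lam]_x f w x = (normal_peak s)^-1 * (Z w * normal_pdf (V w) s v).
  rewrite /f RintegralZl// mulrCA; congr *%R.
  rewrite (normal_pdfE _ s0) mulrA mulVf ?mul1r ?gt_eqF ?normal_peak_gt0//.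
  transitivity (\int[lam]_x (normal_pdf 0 1 x * cos ((V w - v) / s * x + 0))).
    by apply: eq_Rintegral => x _; congr (_ * cos _); ring.
  rewrite normal_pdf_cos// cos0 mul1r /normal_fun; congr expR.
  by field.
have intN : mu.-integrable setT (EFin \o (fun w => Z w * normal_pdf (V w) s v)).
  apply: (@integrableMb _ _ _ mu setT _ _ (normal_peak s)) => //.
    rewrite (_ : (fun w => _) = (fun w => normal_pdf v s (V w))).
      by apply: (measurableT_comp (measurable_normal_pdf v s)).
    by apply/funext => w; rewrite normal_pdfC.
  by move=> w; rewrite ger0_norm ?normal_pdf_ge0 ?normal_pdf_ub.
transitivity (normal_peak s * \int[mu]_w \int[lam]_x f w x).
  under [X in _ = _ * X]eq_Rintegral do rewrite E.
  by rewrite RintegralZl// mulrA divff ?mul1r// gt_eqF// normal_peak_gt0.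
congr *%R; rewrite F//; first last.
- move=> w; rewrite -[leRHS]mulr1 -(Rintegral_normal_pdf 0 1) -RintegralZl//;
    last exact: integrable_normal_pdf.
  apply: le_Rintegral => //.
  + exact: integrable_norm_real.
  + by apply: integrableZl_real => //; exact: integrable_normal_pdf.
  + move=> x _; rewrite /f normrM ler_wpM2l// normrM.
    by rewrite (ger0_norm (normal_pdf_ge0 _ _ _)) ler_piMr ?normal_pdf_ge0 ?cos_max.
- exact: integrable_norm_real.
- rewrite /f; apply: measurable_funM; first exact: measurableT_comp.
  apply: measurable_funM.
    by apply: (measurableT_comp (measurable_normal_pdf 0 1)) => //.
  apply: (measurableT_comp (continuousT_measurable (@continuous_cos R))).
  have m2 : measurable_fun [set: T * R] (fun z : T * R => z.2 / s).
    exact: measurable_funM.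
  apply: measurable_funD; first by apply: measurable_funM => //; exact: measurableT_comp.
  by apply: measurableT_comp => //; exact: measurable_funM.
apply: eq_Rintegral => x _; rewrite /cos_transform -RintegralZl//; last first.
  by apply: (@integrableMb _ _ _ mu setT _ _ 1) => // w; rewrite cos_max.
by apply: eq_Rintegral => w _; rewrite /f mulrCA.
Qed.

(** A smoothed indicator of the half-line above [b], shifted by the margin. *)
Let step (b : R) (n : nat) (y : R) : R :=
  \int[lam]_(v in `]b + n.+1%:R^-1, +oo[) normal_pdf y (n.+1%:R^-1 ^+ 2) v.

Let sn0 (n : nat) : (n.+1%:R^-1 ^+ 2 : R) != 0.
Proof. by rewrite expf_eq0/= invr_eq0 pnatr_eq0. Qed.

Let inversionE b n : inversion (cos_transform mu Z V) b n =
  \int[mu]_w (Z w * step b n (V w)).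
Proof.
rewrite /inversion; set s := n.+1%:R^-1 ^+ 2; pose D : set R := `]b + n.+1%:R^-1, +oo[%classic; rewrite -/D.
have s0 : s != 0 by exact: sn0.
have mD : measurable D by exact: measurable_itv.
pose f w v := Z w * (normal_pdf (V w) s v * \1_D v).
have intp w : lam.-integrable setT (EFin \o (fun v => normal_pdf (V w) s v * \1_D v)).
  apply: (@integrableMb _ _ _ lam setT _ _ 1) => //.
  - exact: integrable_normal_pdf.
  - by move=> x; exact: normr_indic_le1.
have mpw v : measurable_fun setT (fun w => normal_pdf (V w) s v).
  rewrite (_ : (fun w => _) = (fun w => normal_pdf v s (V w))).
    by apply: (measurableT_comp (measurable_normal_pdf v s)).
  by apply/funext => w; rewrite normal_pdfC.
have F := @Rintegral_Fubini _ _ _ _ _ mu lam f (fun w => `|Z w|).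
transitivity (\int[lam]_v \int[mu]_w f w v).
  rewrite Rintegral_mkcond; apply: eq_Rintegral => v _; rewrite patchE.
  case: ifPn => vD.
    rewrite -smooth_pointwise//; apply: eq_Rintegral => w _.
    by rewrite /f indicE vD mulr1.
  rewrite (_ : (fun w => f w v) = cst 0) ?Rintegral_cst ?mul0r//.
  by apply/funext => w; rewrite /f indicE (negbTE vD) !mulr0.
rewrite -F//.
- apply: eq_Rintegral => w _; rewrite /f RintegralZl//; congr *%R.
  rewrite [RHS]Rintegral_mkcond; apply: eq_Rintegral => v _.
  by rewrite patchE indicE; case: ifP; rewrite ?mulr1 ?mulr0.
- rewrite /f; apply: measurable_funM; first exact: measurableT_comp.
  apply: measurable_funM; last first.
    by apply: (measurableT_comp (measurable_indic _)).
  rewrite (_ : (fun z => _) = (fun z : T * R => normal_pdf 0 s (z.2 - V z.1))).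
    apply: (measurableT_comp (measurable_normal_pdf 0 s)).
    by apply: measurable_funB => //; exact: measurableT_comp.
  by apply/funext => z; rewrite !normal_pdfE// /normal_fun subr0.
- by move=> w; exact: integrableZl_real.
- move=> v; apply: (@integrableMb _ _ _ mu setT _ _ (normal_peak s)) => //.
    exact: measurable_funM.
  move=> w; rewrite normrM -[leRHS]mulr1 ler_pM//; last exact: normr_indic_le1.
  by rewrite ger0_norm ?normal_pdf_ge0 ?normal_pdf_ub.
- exact: integrable_norm_real.
- move=> w; apply: (@le_trans _ _ (\int[lam]_v (`|Z w| * normal_pdf (V w) s v))).
    apply: le_Rintegral => //.
    + by apply: integrable_norm_real; exact: integrableZl_real.
    + by apply: integrableZl_real => //; exact: integrable_normal_pdf.
    + move=> v _; rewrite /f normrM ler_wpM2l// normrM.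
      rewrite (ger0_norm (normal_pdf_ge0 _ _ _)) ler_piMr ?normal_pdf_ge0//.
      exact: normr_indic_le1.
  rewrite RintegralZl ?Rintegral_normal_pdf ?mulr1//.
  exact: integrable_normal_pdf.
Qed.

Let mstep b n : measurable_fun [set: R] (step b n).
Proof.
pose s : R := n.+1%:R^-1 ^+ 2; pose D : set R := `]b + n.+1%:R^-1, +oo[%classic.
rewrite (_ : step b n = fine \o (fubini_F lam (fun z : R * R =>
    (normal_pdf z.1 s z.2 * \1_D z.2)%:E))); last first.
  apply/funext => y; rewrite /step /fubini_F /= [LHS]Rintegral_mkcond.
  congr fine; apply: eq_integral => v _; rewrite patchE indicE.
  by case: ifP; rewrite ?mulr1 ?mulr0.
apply: measurableT_comp => //; apply: measurable_fun_fubini_tonelli_F.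
  apply/measurable_EFinP/measurable_funM; last first.
    by apply: (measurableT_comp (measurable_indic _)); first exact: measurable_itv.
  rewrite (_ : (fun z => _) = (fun z : R * R => normal_pdf 0 s (z.2 - z.1))).
    apply: (measurableT_comp (measurable_normal_pdf 0 s)).
    by apply: measurable_funB.
  by apply/funext => z; rewrite !normal_pdfE ?sn0// /normal_fun subr0.
by move=> z; rewrite lee_fin mulr_ge0 ?normal_pdf_ge0.
Qed.

(** The margin [n.+1%:R^-1] equals [n.+1] standard deviations, so [normal_pdf_tail] bounds the mass
    beyond it by [tail n.+1]. *)
Let tail (n : nat) : R := Num.sqrt 2 * expR (- (n%:R ^+ 2 / 4)).

Let tail_cvg0 : tail n @[n --> \oo] --> (0 : R).
Proof.
apply: (@cvg0_of_bounded_mul _ _ (Num.sqrt 2)) => n.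
rewrite /tail mulrCA normrM ger0_norm// ler_piMr// expRN.
rewrite ger0_norm ?mulr_ge0// ?invr_ge0 ?expR_ge0//.
rewrite ler_pdivrMr ?expR_gt0// mul1r.
(* It remains to see [n <= 1 + n^2 / 4], a perfect square. *)
apply: le_trans (expR_ge1Dx _); rewrite -subr_ge0.
have -> : 1 + n%:R ^+ 2 / 4 - n%:R = (n%:R / 2 - 1) ^+ 2 :> R by field.
exact: sqr_ge0.
Qed.

Let tail_bound (n : nat) (y : R) (D : set R) : measurable D ->
  (forall v, D v -> n.+1%:R^-1 <= `|v - y|) ->
  \int[lam]_(v in D) normal_pdf y (n.+1%:R^-1 ^+ 2) v <= tail n.+1.
Proof.
move=> mD De; apply: le_trans (normal_pdf_tail (sn0 n) _ mD De) _ => //.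
rewrite /tail ler_wpM2l// ler_expR lerN2.
by rewrite le_eqVlt; apply/orP; left; apply/eqP; field; rewrite ?pnatr_eq0.
Qed.

(** For [y <= b] the whole half-line lies at least one margin away from [y]; for [b < y] its
    complement does, once the margin is below [(y - b) / 2]. The value at [y = b] is therefore 0, as
    for the open half-line. *)
Let cvg_step b y : step b n y @[n --> \oo] --> (\1_(`]b, +oo[) y : R).
Proof.
have tail1 : tail n.+1 @[n --> \oo] --> (0 : R).
  by move: tail_cvg0; rewrite -(cvg_shiftS tail).
rewrite indicE; have [yb|by_] := leP y b.
  rewrite memNset/=; last by rewrite in_itv/= andbT; apply/negP; rewrite -leNgt.
  apply: (@squeeze_cvgr _ _ _ _ (fun=> 0) (fun n => tail n.+1)) => //.
    near=> n; apply/andP; split.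
      by apply: Rintegral_ge0 => v _; exact: normal_pdf_ge0.
    apply: tail_bound => // v; rewrite /= in_itv/= andbT => bv.
    have p : 0 < n.+1%:R^-1 :> R by rewrite invr_gt0.
    by move: (n.+1%:R^-1) bv p => e bv p; rewrite ger0_norm; lra.
  exact: cvg_cst.
rewrite mem_set/=; last by rewrite in_itv/= by_.
rewrite -[X in _ --> X](subr0 1).
have -> : (fun n => step b n y) = (fun n => 1 - (1 - step b n y)).
  by apply/funext => n; ring.
apply: cvgB; first exact: cvg_cst.
apply: (@squeeze_cvgr _ _ _ _ (fun=> 0) (fun n => tail n.+1)) => //; last exact: cvg_cst.
have cinv : (n.+1%:R^-1 : R) @[n --> \oo] --> (0 : R) by exact: cvg_harmonic.
near=> n.
have H : \int[lam]_(v in `]-oo, b + n.+1%:R^-1])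
    normal_pdf y (n.+1%:R^-1 ^+ 2) v + step b n y = 1.
  rewrite /step -Rintegral_setU//.
  - rewrite -[RHS](Rintegral_normal_pdf y (n.+1%:R^-1 ^+ 2)).
    congr Rintegral; apply/seteqP; split => // v _ /=; rewrite !in_itv/= andbT.
    by have [|] := leP v (b + n.+1%:R^-1); [left|right].
  - apply: (integrableS measurableT) => //; first exact: measurableU.
    exact: integrable_normal_pdf.
  - apply/disj_setPS => v /=; rewrite !in_itv/= andbT => -[h1 h2].
    by have := lt_le_trans h2 h1; rewrite ltxx.
have -> : 1 - step b n y = \int[lam]_(v in `]-oo, b + n.+1%:R^-1])
    normal_pdf y (n.+1%:R^-1 ^+ 2) v.
  by apply/eqP; rewrite subr_eq; apply/eqP/esym.
apply/andP; split; first by apply: Rintegral_ge0 => v _; exact: normal_pdf_ge0.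
apply: tail_bound => // v; rewrite /= in_itv/= => vb.
have : n.+1%:R^-1 < (y - b) / 2.
  near: n; apply: (cvgr_lt (0 : R)) => //; lra.
by move: (n.+1%:R^-1) vb => e vb h; rewrite ler0_norm; lra.
Unshelve. all: by end_near. Qed.

(** The smoothed steps stay in [[0, 1]], so [Z] dominates. The left-hand side depends on the cosine
    transform alone, hence so does the limit. *)
Lemma cvg_inversion b : inversion (cos_transform mu Z V) b n @[n --> \oo] -->
  \int[mu]_w (Z w * \1_(`]b, +oo[) (V w)).
Proof.
under eq_fun do rewrite inversionE.
apply: (@cvg_Rintegral_dominated _ _ _ mu setT
  (fun n w => Z w * step b n (V w)) _ (fun w => `|Z w|)) => //.
- move=> n; apply: measurable_funM => //.
  exact: (measurableT_comp (mstep b n)).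
- move=> w _; apply: cvgMl_tmp; exact: cvg_step.
- exact: integrable_norm_real.
- move=> n w _; rewrite normrM ler_piMr// ger0_norm.
    exact: Rintegral_normal_pdf_le1.
  by apply: Rintegral_ge0 => v _; exact: normal_pdf_ge0.
Qed.

End fourier_inversion.

(** * Signed laws and their uniqueness *)

Section weighted_law1.
Context {d1 d3 : measure_display} {T : measurableType d1}
   {U : measurableType d3} {R : realType}.
Variables (mu : {measure set T -> \bar R}) (Z : T -> R) (V : T -> U).
Hypothesis intZ : mu.-integrable [set: T] (EFin \o Z).
Hypothesis mV : measurable_fun [set: T] V.

(** The image under [V] of the signed measure with density [Z]. Signs are needed because [Z] will
    contain cosines of the remaining variables. *)
Definition weighted_law (B : set U) : R := \int[mu]_w (Z w * \1_B (V w)).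

Lemma integrable_weight (B : set U) : measurable B ->
  mu.-integrable [set: T] (EFin \o (fun w => Z w * \1_B (V w))).
Proof.
move=> mB; apply: (@integrableMb _ _ _ mu setT _ _ 1) => //.
  by apply: (measurableT_comp (measurable_indic _)).
by move=> w; exact: normr_indic_le1.
Qed.

Lemma weighted_lawT : weighted_law setT = \int[mu]_w Z w.
Proof. by apply: eq_Rintegral => w _; rewrite indicT mulr1. Qed.

Lemma weighted_lawC (B : set U) : measurable B ->
  weighted_law (~` B) = weighted_law setT - weighted_law B.
Proof.
move=> mB; rewrite /weighted_law -RintegralB//; [|exact: integrable_weight..].
apply: eq_Rintegral => w _; rewrite indicT mulr1 !indicE in_setC.
by case: (_ \in _); rewrite ?mulr0 ?mulr1 ?subr0 ?subrr.
Qed.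

Lemma cvg_weighted_law (F : nat -> set U) : (forall n, measurable (F n)) ->
  trivIset setT F ->
  (\sum_(k < n) weighted_law (F k)) @[n --> \oo] --> weighted_law (\bigcup_k F k).
Proof.
move=> mF tF.
have E n : \sum_(k < n) weighted_law (F k) =
    \int[mu]_w (Z w * \1_(\big[setU/set0]_(k < n) F k) (V w)).
  elim: n => [|n IH].
    rewrite !big_ord0 (_ : (fun w => _) = cst 0) ?Rintegral_cst ?mul0r//.
    by apply/funext => w; rewrite indic0 mulr0.
  rewrite !big_ord_recr/= IH /weighted_law -RintegralD//; last 2 first.
  - by apply: integrable_weight; exact: bigsetU_measurable.
  - exact: integrable_weight.
  apply: eq_Rintegral => w _; rewrite -mulrDr !indicE in_setU.
  case: (boolP (V w \in F n)) => VF; last by rewrite orbF addr0.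
  rewrite orbT memNset ?add0r//; rewrite -bigcup_mkord => -[k /= kn Fk].
  move/set_mem: VF => VF.
  have E : k = n by apply: (tF k n I I); exists (V w).
  by rewrite E ltnn in kn.
under eq_fun do rewrite E.
apply: (@cvg_Rintegral_dominated _ _ _ mu setT (fun n w => Z w *
  \1_(\big[setU/set0]_(k < n) F k) (V w)) _ (fun w => `|Z w|)) => //.
- move=> n; apply: integrable_measurable_real; apply: integrable_weight.
  exact: bigsetU_measurable.
- move=> w _; apply: cvgMl_tmp.
  have [/set_mem[k _ Fk]|nF] := boolP (V w \in \bigcup_k F k).
    apply: cvg_near_cst; exists k.+1 => // n /= kn.
    rewrite !indicE !mem_set//; last by rewrite -bigcup_mkord; exists k.
    by exists k.
  apply: cvg_near_cst; near=> n; rewrite !indicE (negbTE nF).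
  rewrite memNset//= -bigcup_mkord => -[k _ Fk].
  by move/negP: nF; apply; apply/mem_set; exists k.
- exact: integrable_norm_real.
- move=> n w _; rewrite normrM ler_piMr//; exact: normr_indic_le1.
Unshelve. all: by end_near. Qed.

End weighted_law1.

Import HBNNSimple.

Section weighted_law2.
Context {d1 d2 d3 : measure_display} {T1 : measurableType d1}
  {T2 : measurableType d2} {U : measurableType d3} {R : realType}.
Variables (m1 : {measure set T1 -> \bar R}) (m2 : {measure set T2 -> \bar R}).
Variables (Z1 : T1 -> R) (Z2 : T2 -> R) (V1 : T1 -> U) (V2 : T2 -> U).
Hypothesis intZ1 : m1.-integrable [set: T1] (EFin \o Z1).
Hypothesis intZ2 : m2.-integrable [set: T2] (EFin \o Z2).
Hypothesis mV1 : measurable_fun [set: T1] V1.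
Hypothesis mV2 : measurable_fun [set: T2] V2.

(** Dynkin's lemma. Equality of the total masses is a separate hypothesis because [G] may omit
    [setT], and it is what settles complements. *)
Lemma weighted_law_unique (G : set (set U)) :
  @measurable _ U = <<s G >> -> setI_closed G ->
  weighted_law m1 Z1 V1 setT = weighted_law m2 Z2 V2 setT ->
  (forall B, G B -> weighted_law m1 Z1 V1 B = weighted_law m2 Z2 V2 B) ->
  forall B, measurable B -> weighted_law m1 Z1 V1 B = weighted_law m2 Z2 V2 B.
Proof.
move=> mG GI eqT eqG B; rewrite mG.
apply: (dynkin_induction (P := fun B => weighted_law m1 Z1 V1 B = weighted_law m2 Z2 V2 B)) => //.
- by move=> S mS eqS; rewrite !weighted_lawC// eqT eqS.
- move=> F mF tF eqF.
  have := cvg_weighted_law intZ1 mV1 mF tF.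
  under eq_fun do under eq_bigr do rewrite eqF.
  move/cvg_unique; apply; first exact: norm_hausdorff.
  exact: cvg_weighted_law.
Qed.

Hypothesis same_law : forall B, measurable B ->
  weighted_law m1 Z1 V1 B = weighted_law m2 Z2 V2 B.

Let simple_case (g : {nnsfun U >-> R}) :
  \int[m1]_w (Z1 w * g (V1 w)) = \int[m2]_w (Z2 w * g (V2 w)).
Proof.
have E d (T' : measurableType d) (m : {measure set T' -> \bar R}) (Z : T' -> R) V :
    m.-integrable setT (EFin \o Z) -> measurable_fun setT V ->
    \int[m]_w (Z w * g (V w)) =
    \sum_(y <- fset_set (range g)) y * weighted_law m Z V (g @^-1` [set y]).
  move=> intZ mV.
  under eq_bigr do rewrite /weighted_law -RintegralZl ?integrable_weight//.
  rewrite -Rintegral_sum//; last first.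
    by move=> y; apply: integrableZl_real => //; exact: integrable_weight.
  apply: eq_Rintegral => w _; rewrite (fimfunE g) fsbig_finite//=.
  by rewrite mulr_sumr; apply: eq_bigr => y _; rewrite mulrCA.
rewrite !E//; apply: eq_bigr => y _; rewrite same_law//.
Qed.

(** The weights are signed, so the increasing simple approximations of [f] are used under dominated
    convergence, with bound [Z * f]. *)
Let nonneg_case (f : U -> R) : measurable_fun setT f -> (forall x, 0 <= f x) ->
  m1.-integrable setT (EFin \o (fun w => Z1 w * f (V1 w))) ->
  m2.-integrable setT (EFin \o (fun w => Z2 w * f (V2 w))) ->
  \int[m1]_w (Z1 w * f (V1 w)) = \int[m2]_w (Z2 w * f (V2 w)).
Proof.
move=> mf f0 int1 int2.
have mF : measurable_fun setT (EFin \o f) by exact/measurable_EFinP.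
pose g := nnsfun_approx measurableT mF.
have g_cvg x : g n x @[n --> \oo] --> f x.
  have := cvg_nnsfun_approx measurableT mF (fun x _ => f0 x) (I : setT x).
  by move=> /fine_cvg.
have g_le n x : g n x <= f x.
  apply: (cvgr_to_ge (g_cvg x)); near=> k.
  have nk : (n <= k)%N by near: k; exists n.
  by have /lefP := nd_nnsfun_approx measurableT mF nk; exact.
have E d (T' : measurableType d) (m : {measure set T' -> \bar R}) (Z : T' -> R) V :
    m.-integrable setT (EFin \o Z) -> measurable_fun setT V ->
    m.-integrable setT (EFin \o (fun w => Z w * f (V w))) ->
  \int[m]_w (Z w * g n (V w)) @[n --> \oo] --> \int[m]_w (Z w * f (V w)).
  move=> intZ mV intf.
  apply: (@cvg_Rintegral_dominated _ _ _ m setT (fun n w => Z w * g n (V w)) _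
     (fun w => `|Z w * f (V w)|)) => //.
  - move=> n; apply: measurable_funM; first exact: integrable_measurable_real intZ.
    by apply: measurableT_comp.
  - by move=> w _; apply: cvgMl_tmp; exact: g_cvg.
  - exact: integrable_norm_real.
  - move=> n w _; rewrite !normrM ler_wpM2l// !ger0_norm//.
have := E _ _ m1 Z1 V1 intZ1 mV1 int1.
under eq_fun do rewrite simple_case.
move/cvg_unique; apply; first exact: norm_hausdorff.
exact: E.
Unshelve. all: by end_near. Qed.

(** Change of variables for signed laws. Unbounded [f] is allowed, as second moments require, at the
    price of integrability on both sides. *)
Lemma weighted_law_fun (f : U -> R) : measurable_fun setT f ->
  m1.-integrable setT (EFin \o (fun w => Z1 w * f (V1 w))) ->
  m2.-integrable setT (EFin \o (fun w => Z2 w * f (V2 w))) ->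
  \int[m1]_w (Z1 w * f (V1 w)) = \int[m2]_w (Z2 w * f (V2 w)).
Proof.
move=> mf int1 int2.
have mn : measurable_fun setT (fun x => `|f x|) by exact: measurableT_comp.
(* [f = (|f| + f) - |f|] is a difference of nonnegative functions. *)
have intn d (T' : measurableType d) (m : {measure set T' -> \bar R}) (Z : T' -> R) V :
    m.-integrable setT (EFin \o Z) -> measurable_fun setT V ->
    m.-integrable setT (EFin \o (fun w => Z w * f (V w))) ->
    m.-integrable setT (EFin \o (fun w => Z w * `|f (V w)|)).
  move=> intZ mV intf.
  apply: (@le_integrable_real _ _ _ m setT _ (fun w => `|Z w * f (V w)|)) => //.
  - apply: measurable_funM; first exact: integrable_measurable_real intZ.
    exact: (measurableT_comp mn).
  - by move=> w _; rewrite !normrM normr_id.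
  - exact: integrable_norm_real.
have int1n := intn _ _ m1 Z1 V1 intZ1 mV1 int1.
have int2n := intn _ _ m2 Z2 V2 intZ2 mV2 int2.
have E d (T' : measurableType d) (m : {measure set T' -> \bar R}) (Z : T' -> R) V :
    m.-integrable setT (EFin \o (fun w => Z w * f (V w))) ->
    m.-integrable setT (EFin \o (fun w => Z w * `|f (V w)|)) ->
    m.-integrable setT (EFin \o (fun w => Z w * (`|f (V w)| + f (V w)))) /\
    \int[m]_w (Z w * f (V w)) = \int[m]_w (Z w * (`|f (V w)| + f (V w))) -
      \int[m]_w (Z w * `|f (V w)|).
  move=> intf intfn.
  have H : m.-integrable setT (EFin \o (fun w => Z w * (`|f (V w)| + f (V w)))).
    by under [X in _.-integrable _ (_ \o X)]eq_fun do rewrite mulrDr;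
       exact: integrableD_real.
  split => //; rewrite -RintegralB//; apply: eq_Rintegral => w _.
  by rewrite mulrDr addrC addKr.
have [H1 ->] := E _ _ m1 Z1 V1 int1 int1n.
have [H2 ->] := E _ _ m2 Z2 V2 int2 int2n.
congr (_ - _).
  apply: (nonneg_case (f := fun x => `|f x| + f x)) => //.
    exact: measurable_funD.
  by move=> x; rewrite -lerBlDr sub0r -normrN ler_norm.
exact: (nonneg_case (f := fun x => `|f x|)).
Qed.

End weighted_law2.

Section cos_transform_unique.
Context {d1 d2 : measure_display} {T1 : measurableType d1}
  {T2 : measurableType d2} {R : realType}.
Variables (m1 : {sigma_finite_measure set T1 -> \bar R})
  (m2 : {sigma_finite_measure set T2 -> \bar R}).
Variables (Z1 V1 : T1 -> R) (Z2 V2 : T2 -> R).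
Hypothesis intZ1 : m1.-integrable [set: T1] (EFin \o Z1).
Hypothesis intZ2 : m2.-integrable [set: T2] (EFin \o Z2).
Hypothesis mV1 : measurable_fun [set: T1] V1.
Hypothesis mV2 : measurable_fun [set: T2] V2.

(** Inversion determines the masses of the half-lines []b, +oo[], a pi-system generating the Borel
    sets. *)
Lemma cos_transform_unique :
  (forall th ph, cos_transform m1 Z1 V1 th ph = cos_transform m2 Z2 V2 th ph) ->
  forall B, measurable B -> weighted_law m1 Z1 V1 B = weighted_law m2 Z2 V2 B.
Proof.
move=> eqcf; apply: (weighted_law_unique intZ1 intZ2 mV1 mV2
  (RGenOInfty.measurableE R)).
- move=> A B [x ->] [y ->]; exists (Num.max x y).
  apply/seteqP; split => z /=; rewrite !in_itv/= !andbT gt_max.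
    by move=> [-> ->].
  by move/andP.
(* Zero frequency and zero phase give the total mass. *)
- have := eqcf 0 0; rewrite !weighted_lawT /cos_transform.
  under eq_Rintegral do rewrite mul0r addr0 cos0 mulr1.
  by under [in RHS]eq_Rintegral do rewrite mul0r addr0 cos0 mulr1.
- move=> B [b ->].
  have /cvg_unique := cvg_inversion intZ1 mV1 (b := b).
  apply; first exact: norm_hausdorff.
  rewrite (_ : cos_transform _ _ _ = cos_transform m2 Z2 V2).
    exact: cvg_inversion.
  by apply/funext => th; apply/funext => ph; exact: eqcf.
Qed.

End cos_transform_unique.

(** * Independent Gaussian families *)

Section gauss_mean.
Context {R : realType}.
Notation lam := (@lebesgue_measure R).

(* Rescaling a standard normal variable keeps the case [s = 0] meaningful: it
   gives [f 0]. *)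
Definition gauss_mean (s : R) (f : R -> R) : R :=
  \int[lam]_x (normal_pdf 0 1 x * f (s * x)).

Lemma integrable_std_pdf : lam.-integrable setT (EFin \o normal_pdf (0 : R) 1).
Proof. exact: integrable_normal_pdf. Qed.

Lemma integrable_gauss_bounded (s : R) (f : R -> R) (M : R) :
  measurable_fun setT f -> (forall x, `|f x| <= M) ->
  lam.-integrable setT (EFin \o (fun x => normal_pdf 0 1 x * f (s * x))).
Proof.
move=> mf fM; apply: (@integrableMb _ _ _ lam setT _ _ M) => //.
  exact: integrable_std_pdf.
by apply: (measurableT_comp mf); exact: measurable_funM.
Qed.

Lemma gauss_mean_cos (s th ph : R) :
  gauss_mean s (fun x => cos (th * x + ph)) =
  cos ph * expR (- (th ^+ 2 * s ^+ 2 / 2)).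
Proof.
rewrite /gauss_mean; under eq_Rintegral do rewrite mulrA.
by rewrite normal_pdf_cos// expr1n mul1r exprMn.
Qed.

Lemma gauss_mean_cst (s c : R) : gauss_mean s (fun=> c) = c.
Proof.
rewrite /gauss_mean RintegralZr//; last exact: integrable_std_pdf.
by rewrite Rintegral_normal_pdf mul1r.
Qed.

Lemma gauss_mean_sin (s th : R) : gauss_mean s (fun x => sin (th * x)) = 0.
Proof.
rewrite (_ : (fun x => _) = (fun x => cos (th * x + - (pi / 2)))).
  by rewrite gauss_mean_cos cosN cos_pihalf mul0r.
by apply/funext => x; rewrite cosB cos_pihalf sin_pihalf mulr0 mulr1 add0r.
Qed.

End gauss_mean.

Lemma integrable_prob_bounded {d : measure_display} {T : measurableType d}
    {R : realType} (P : probability T R) (f : T -> R) (M : R) :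
  measurable_fun setT f -> (forall x, `|f x| <= M) ->
  P.-integrable setT (EFin \o f).
Proof.
move=> mf fM; apply: (@le_integrable_real _ _ _ P setT _ (cst M)) => //.
exact: finite_measure_integrable_cst.
Qed.

Section gaussian_families.
Context {d : measure_display} {T : measurableType d} {R : realType}.
Notation lam := (@lebesgue_measure R).
Variable P : probability T R.
Variables (n : nat) (X : nat -> T -> R) (s : nat -> R).
Hypothesis mX : forall k, (k < n)%N -> measurable_fun [set: T] (X k).

Let ind (B : nat -> set R) (j : nat) (w : T) : R :=
  \prod_(0 <= k < j) \1_(B k) (X k w).

Let lin (th : nat -> R) (j : nat) (w : T) : R := \sum_(j <= k < n) th k * X k w.

Let var (th : nat -> R) (j : nat) : R := \sum_(j <= k < n) th k ^+ 2 * s k ^+ 2.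

(* Interpolates between [gaussian_cf] ([j = 0]) and [gaussian_law] ([j = n]). *)
Let mix (j : nat) : Prop := forall (B : nat -> set R) (th : nat -> R) (ph : R),
  (forall k, measurable (B k)) ->
  \int[P]_w (ind B j w * cos (lin th j w + ph)) =
  \prod_(0 <= k < j) gauss_mean (s k) \1_(B k) * (cos ph * expR (- (var th j / 2))).

Let mind B j : (j <= n)%N -> (forall k, measurable (B k)) ->
  measurable_fun setT (ind B j).
Proof.
move=> jn mB; elim: j jn => [|j IH] jn.
  by rewrite (_ : ind B 0 = cst 1)//; apply/funext => w; rewrite /ind big_geq.
rewrite (_ : ind B j.+1 = fun w => ind B j w * \1_(B j) (X j w)).
  apply: measurable_funM; first by apply: IH; exact: ltnW.
  by apply: (measurableT_comp (measurable_indic _)); [exact: mB|exact: mX].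
by apply/funext => w; rewrite /ind big_nat_recr.
Qed.

Let ind_le B j w : `|ind B j w| <= 1.
Proof.
rewrite /ind normr_prod; apply: prodr_ile1 => k _.
by rewrite normr_ge0 normr_indic_le1.
Qed.

Let mlin th j : measurable_fun setT (lin th j).
Proof.
rewrite /lin (_ : (fun w => _) = (fun w => \sum_(j <= k < n)
    (if (k < n)%N then th k * X k w else 0))).
  apply: measurable_sum => k; case: (boolP (k < n)%N) => kn; last exact: measurable_cst.
  by apply: measurable_funM => //; exact: mX.
apply/funext => w; rewrite [LHS]big_nat [RHS]big_nat; apply: eq_bigr => k /andP[_ kn].
by rewrite kn.
Qed.

Let mcos (A : T -> R) ph : measurable_fun setT A ->
  measurable_fun setT (fun w => cos (A w + ph)).
Proof.
move=> mA; apply: (measurableT_comp (continuousT_measurable (@continuous_cos R))).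
exact: measurable_funD.
Qed.

Let lin_recl th j w : (j < n)%N -> lin th j w = th j * X j w + lin th j.+1 w.
Proof. by move=> jn; rewrite /lin big_ltn. Qed.

Let var_recl th j : (j < n)%N -> var th j = th j ^+ 2 * s j ^+ 2 + var th j.+1.
Proof. by move=> jn; rewrite /var big_ltn. Qed.

(** Frees the frequency of [X j], so that the hypothesis at [j] becomes a statement about a cosine
    transform in that variable. *)
Let upd (th : nat -> R) j t := fun k => if k == j then t else th k.

Let lin_upd th j t : lin (upd th j t) j.+1 = lin th j.+1.
Proof.
apply/funext => w; rewrite /lin; rewrite [LHS]big_nat [RHS]big_nat; apply: eq_bigr => k /andP[jk _].
by rewrite /upd gtn_eqF.
Qed.

Let var_upd th j t : var (upd th j t) j.+1 = var th j.+1.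
Proof.
rewrite /var; rewrite [LHS]big_nat [RHS]big_nat; apply: eq_bigr => k /andP[jk _].
by rewrite /upd gtn_eqF.
Qed.

Let upd_eq th j t : upd th j t j = t. Proof. by rewrite /upd eqxx. Qed.

Let weight B th j ph w := ind B j w * cos (lin th j.+1 w + ph).

Let int_weight B th j ph : (j <= n)%N -> (forall k, measurable (B k)) ->
  P.-integrable setT (EFin \o weight B th j ph).
Proof.
move=> jn mB; apply: (@integrable_prob_bounded _ _ _ P _ 1).
  apply: measurable_funM; first exact: mind.
  by apply: mcos; exact: mlin.
by move=> w; rewrite normrM mulr_ile1// cos_max.
Qed.

Let int_gauss (c : R) : lam.-integrable setT (EFin \o (fun x => c * normal_pdf (0 : R) 1 x)).
Proof. by apply: integrableZl_real => //; exact: integrable_std_pdf. Qed.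

Let law_gauss (c t : R) (B : set R) : measurable B ->
  weighted_law lam (fun x => c * normal_pdf (0 : R) 1 x) (fun x => t * x) B =
  c * gauss_mean t \1_B.
Proof.
move=> mB; rewrite /weighted_law /gauss_mean -RintegralZl//; last first.
  apply: (@integrable_gauss_bounded _ _ _ 1); first exact: measurable_indic.
  by move=> x; exact: normr_indic_le1.
by apply: eq_Rintegral => x _; rewrite mulrA.
Qed.

Let mscale (t : R) : measurable_fun setT (fun x : R => t * x).
Proof. exact: measurable_funM. Qed.

(** With the other variables put into a signed weight, the hypothesis gives the cosine transform of
    [X j] at every frequency and phase. It is that of a multiple of a Gaussian, so uniqueness lets
    an indicator of [X j] replace its cosine. *)
Let mix_up j : (j < n)%N -> mix j -> mix j.+1.
Proof.
move=> jn H B th ph mB.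
have H' t ps : \int[P]_w (ind B j w * cos (t * X j w + lin th j.+1 w + ps)) =
    \prod_(0 <= k < j) gauss_mean (s k) \1_(B k) *
    (cos ps * expR (- ((t ^+ 2 * s j ^+ 2 + var th j.+1) / 2))).
  have := H B (upd th j t) ps mB; rewrite var_recl// upd_eq var_upd => <-.
  by apply: eq_Rintegral => w _; rewrite [lin (upd _ _ _) _ _]lin_recl// upd_eq lin_upd.
pose c := \prod_(0 <= k < j) gauss_mean (s k) \1_(B k) * (cos ph * expR (- (var th j.+1 / 2))).
have := @cos_transform_unique _ _ _ _ _ P lam (weight B th j ph) (X j)
  (fun x => c * normal_pdf (0 : R) 1 x) (fun x => s j * x)
  (int_weight th ph (ltnW jn) mB) (int_gauss c) (mX jn) (mscale _).
move=> /(_ _ (B j) (mB j)); rewrite law_gauss// => E.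
rewrite big_nat_recr//= mulrAC -E.
  apply: eq_Rintegral => w _; rewrite /weight /ind big_nat_recr//=.
  by rewrite mulrAC.
move=> t ps; rewrite /cos_transform.
(* Product-to-sum formula: a product of two cosines, one from the weight and one from the transform,
   becomes two cosines covered by the hypothesis. *)
have -> : \int[P]_w (weight B th j ph w * cos (t * X j w + ps)) =
   2^-1 * (\int[P]_w (ind B j w * cos (t * X j w + lin th j.+1 w + (ph + ps))) +
           \int[P]_w (ind B j w * cos (- t * X j w + lin th j.+1 w + (ph - ps)))).
  have I u v : P.-integrable setT
      (EFin \o (fun w => ind B j w * cos (u * X j w + lin th j.+1 w + v))).
    apply: (@integrable_prob_bounded _ _ _ P _ 1).
      apply: measurable_funM; first by apply: mind => //; exact: ltnW.
      apply: mcos; apply: measurable_funD => //.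
      by apply: measurable_funM => //; exact: mX.
    by move=> w; rewrite normrM mulr_ile1// cos_max.
  rewrite -RintegralD// -RintegralZl//; last exact: integrableD_real.
  apply: eq_Rintegral => w _; rewrite /weight.
  set x := t * X j w; set y := lin _ _ _.
  have -> : x + y + (ph + ps) = (y + ph) + (x + ps) by ring.
  have -> : - t * X j w + y + (ph - ps) = (y + ph) - (x + ps) by rewrite /x; ring.
  by move: (y + ph) (x + ps) => a b; rewrite cosD cosB; field.
rewrite !H' sqrrN cosD cosB.
rewrite (_ : \int[lam]_w _ = c * gauss_mean (s j) (fun x => cos (t * x + ps))).
  rewrite gauss_mean_cos /c [- ((_ + _) / 2)](_ : _ =
    - (t ^+ 2 * s j ^+ 2 / 2) + - (var th j.+1 / 2)) ?expRD; last by field.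
  by field.
rewrite /gauss_mean -RintegralZl//; first by apply: eq_Rintegral => x _; rewrite -mulrA.
apply: (@integrable_gauss_bounded _ (s j) (fun x => cos (t * x + ps)) 1); last first.
  by move=> x; rewrite cos_max.
have ml : measurable_fun setT (fun x : R => t * x + ps) by exact: measurable_funD.
exact: (measurableT_comp (continuousT_measurable (@continuous_cos R)) ml).
Qed.

(** Indicators of [X j] give its law under the weight, against which the trigonometric functions of
    [X j] can be integrated. The sine part vanishes because the Gaussian is symmetric. *)
Let mix_down j : (j < n)%N -> mix j.+1 -> mix j.
Proof.
move=> jn H B th ph mB.
pose c ps := \prod_(0 <= k < j) gauss_mean (s k) \1_(B k) *
  (cos ps * expR (- (var th j.+1 / 2))).
have law ps A : measurable A -> weighted_law P (weight B th j ps) (X j) A =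
    weighted_law lam (fun x => c ps * normal_pdf (0 : R) 1 x) (fun x => s j * x) A.
  move=> mA; rewrite law_gauss//.
  pose B' k := if k == j then A else B k.
  have mB' k : measurable (B' k) by rewrite /B'; case: ifP.
  have := H B' th ps mB'.
  have B'B k : (k < j)%N -> B' k = B k by move=> kj; rewrite /B' ltn_eqF.
  have B'j : B' j = A by rewrite /B' eqxx.
  rewrite big_nat_recr//= B'j.
  rewrite [X in X * _ * _](_ : _ = \prod_(0 <= k < j) gauss_mean (s k) \1_(B k)).
    rewrite /c mulrAC => <-; apply: eq_Rintegral => w _.
    rewrite /weight /ind [in RHS]big_nat_recr//= B'j mulrAC.
    congr (_ * _ * _); rewrite [LHS]big_nat [RHS]big_nat.
    by apply: eq_bigr => k /andP[_ kj]; rewrite B'B.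
  rewrite [LHS]big_nat [RHS]big_nat.
  by apply: eq_bigr => k /andP[_ kj]; rewrite B'B.
have msc (t : R) : measurable_fun setT (fun x : R => cos (t * x)).
  by apply: (measurableT_comp (continuousT_measurable (@continuous_cos R))).
have mss (t : R) : measurable_fun setT (fun x : R => sin (t * x)).
  by apply: (measurableT_comp (continuousT_measurable (@continuous_sin R))).
have fun_law ps (f : R -> R) : measurable_fun setT f -> (forall x, `|f x| <= 1) ->
    P.-integrable setT (EFin \o (fun w => weight B th j ps w * f (X j w))) /\
    \int[P]_w (weight B th j ps w * f (X j w)) = c ps * gauss_mean (s j) f.
  move=> mf f1.
  have I1 : P.-integrable setT (EFin \o (fun w => weight B th j ps w * f (X j w))).
    apply: (@integrableMb _ _ _ P setT _ _ 1) => //.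
      exact: int_weight (ltnW jn) mB.
    by apply: (measurableT_comp mf); exact: mX.
  have I2 : lam.-integrable setT (EFin \o (fun x => normal_pdf 0 1 x * f (s j * x))).
    exact: integrable_gauss_bounded mf f1.
  split => //; rewrite (weighted_law_fun (int_weight th ps (ltnW jn) mB)
    (int_gauss (c ps)) (mX jn) (mscale _) (law ps) mf)//.
    rewrite /gauss_mean -RintegralZl//.
    by apply: eq_Rintegral => x _; rewrite -mulrA.
  by apply: (@integrableMb _ _ _ lam setT _ _ 1) => //; exact: (measurableT_comp mf).
have [Ic Ec] := fun_law ph _ (msc (th j)) (fun x => cos_max _).
have [Is Es] := fun_law (ph - pi / 2) _ (mss (th j)) (fun x => sin_max _).
(* Addition formula for the cosine; the sine of the remaining variables is the weight with phase
   shifted by [- pi / 2]. *)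
transitivity (\int[P]_w (weight B th j ph w * cos (th j * X j w)) -
    \int[P]_w (weight B th j (ph - pi / 2) w * sin (th j * X j w))).
  rewrite -RintegralB//; apply: eq_Rintegral => w _; rewrite lin_recl// /weight.
  rewrite -addrA [lin _ _ _ + (ph - _)]addrA.
  move: (th j * X j w) (lin th j.+1 w + ph) => a b.
  by rewrite cosD cosB cos_pihalf sin_pihalf; ring.
rewrite Ec Es gauss_mean_sin mulr0 subr0.
have -> : (fun x => cos (th j * x)) = (fun x => cos (th j * x + 0)).
  by apply/funext => x; rewrite addr0.
rewrite gauss_mean_cos cos0 mul1r /c (var_recl th jn).
rewrite [- ((_ + _) / 2)](_ : _ = - (th j ^+ 2 * s j ^+ 2 / 2) +
  - (var th j.+1 / 2)) ?expRD; last by field.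
by ring.
Qed.

(* The characteristic function of independent centered Gaussians, with [s k]
   the standard deviation of [X k]. *)
Definition gaussian_cf : Prop := forall (th : nat -> R) (ph : R),
  \int[P]_w cos (\sum_(0 <= k < n) th k * X k w + ph) =
  cos ph * expR (- ((\sum_(0 <= k < n) th k ^+ 2 * s k ^+ 2) / 2)).

Definition gaussian_law : Prop := forall B : nat -> set R,
  (forall k, measurable (B k)) ->
  \int[P]_w \prod_(0 <= k < n) \1_(B k) (X k w) =
  \prod_(0 <= k < n) gauss_mean (s k) \1_(B k).

Let var_n th : var th n = 0. Proof. by rewrite /var big_geq. Qed.
Let lin_n th w : lin th n w = 0. Proof. by rewrite /lin big_geq. Qed.

Lemma gaussian_cf_law : gaussian_cf -> gaussian_law.
Proof.
move=> H B mB.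
have H0 : mix 0.
  move=> B' th ph _; rewrite big_geq// mul1r -H; apply: eq_Rintegral => w _.
  by rewrite /ind big_geq// mul1r.
have Hj j : (j <= n)%N -> mix j.
  by elim: j => // j IH jn; apply: mix_up => //; apply: IH; exact: ltnW.
have := Hj n (leqnn n) B (fun=> 0) 0 mB.
rewrite var_n mul0r oppr0 expR0 cos0 !mulr1 => <-.
by apply: eq_Rintegral => w _; rewrite lin_n addr0 cos0 mulr1.
Qed.

Lemma gaussian_law_cf : gaussian_law -> gaussian_cf.
Proof.
move=> H th ph.
have Hn : mix n.
  move=> B th' ph' mB; rewrite var_n mul0r oppr0 expR0 mulr1 -H//.
  rewrite -RintegralZr//; last first.
    apply: (@integrable_prob_bounded _ _ _ P (ind B n) 1); first exact: mind.
    exact: ind_le.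
  by apply: eq_Rintegral => w _; rewrite lin_n add0r.
have Hj j : (j <= n)%N -> mix (n - j).
  elim: j => [|j IH] jn; first by rewrite subn0.
  by apply: mix_down; [rewrite ltn_subrL; case: n jn|rewrite subnSK//; apply/IH/ltnW].
have := Hj n (leqnn n) (fun=> setT) th ph (fun=> measurableT).
rewrite subnn big_geq// mul1r => <-; apply: eq_Rintegral => w _.
by rewrite /ind big_geq// mul1r.
Qed.

End gaussian_families.

Section gaussian_law_fun.
Context {d : measure_display} {T : measurableType d} {R : realType}.
Notation lam := (@lebesgue_measure R).
Variable P : probability T R.
Variables (n : nat) (X : nat -> T -> R) (s : nat -> R).
Hypothesis mX : forall k, (k < n)%N -> measurable_fun [set: T] (X k).
Hypothesis lawX : gaussian_law P n X s.

(** Indicators are replaced by functions one coordinate at a time, the functions already in place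
    serving as weight for the next. Hence the integrability hypothesis on every prefix of the
    product. *)
Lemma gaussian_law_fun (f : nat -> R -> R) :
  (forall k, measurable_fun setT (f k)) ->
  (forall k, lam.-integrable setT (EFin \o (fun x => normal_pdf 0 1 x * f k (s k * x)))) ->
  (forall j, (j <= n)%N ->
    P.-integrable setT (EFin \o (fun w => \prod_(0 <= k < j) f k (X k w)))) ->
  \int[P]_w \prod_(0 <= k < n) f k (X k w) = \prod_(0 <= k < n) gauss_mean (s k) (f k).
Proof.
move=> mf intf intp.
pose ind (B : nat -> set R) j w : R := \prod_(j <= k < n) \1_(B k) (X k w).
have mind B j : (forall k, measurable (B k)) -> measurable_fun setT (ind B j).
  move=> mB; rewrite (_ : ind B j = fun w => \prod_(j <= k < n)
    (if (k < n)%N then \1_(B k) (X k w) else 1)).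
    apply: measurable_prod => k _; case: (boolP (k < n)%N) => kn; last exact: measurable_cst.
    by apply: (measurableT_comp (measurable_indic _)); [exact: mB|exact: mX].
  apply/funext => w; rewrite /ind [LHS]big_nat [RHS]big_nat.
  by apply: eq_bigr => k /andP[_ ->].
have ind_le B j w : `|ind B j w| <= 1.
  rewrite /ind normr_prod; apply: prodr_ile1 => k _.
  by rewrite normr_ge0 normr_indic_le1.
have intw B j i : (forall k, measurable (B k)) -> (j <= n)%N -> P.-integrable setT
    (EFin \o (fun w => \prod_(0 <= k < j) f k (X k w) * ind B i w)).
  move=> mB jn; apply: (@integrableMb _ _ _ P setT _ _ 1) => //; first exact: intp.
  exact: mind.
have mix j : (j <= n)%N -> forall B, (forall k, measurable (B k)) ->
    \int[P]_w (\prod_(0 <= k < j) f k (X k w) * ind B j w) =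
    \prod_(0 <= k < j) gauss_mean (s k) (f k) *
    \prod_(j <= k < n) gauss_mean (s k) \1_(B k).
  elim: j => [|j IH] jn B mB.
    rewrite big_geq// mul1r -lawX//; apply: eq_Rintegral => w _.
    by rewrite big_geq// mul1r.
  have jn' := ltnW jn.
  pose Z w := \prod_(0 <= k < j) f k (X k w) * ind B j.+1 w.
  have intZ : P.-integrable setT (EFin \o Z) by exact: intw.
  pose c := \prod_(0 <= k < j) gauss_mean (s k) (f k) *
    \prod_(j.+1 <= k < n) gauss_mean (s k) \1_(B k).
  have intg : lam.-integrable setT (EFin \o (fun x => c * normal_pdf (0 : R) 1 x)).
    by apply: integrableZl_real => //; exact: integrable_std_pdf.
  have msc : measurable_fun setT (fun x : R => s j * x) by exact: measurable_funM.
  have law A : measurable A -> weighted_law P Z (X j) A =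
      weighted_law lam (fun x => c * normal_pdf (0 : R) 1 x) (fun x => s j * x) A.
    move=> mA.
    pose B' k := if k == j then A else B k.
    have mB' k : measurable (B' k) by rewrite /B'; case: ifP.
    have B'j : B' j = A by rewrite /B' eqxx.
    have B'B k : (j < k)%N -> B' k = B k by move=> kj; rewrite /B' gtn_eqF.
    have := IH jn' B' mB'; rewrite [X in _ * X]big_ltn// B'j.
    have -> : \prod_(j.+1 <= k < n) gauss_mean (s k) \1_(B' k) =
              \prod_(j.+1 <= k < n) gauss_mean (s k) \1_(B k).
      rewrite [LHS]big_nat [RHS]big_nat.
      by apply: eq_bigr => k /andP[jk _]; rewrite B'B.
    move=> E; transitivity (c * gauss_mean (s j) \1_A); last first.
      rewrite /gauss_mean -RintegralZl//.
        by apply: eq_Rintegral => x _; rewrite mulrA.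
      apply: (@integrable_gauss_bounded _ (s j) \1_A 1); first exact: measurable_indic.
      by move=> x; exact: normr_indic_le1.
    rewrite /c -mulrA [X in _ * X]mulrC -E; apply: eq_Rintegral => w _.
    rewrite /Z /ind [in RHS](big_ltn jn) B'j -mulrA; congr (_ * _).
    rewrite mulrC; congr (_ * _); rewrite [LHS]big_nat [RHS]big_nat.
    by apply: eq_bigr => k /andP[jk _]; rewrite B'B.
  transitivity (\int[P]_w (Z w * f j (X j w))).
    by apply: eq_Rintegral => w _; rewrite big_nat_recr//= /Z mulrAC.
  rewrite (weighted_law_fun intZ intg (mX jn) msc law (mf j)).
  - rewrite big_nat_recr//= mulrAC -/c /gauss_mean -RintegralZl//.
    by apply: eq_Rintegral => x _; rewrite -mulrA.
  - have := intw B j.+1 j.+1 mB jn; apply: eq_integrable => // w _ /=.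
    by rewrite big_nat_recr//= /Z mulrAC.
  - under [X in _.-integrable _ (_ \o X)]eq_fun do rewrite -mulrA.
    exact: integrableZl_real.
have := mix n (leqnn n) (fun=> setT) (fun=> measurableT).
rewrite [X in _ * X]big_geq// mulr1 => <-; apply: eq_Rintegral => w _.
by rewrite /ind [X in _ * X]big_geq// mulr1.
Qed.

End gaussian_law_fun.

(** * Gaussian moments and half-line moments *)

Section gaussian_moments.
Context {R : realType}.
Notation lam := (@lebesgue_measure R).

Lemma normal_peak1 : normal_peak (1 : R) = (Num.sqrt (2 * pi))^-1.
Proof. by rewrite /normal_peak expr1n mul1r mulr_natl. Qed.

Let s01 : (1 : R) != 0. Proof. exact: oner_neq0. Qed.

Let intx2 (s : R) :
  lam.-integrable setT (EFin \o (fun x => normal_pdf 0 1 x * (s * x) ^+ 2)).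
Proof.
have := integrableZl_real (s ^+ 2 * normal_peak 1) measurableT
  (integrable_sqr_normal_fun s01).
apply: eq_integrable => // x _ /=; congr EFin.
by rewrite normal_pdfE//; ring.
Qed.

Lemma expr_le2_bound (x : R) (e : nat) : (e <= 2)%N -> `|x ^+ e| <= 1 + x ^+ 2.
Proof.
case: e => [_|[_|[_|//]]].
- by rewrite expr0 normr1 lerDl sqr_ge0.
- by rewrite expr1 ler_norml; apply/andP; split; nra.
- by rewrite ger0_norm ?sqr_ge0// lerDr.
Qed.

Lemma integrable_gauss_pow (s : R) (e : nat) (g : R -> R) : (e <= 2)%N ->
  measurable_fun setT g -> (forall x, `|g x| <= 1) ->
  lam.-integrable setT (EFin \o (fun x => normal_pdf 0 1 x * ((s * x) ^+ e * g (s * x)))).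
Proof.
move=> e2 mg g1; have msc : measurable_fun setT (fun x : R => s * x).
  exact: measurable_funM.
apply: (@le_integrable_real _ _ _ lam setT _ (fun x => normal_pdf 0 1 x +
    normal_pdf 0 1 x * (s * x) ^+ 2)) => //.
- apply: measurable_funM; first exact: measurable_normal_pdf.
  apply: measurable_funM; first exact: measurable_funX.
  exact: (measurableT_comp mg).
- move=> x _; rewrite normrM ger0_norm ?normal_pdf_ge0//.
  rewrite -[X in X + _]mulr1 -mulrDr ler_wpM2l ?normal_pdf_ge0//.
  rewrite normrM -[leRHS]mulr1 ler_pM//; exact: expr_le2_bound.
- by apply: integrableD_real => //; exact: integrable_std_pdf.
Qed.

Lemma gauss_mean_sqr (s : R) : gauss_mean s (fun x => x ^+ 2) = s ^+ 2.
Proof.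
rewrite /gauss_mean.
transitivity (\int[lam]_x (s ^+ 2 * normal_peak 1 * (x ^+ 2 * normal_fun 0 1 x))).
  by apply: eq_Rintegral => x _; rewrite normal_pdfE//; ring.
rewrite RintegralZl//; last exact: integrable_sqr_normal_fun.
rewrite gaussian_second_moment// expr1n mul1r -mulrA.
rewrite -RintegralZl//; last exact: integrable_normal_fun.
rewrite (_ : \int[lam]_x _ = \int[lam]_x normal_pdf (0 : R) 1 x).
  by rewrite Rintegral_normal_pdf mulr1.
by apply: eq_Rintegral => x _; rewrite normal_pdfE.
Qed.

(** The cosine transform of a centered Gaussian involves [s] only through its square, and it
    determines the law. *)
Lemma gauss_meanN (s : R) (f : R -> R) : measurable_fun setT f ->
  lam.-integrable setT (EFin \o (fun x => normal_pdf 0 1 x * f (s * x))) ->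
  lam.-integrable setT (EFin \o (fun x => normal_pdf 0 1 x * f (- s * x))) ->
  gauss_mean (- s) f = gauss_mean s f.
Proof.
move=> mf int1 int2; rewrite /gauss_mean.
have msc t : measurable_fun setT (fun x : R => t * x) by exact: measurable_funM.
have law := @cos_transform_unique _ _ _ _ _ lam lam (normal_pdf (0 : R) 1)
  (fun x => - s * x) (normal_pdf 0 1) (fun x => s * x)
  integrable_std_pdf integrable_std_pdf (msc _) (msc _).
apply: (weighted_law_fun integrable_std_pdf integrable_std_pdf (msc _) (msc _) _ mf) => //.
apply: law => th ph; rewrite -[LHS]/(gauss_mean (- s) (fun x => cos (th * x + ph))).
rewrite -[RHS]/(gauss_mean s (fun x => cos (th * x + ph))).
by rewrite !gauss_mean_cos sqrrN.
Qed.

(** As a function of [s] this mean is even by symmetry and odd by linearity. *)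
Lemma gauss_mean_id (s : R) : gauss_mean s id = 0.
Proof.
have I t : lam.-integrable setT (EFin \o (fun x => normal_pdf 0 1 x * (t * x))).
  have := @integrable_gauss_pow t 1 (cst 1) isT (measurable_cst _) _.
  under eq_fun do rewrite /= mulr1 expr1.
  by apply => x; rewrite normr1.
have := gauss_meanN (@measurable_id _ _ setT) (I s) (I (- s)).
have -> : gauss_mean (- s) id = - gauss_mean s id.
  rewrite -[RHS]mulN1r /gauss_mean -RintegralZl//.
  by apply: eq_Rintegral => x _ /=; ring.
by move=> E; lra.
Qed.

Definition half_moment (e : nat) : R :=
  gauss_mean 1 (fun x => x ^+ e * \1_(`]0, +oo[) x).

Lemma indic_pos (x : R) : \1_(`]0, +oo[) x = (0 < x)%R%:R :> R.
Proof.
rewrite indicE; have [h|h] := ltP 0 x; first by rewrite mem_set//= in_itv/= h.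
by rewrite memNset//= in_itv/= andbT; apply/negP; rewrite -leNgt.
Qed.

Lemma indic_neg (x : R) : \1_(`]-oo, 0[) x = (x < 0)%R%:R :> R.
Proof.
rewrite indicE; have [h|h] := ltP x 0; first by rewrite mem_set//= in_itv/= h.
by rewrite memNset//= in_itv/=; apply/negP; rewrite -leNgt.
Qed.

Lemma gauss_mean_pos (s : R) (e : nat) : 0 < s -> (e <= 2)%N ->
  gauss_mean s (fun x => x ^+ e * \1_(`]0, +oo[) x) = s ^+ e * half_moment e.
Proof.
move=> s0 e2; rewrite /half_moment /gauss_mean -RintegralZl//; last first.
  by apply: (@integrable_gauss_pow 1 e) => // x; exact: normr_indic_le1.
apply: eq_Rintegral => x _; rewrite mul1r exprMn.
by rewrite !indic_pos pmulr_rgt0//; ring.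
Qed.

Lemma gauss_mean_neg (s : R) (e : nat) : 0 < s -> (e <= 2)%N ->
  gauss_mean s (fun x => x ^+ e * \1_(`]-oo, 0[) x) =
  (- s) ^+ e * half_moment e.
Proof.
move=> s0 e2; rewrite -gauss_meanN; last 3 first.
- by apply: measurable_funM => //; exact: exprn_measurable.
- by apply: (@integrable_gauss_pow s e) => // x; exact: normr_indic_le1.
- by apply: (@integrable_gauss_pow (- s) e) => // x; exact: normr_indic_le1.
rewrite /half_moment /gauss_mean -RintegralZl//; last first.
  by apply: (@integrable_gauss_pow 1 e) => // x; exact: normr_indic_le1.
apply: eq_Rintegral => x _; rewrite mul1r exprMn.
by rewrite indic_neg indic_pos mulNr oppr_lt0 pmulr_rgt0//; ring.
Qed.

(** Independence of absolute value and sign, in computable form: the size contributes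
    [s ^+ e * half_moment e], while [g] enters through a combination depending only on the parity of
    [e]. Thus [e = 2] can be compared with [e = 0], and [e = 1] with [e = 0] for
    [fun y => y * g y]. *)
Lemma gauss_mean_sg (s : R) (e : nat) (g : R -> R) : 0 < s -> (e <= 2)%N ->
  gauss_mean s (fun x => x ^+ e * g (Num.sg x)) =
  s ^+ e * half_moment e * (g 1 + (-1) ^+ e * g (-1)).
Proof.
move=> s0 e2.
have I B : measurable B ->
    lam.-integrable setT (EFin \o (fun x => normal_pdf 0 1 x * ((s * x) ^+ e * \1_B (s * x)))).
  move=> mB; apply: integrable_gauss_pow => //.
  by move=> x; exact: normr_indic_le1.
have m0 : measurable ([set 0] : set R) by exact: measurable_set1.
(* The sign takes the value 0 only on a null set, so [g 0] drops out. *)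
have E0 : gauss_mean s (fun x => x ^+ e * \1_[set 0] x) = 0.
  rewrite /gauss_mean -[RHS](@Rintegral_set1 R (fun x => normal_pdf 0 1 x * (s * x) ^+ e) 0).
  rewrite [RHS]Rintegral_mkcond; apply: eq_Rintegral => x _.
  rewrite patchE indicE mulrA; case: ifPn => x0.
    by rewrite mem_set ?mulr1//=; move/set_mem: x0 => ->; rewrite mulr0.
  rewrite memNset ?mulr0//= => /eqP; rewrite mulf_eq0 gt_eqF//= => /eqP x0'.
  by move/negP : x0; apply; apply/mem_set.
transitivity (g 1 * gauss_mean s (fun x => x ^+ e * \1_(`]0, +oo[) x) +
    g (-1) * gauss_mean s (fun x => x ^+ e * \1_(`]-oo, 0[) x) +
    g 0 * gauss_mean s (fun x => x ^+ e * \1_[set 0] x)).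
  rewrite /gauss_mean -!RintegralZl//; [|exact: I..].
  have J c B : measurable B -> lam.-integrable setT (EFin \o (fun x => c *
      (normal_pdf 0 1 x * ((s * x) ^+ e * \1_B (s * x))))).
    by move=> mB; apply: integrableZl_real => //; exact: I.
  rewrite -!RintegralD//; do ?[exact: J|by apply: integrableD_real => //; exact: J].
  apply: eq_Rintegral => x _; rewrite indic_pos indic_neg indicE.
  have [y0|y0|->] := ltgtP (s * x) 0.
  - rewrite ltr0_sg// memNset/=; first by ring.
    by move=> y0'; rewrite y0' ltxx in y0.
  - rewrite gtr0_sg// memNset/=; first by ring.
    by move=> y0'; rewrite y0' ltxx in y0.
  - by rewrite sgr0 mem_set//=; ring.
rewrite E0 gauss_mean_pos// gauss_mean_neg// [(- s) ^+ e]exprNn.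
by move: ((-1) ^+ e) (s ^+ e) => a b; ring.
Qed.

(** [gauss_mean_sg] read backwards with [g] constant: the two half-lines contribute equally. *)
Lemma half_moment0 : half_moment 0 = 1 / 2.
Proof.
have := @gauss_mean_sg 1 0 (cst 1) ltr01 isT.
rewrite (_ : (fun _ => _) = cst 1); last by apply/funext => x; rewrite expr0 mulr1.
by rewrite gauss_mean_cst !expr0 /=; lra.
Qed.

Lemma half_moment2 : half_moment 2 = 1 / 2.
Proof.
have := @gauss_mean_sg 1 2 (cst 1) ltr01 isT.
rewrite (_ : (fun _ => _) = (fun x => x ^+ 2)); last by apply/funext => x; rewrite mulr1.
by rewrite gauss_mean_sqr sqrrN !expr1n /=; lra.
Qed.

(** On the half-line [x * expR (- (x ^+ 2 / 2))] has the primitive [- expR (- (x ^+ 2 / 2))], so its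
    integral is 1 and only the normalisation remains. *)
Lemma half_moment1 : half_moment 1 = (Num.sqrt (2 * pi))^-1.
Proof.
have F0 : forall x : R, is_derive x (1 : R) (fun x => - expR (- (x ^+ 2 / 2)))
    (x * expR (- (x ^+ 2 / 2))).
  by move=> x; apply: is_derive_eq; rewrite /GRing.scale/=; field.
have cF := is_derive_continuous F0.
have cx : continuous (fun x : R => x * expR (- (x ^+ 2 / 2))).
  move=> x; apply: cvgM; first exact: cvg_id.
  apply: (continuous_comp (f := fun x : R => - (x ^+ 2 / 2))); last exact: continuous_expR.
  by apply: cvgN; apply: cvgMr_tmp; exact: exprn_continuous.
have E : \int[lam]_(x in `[0, +oo[) (x * expR (- (x ^+ 2 / 2))) = 1.
  rewrite (@Rintegral_ge0_continuous_FTC2y _ _ (fun x => - expR (- (x ^+ 2 / 2))) 0 0).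
  - by rewrite expr0n/= mul0r oppr0 expR0 opprK add0r.
  - by move=> x x0; rewrite mulr_ge0// expR_ge0.
  - exact: continuous_subspaceT.
  - rewrite -oppr0; apply: cvgN.
    apply: (cvg_comp (fun x : R => x ^+ 2 / 2) (fun x => expR (- x))); last exact: cvgr_expR.
    by apply: gt0_cvgMly; [|exact: cvgr_expr2].
  - by move=> x _; case: (F0 x).
  - by apply: cvg_at_right_filter; exact: cF.
  - by move=> x _; rewrite derive1E; case: (F0 x).
have I : lam.-integrable `[0, +oo[ (EFin \o (fun x => x * expR (- (x ^+ 2 / 2)))).
  have c1 (x : R) : `|cst (1 : R) x| <= 1 by rewrite normr1.
  have H0 := integrableZl_real (normal_peak 1)^-1 measurableT
    (@integrable_gauss_pow 1 1 (cst 1) isT (measurable_cst _) c1).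
  apply: integrableS (subsetT _) _ => //.
  apply: eq_integrable H0 => // x _ /=; congr EFin.
  rewrite mulr1 mul1r expr1 normal_pdfE// /normal_fun subr0 mulNr expr1n.
  have := normal_peak_gt0 s01; set p := normal_peak 1 => p0.
  by rewrite mulrA mulrA mulVf ?gt_eqF// mul1r mulrC.
transitivity (normal_peak 1 * \int[lam]_(x in `[0, +oo[) (x * expR (- (x ^+ 2 / 2)))).
  rewrite -RintegralZl// [RHS]Rintegral_mkcond; apply: eq_Rintegral => x _.
  rewrite mul1r expr1 normal_pdfE// /normal_fun subr0 mulNr expr1n patchE indic_pos.
  rewrite (_ : (x \in `[0, +oo[%classic) = (0 <= x)); last first.
    by apply/idP/idP => [/set_mem|h]; [|apply/mem_set]; rewrite /= in_itv/= andbT.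
  have [x0|x0|<-] := ltgtP 0 x; rewrite ?mulr0 ?mul0r ?mulr0//=.
  by rewrite mulr1; ring.
by rewrite E mulr1 normal_peak1.
Qed.

End gaussian_moments.

(** * Brownian increments and areas *)

Section brownian_increments.
Context {d : measure_display} {T : measurableType d} {R : realType}.
Notation lam := (@lebesgue_measure R).
Variable P : probability T R.

Lemma normal_prob_gauss_mean (s : R) (A : set R) : s != 0 -> measurable A ->
  fine (normal_prob 0 s A) = gauss_mean s \1_A.
Proof.
move=> s0 mA.
have intp : lam.-integrable setT (EFin \o normal_pdf (0 : R) s).
  exact: integrable_normal_pdf.
have msc : measurable_fun setT (fun x : R => s * x) by exact: measurable_funM.
have := @cos_transform_unique _ _ _ _ _ lam lam (normal_pdf (0 : R) s) id
  (normal_pdf 0 1) (fun x => s * x) intp integrable_std_pdf (@measurable_id _ _ setT) msc.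
move=> H; rewrite [RHS](_ : _ = weighted_law lam (normal_pdf 0 1) (fun x => s * x) A)//.
rewrite -H//.
  rewrite /normal_prob -/(Rintegral lam A (normal_pdf 0 s)) /weighted_law Rintegral_mkcond.
  apply: eq_Rintegral => x _; rewrite patchE [\1_A _]indicE -[id x]/x.
  by case: (x \in A); rewrite ?mulr1 ?mulr0.
move=> th ph; rewrite /cos_transform normal_pdf_cos//.
rewrite -[RHS]/(gauss_mean s (fun x => cos (th * x + ph))) gauss_mean_cos.
by congr (_ * expR _); ring.
Qed.

Lemma gauss_mean0 (f : R -> R) : gauss_mean 0 f = f 0.
Proof.
rewrite -[RHS](gauss_mean_cst 0 (f 0)) /gauss_mean.
by apply: eq_Rintegral => x _; rewrite !mul0r.
Qed.

Lemma brownian_gaussian_law (B : R -> T -> R) (m : nat) (t : nat -> R) :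
  brownian_motion P B -> 0 <= t 0%N -> (forall j, (j < m)%N -> t j <= t j.+1) ->
  gaussian_law P m (fun j w => B (t j.+1) w - B (t j) w)
    (fun j => Num.sqrt (t j.+1 - t j)).
Proof.
move=> [mB _ _ BN Bind] t0 tle A mA.
have tge0 j : (j <= m)%N -> 0 <= t j.
  by elim: j => // j IH jm; apply: le_trans (tle j jm); apply: IH; exact: ltnW.
have mX j : (j < m)%N -> measurable_fun setT (fun w => B (t j.+1) w - B (t j) w).
  by move=> jm; apply: measurable_funB; apply: mB; apply: tge0 => //; exact: ltnW.
pose E j := (fun w => B (t j.+1) w - B (t j) w) @^-1` A j.
have mE j : (j < m)%N -> measurable (E j).
  by move=> jm; rewrite -[E j]setTI; apply: mX.
have law j : (j < m)%N -> fine (P (E j)) = gauss_mean (Num.sqrt (t j.+1 - t j)) \1_(A j).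
  (* Two equal consecutive times give a null increment and standard deviation 0; both sides are then
     the indicator of [A j] at 0. *)
  move=> jm; have := tle j jm; rewrite le_eqVlt => /predU1P[e|lt].
    rewrite e subrr sqrtr0 gauss_mean0 indicE.
    have [A0|A0] := boolP (0 \in A j).
      rewrite (_ : E j = setT) ?probability_setT//.
      by apply/seteqP; split => // w _; rewrite /E /= e subrr; exact: set_mem.
    rewrite (_ : E j = set0) ?measure0//.
    apply/seteqP; split => // w; rewrite /E /= e subrr => h.
    by move/negP : A0; apply; exact: mem_set.
  rewrite /E (BN _ _ (tge0 j (ltnW jm)) lt)// normal_prob_gauss_mean//.
  by rewrite gt_eqF// sqrtr_gt0 subr_gt0.
have := Bind m t t0 tle (fun i : 'I_m => E i).
rewrite /mutually_independent => /(_ _) H.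
transitivity (fine (P (\bigcap_(i in [set: 'I_m]) E i))).
  have mI : measurable (\bigcap_(i in [set: 'I_m]) E i).
    by apply: fin_bigcap_measurable => // i _; exact: mE.
  rewrite -(setIT (\bigcap_(i in _) _)) -integral_indic//.
  congr fine; apply: eq_integral => w _; congr EFin.
  rewrite big_mkord; have [/set_mem wI|wI] := boolP (w \in \bigcap_(i in [set: 'I_m]) E i).
    rewrite indicE mem_set// big1// => i _; rewrite indicE mem_set//.
    exact: wI.
  rewrite indicE (negbTE wI).
  have [i iA] : exists i : 'I_m, ~ A i (B (t i.+1) w - B (t i) w).
    apply/existsNP => h; move/negP : wI; apply; apply/mem_set => i _.
    exact: h.
  by rewrite (bigD1 i)//= indicE memNset// mul0r.
rewrite H; last first.
  by move=> i; exists (A i) => //; rewrite setTI.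
rewrite big_mkord (eq_bigr (fun i : 'I_m =>
  (gauss_mean (Num.sqrt (t i.+1 - t i)) \1_(A i))%:E)) ?prodEFin// => i _.
by rewrite -law// fineK//; exact: fin_num_measure (mE _ _).
Qed.

End brownian_increments.

(** * Riemann sums of continuous functions *)

Section riemann_sums.
Context {R : realType}.
Notation lam := (@lebesgue_measure R).

(** Compactness of the segment controls [x]; continuity on the whole line allows [y] to lie outside
    it. *)
Lemma segment_unif_continuous (f : R -> R) (a b e : R) : continuous f -> 0 < e ->
  exists2 del : R, 0 < del & forall x y, x \in `[a, b] -> `|x - y| < del ->
    `|f x - f y| < e.
Proof.
move=> cf e0.
have /compact_near_coveringP := @segment_compact R a b.
move=> /(_ R (0 : R)^'+ (fun del x => forall y, `|x - y| < del -> `|f x - f y| < e)).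
case=> [|del /= del0 H].
  move=> x _; have /cvgrPdist_lt /(_ (e / 2)) := cf x; rewrite divr_gt0// => /(_ isT).
  move=> [r /= r0 xr].
  exists (ball x (r / 2), [set z | z < r / 2]) => /=.
    split; first by apply: nbhsx_ballx; rewrite divr_gt0.
    by apply: nbhs_right_lt; rewrite divr_gt0.
  move=> [x' del]/= [xx' delr] y x'y.
  have h1 : `|f x - f x'| < e / 2.
    by apply: xr => /=; apply: lt_trans xx' _; lra.
  have h2 : `|f x - f y| < e / 2.
    apply: xr => /=; rewrite -(subrKA x') (le_lt_trans (ler_normD _ _))//.
    by move: xx'; rewrite /ball /= => xx'; lra.
  rewrite -(subrKA (f x)) (le_lt_trans (ler_normD _ _))//.
  by rewrite distrC in h1; lra.
exists (del / 2) => [|x y xab xy]; first by rewrite divr_gt0.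
apply: (H (del / 2)) => //=; [|by rewrite divr_gt0].
by rewrite sub0r normrN ger0_norm; lra.
Qed.

(** By the mean value theorem each cell contributes to the integral a value of [f] inside the cell
    times its length; uniform continuity compares this with the value at the right end. The
    primitive is differentiated only strictly to the right of [a], which suffices on open cells. *)
Lemma cvg_riemann_sum (f : R -> R) (a b : R) : continuous f -> a <= b ->
  (\sum_(0 <= k < n.+1) f (a + k.+1%:R * ((b - a) / n.+1%:R)) *
    ((b - a) / n.+1%:R)) @[n --> \oo] --> \int[lam]_(x in `[a, b]) f x.
Proof.
move=> cf; rewrite le_eqVlt => /predU1P[<-|ab].
  rewrite set_itv1 Rintegral_set1; apply: cvg_near_cst; near=> n.
  by rewrite big1// => k _; rewrite subrr mul0r mulr0.
pose F x := \int[lam]_(y in `[a, x]) f y.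
have intf u v : lam.-integrable `[u, v] (EFin \o f).
  apply: continuous_compact_integrable; first exact: segment_compact.
  exact: continuous_subspaceT.
have dF x : a < x -> is_derive x (1 : R) F (f x).
  move=> ax.
  have x1 : x < x + 1 by rewrite ltrDl.
  have [d1 d2] := @continuous_FTC1_closed R f a x (x + 1) x1 (intf _ _) ax (cf x).
  by apply: DeriveDef; [exact: d1|rewrite -derive1E; exact: d2].
have cF : {within `[a, b], continuous F}.
  exact: (parameterized_integral_continuous (ltW ab) (intf _ _)).
have Fa : F a = 0 by rewrite /F set_itv1 Rintegral_set1.
apply/cvgrPdist_lt => e e0.
have e1 : 0 < e / (b - a) by rewrite divr_gt0// subr_gt0.
have [del del0 fdel] := segment_unif_continuous a b cf e1.
near=> n; set h := (b - a) / n.+1%:R.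
have h0 : 0 < h by rewrite divr_gt0// subr_gt0.
have hdel : h < del.
  rewrite /h ltr_pdivrMr// mulrC -ltr_pdivrMr//.
  rewrite (lt_le_trans (truncnS_gt _))// ler_nat ltnS.
  by near: n; exists (Num.truncn ((b - a) / del)).
pose t k := a + k%:R * h.
have tn : t n.+1 = b by rewrite /t /h mulrC divfK ?pnatr_eq0// addrC subrK.
have tS k : t k.+1 = t k + h by rewrite /t -natr1; ring.
have ta k : a <= t k by rewrite lerDl mulr_ge0// ltW.
have tle k : (k <= n.+1)%N -> t k <= b.
  by move=> kn; rewrite -tn lerD2l ler_wpM2r ?ler_nat// ltW.
have Fsum : \int[lam]_(x in `[a, b]) f x = \sum_(0 <= k < n.+1) (F (t k.+1) - F (t k)).
  by rewrite telescope_sumr// tn /t mul0r addr0 Fa subr0.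
rewrite Fsum -sumrB.
apply: (@le_lt_trans _ _ (\sum_(0 <= k < n.+1)
    `|F (t k.+1) - F (t k) - f (a + k.+1%:R * h) * h|)); first exact: ler_norm_sum.
have -> : e = \sum_(0 <= k < n.+1) (e / (b - a) * h).
  rewrite sumr_const_nat subn0 /h -[RHS]mulr_natr -mulrA divfK ?pnatr_eq0//.
  by rewrite divfK// subr_eq0 gt_eqF.
apply: ltr_sum_nat => // k /andP[_ kn].
have tk : t k < t k.+1 by rewrite tS ltrDl.
have dFk x : x \in `]t k, t k.+1[ -> is_derive x (1 : R) F (f x).
  by rewrite in_itv/= => /andP[x1 _]; apply: dF; exact: le_lt_trans x1.
have cFk : {within `[t k, t k.+1], continuous F}.
  apply: continuous_subspaceW cF => x /=; rewrite !in_itv/= => /andP[x1 x2].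
  by rewrite (le_trans (ta k))//= (le_trans x2)// tle.
have [c] := MVT tk dFk cFk.
rewrite in_itv/= => /andP[c1 c2] ->.
have -> : t k.+1 - t k = h by rewrite tS addrC addKr.
rewrite -/(t k.+1) -mulrBl normrM (gtr0_norm h0).
rewrite ltr_pM2r// fdel//.
  by rewrite in_itv/= (le_trans (ta k) (ltW c1))/= (le_trans (ltW c2))// tle.
by rewrite ltr0_norm; rewrite tS in c2 *; lra.
Unshelve. all: by end_near. Qed.

End riemann_sums.

Lemma cvg_sum_nat {R : realType} (u : nat -> nat -> R) (l : nat -> R) (M : nat) :
  (forall m, u m n @[n --> \oo] --> l m) ->
  (\sum_(0 <= m < M) u m n) @[n --> \oo] --> \sum_(0 <= m < M) l m.
Proof.
move=> ul; elim: M => [|M IH].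
  by rewrite big_geq//; under eq_fun do rewrite big_geq//; exact: cvg_cst.
rewrite big_nat_recr//=; under eq_fun do rewrite big_nat_recr//=.
exact: cvgD.
Qed.

Section full_path.
Context {T : Type} {R : realType}.
Variable B : R -> T -> R.

(** The path frozen at its time-0 value for negative times, so that continuity holds on the whole
    line. *)
Definition full_path (w : T) (r : R) : R := B (Num.max 0 r) w.

Lemma continuous_full_path w :
  {within `[0, +oo[%classic, continuous (fun t => B t w)} -> continuous (full_path w).
Proof.
move=> /continuous_within_itvcyP[cB c0] r.
apply/cvgrPdist_lt => e e0; have [r0|r0|->] := ltgtP r 0.
- near=> t; rewrite /full_path !max_l ?subrr ?normr0// ltW//.
  by near: t; exact: lt_nbhsl.
- have rI : r \in `]0, +oo[ by rewrite in_itv/= r0.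
  have /cvgrPdist_lt /(_ e e0) ce := cB r rI.
  near=> t; rewrite /full_path !max_r ?(ltW r0)//; first by near: t.
  by rewrite ltW//; near: t; exact: lt_nbhsr.
- move/cvgrPdist_lt : c0 => /(_ e e0) ce.
  have {}ce : \forall t \near (0 : R), 0 < t -> `|B 0 w - B t w| < e by exact: ce.
  near=> t; rewrite /full_path maxxx; have [t0|t0] := leP t 0.
    by rewrite subrr normr0.
  by move: t0; near: t.
Unshelve. all: by end_near. Qed.

Lemma full_path_ge0 w r : 0 <= r -> full_path w r = B r w.
Proof. by move=> r0; rewrite /full_path max_r. Qed.

End full_path.

Section area_cf.
Context {d : measure_display} {T : measurableType d} {R : realType}.
Notation lam := (@lebesgue_measure R).
Variable P : probability T R.
Variable B : R -> T -> R.
Hypothesis BM : brownian_motion P B.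

Definition path_area (a b : R) (w : T) : R :=
  \int[lam]_(r in `[a, b]) (B r w - B a w).

(** The increment over cell [k] is counted once by each of the [N - k] right end points from that
    cell on. *)
Lemma abel_sum (u : nat -> R) (N : nat) :
  \sum_(0 <= k < N) (N%:R - k%:R) * (u k.+1 - u k) =
  \sum_(0 <= k < N) (u k.+1 - u 0%N).
Proof.
elim: N => [|N IH]; first by rewrite !big_geq.
rewrite big_nat_recr//= [RHS]big_nat_recr//= -IH.
transitivity (\sum_(0 <= k < N) ((N%:R - k%:R) * (u k.+1 - u k) + (u k.+1 - u k)) +
  (u N.+1 - u N)).
  congr (_ + _); last by rewrite -natr1; ring.
  by apply: eq_bigr => k _; rewrite -natr1; ring.
by rewrite big_split/= telescope_sumr// -addrA; congr (_ + _); ring.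
Qed.

Lemma Rintegral_sqr_affine (al be l : R) : 0 <= l ->
  \int[lam]_(x in `[0, l]) ((al + be * x) ^+ 2) =
  al ^+ 2 * l + al * be * l ^+ 2 + be ^+ 2 * l ^+ 3 / 3.
Proof.
rewrite le_eqVlt => /predU1P[<-|l0].
  by rewrite set_itv1 Rintegral_set1 !expr0n/=; ring.
pose F x : R := al ^+ 2 * x + al * be * x ^+ 2 + be ^+ 2 * x ^+ 3 / 3.
have dF (x : R) : is_derive x (1 : R) F ((al + be * x) ^+ 2).
  by rewrite /F; apply: is_derive_eq; rewrite /GRing.scale/=; field.
have cF : continuous F := is_derive_continuous dF.
have df (x : R) : is_derive x (1 : R) (fun x => (al + be * x) ^+ 2)
    (2 * be * (al + be * x)).
  by apply: is_derive_eq; rewrite /GRing.scale/=; ring.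
rewrite /Rintegral (@continuous_FTC2 _ (fun x => (al + be * x) ^+ 2) F 0 l l0).
- by rewrite /= /F !expr0n/=; ring.
- exact: continuous_subspaceT (is_derive_continuous df).
- split.
  + by move=> x _; case: (dF x).
  + by apply: cvg_at_right_filter; exact: cF.
  + by apply: cvg_at_left_filter; exact: cF.
- by move=> x _; rewrite derive1E; case: (dF x).
Qed.

Let cpath w : continuous (full_path B w).
Proof. by apply: continuous_full_path; case: BM. Qed.

Let mB t : 0 <= t -> measurable_fun setT (B t).
Proof. by case: BM => mB _ _ _ _; exact: mB. Qed.

Section area_grid.
Variables (M : nat) (a al be : nat -> R).
Hypothesis a0 : 0 <= a 0%N.
Hypothesis ale : forall m, a m <= a m.+1.

Let a_ge0 m : 0 <= a m.
Proof. by elim: m => // m IH; exact: le_trans IH (ale m). Qed.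

Section area_grid_size.
Variable n : nat.
Let N := n.+1.
Let step m := (a m.+1 - a m) / N%:R.

Let step_ge0 m : 0 <= step m.
Proof. by rewrite divr_ge0// subr_ge0. Qed.

Let N0 : (N%:R : R) != 0. Proof. by rewrite pnatr_eq0. Qed.

(** Blocks and cells are flattened into one index, quotient and remainder by [N], because
    independence of increments is given along a single increasing sequence of times. *)
Definition grid_time (j : nat) : R := a (j %/ N)%N + (j %% N)%:R * step (j %/ N)%N.

(* Summation by parts turns the Riemann sum of the area over block [m] into a
   combination of the increments over its [N] cells. *)
Definition grid_coef (j : nat) : R :=
  al (j %/ N)%N + be (j %/ N)%N * ((N%:R - (j %% N)%:R) * step (j %/ N)%N).

(** The bound on [k] is inclusive: the end of block [m] and the start of the next are the same time,
    though their quotients differ. *)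
Let grid_timeE m k : (k <= N)%N -> grid_time (m * N + k) = a m + k%:R * step m.
Proof.
rewrite leq_eqVlt => /predU1P[->|kN].
  rewrite /grid_time -mulSnr mulnK// modnMl mul0r addr0 mulrC divfK//.
  by rewrite addrC subrK.
by rewrite /grid_time divnMDl// modnMDl divn_small// modn_small// addn0.
Qed.

Let grid_coefE m k : (k < N)%N ->
  grid_coef (m * N + k) = al m + be m * ((N%:R - k%:R) * step m).
Proof.
by move=> kN; rewrite /grid_coef divnMDl// modnMDl divn_small// modn_small// addn0.
Qed.

Let grid_sum (F : nat -> R) : \sum_(0 <= j < M * N) F j =
  \sum_(0 <= m < M) \sum_(0 <= k < N) F (m * N + k)%N.
Proof.
rewrite big_nat_mul; apply: eq_bigr => m _.
rewrite -{1}(add0n (m * N)%N) mulSn big_addn addnK.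
by apply: eq_bigr => k _; rewrite addnC.
Qed.

Lemma grid_time_le j : grid_time j <= grid_time j.+1.
Proof.
rewrite {1 2}(divn_eq j N); set m := (j %/ N)%N; set k := (j %% N)%N.
have kN : (k < N)%N by rewrite ltn_mod.
rewrite -addnS !grid_timeE//; last exact: ltnW.
by rewrite lerD2l ler_wpM2r// ler_nat.
Qed.

Lemma grid_time0 : 0 <= grid_time 0.
Proof. by rewrite /grid_time div0n mod0n mul0r addr0. Qed.

Lemma grid_time_ge0 j : 0 <= grid_time j.
Proof. by elim: j => [|j IH]; [exact: grid_time0|exact: le_trans IH (grid_time_le j)]. Qed.

Definition grid_functional (w : T) : R := \sum_(0 <= j < M * N)
  grid_coef j * (B (grid_time j.+1) w - B (grid_time j) w).

Definition grid_variance : R := \sum_(0 <= j < M * N)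
  grid_coef j ^+ 2 * (grid_time j.+1 - grid_time j).

Lemma grid_cf ph : \int[P]_w cos (grid_functional w + ph) =
  cos ph * expR (- (grid_variance / 2)).
Proof.
have mX k : (k < M * N)%N -> measurable_fun setT
    (fun w => B (grid_time k.+1) w - B (grid_time k) w).
  by move=> _; apply: measurable_funB; apply: mB; exact: grid_time_ge0.
have := gaussian_law_cf mX (brownian_gaussian_law BM grid_time0
  (fun j _ => grid_time_le j)).
move=> /(_ grid_coef ph) ->; congr (_ * expR (- (_ / 2))).
by apply: eq_bigr => j _; rewrite sqr_sqrtr// subr_ge0 grid_time_le.
Qed.

Lemma measurable_grid_functional : measurable_fun setT grid_functional.
Proof.
apply: measurable_sum => j; apply: measurable_funM => //.
by apply: measurable_funB; apply: mB; exact: grid_time_ge0.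
Qed.

Lemma grid_functionalE w : grid_functional w = \sum_(0 <= m < M)
  (al m * (B (a m.+1) w - B (a m) w) + be m *
   \sum_(0 <= k < N) (full_path B w (a m + k.+1%:R * step m) - B (a m) w) * step m).
Proof.
rewrite /grid_functional grid_sum; apply: eq_bigr => m _.
pose u k := B (a m + k%:R * step m) w.
transitivity (\sum_(0 <= k < N) (al m * (u k.+1 - u k) +
    be m * step m * ((N%:R - k%:R) * (u k.+1 - u k)))).
  rewrite [LHS]big_nat [RHS]big_nat; apply: eq_bigr => k /andP[_ kN].
  by rewrite grid_coefE// -addnS !grid_timeE//; [rewrite /u; ring|exact: ltnW].
rewrite big_split/= -!mulr_sumr telescope_sumr// abel_sum; congr (_ * (_ - _) + _).
- by rewrite /u mulrC divfK// addrC subrK.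
- by rewrite /u mul0r addr0.
- rewrite -mulrA -mulr_suml [step m * _]mulrC; congr (_ * (_ * _)).
  apply: eq_bigr => k _; rewrite /u mul0r addr0 full_path_ge0//.
  by rewrite addr_ge0// mulr_ge0.
Qed.

(** Reversing the cells of a block turns the remaining time into elapsed time. The result is a
    Riemann sum over [[0, l]], written with explicit zeros to match [cvg_riemann_sum]. *)
Lemma grid_varianceE : grid_variance = \sum_(0 <= m < M) \sum_(0 <= k < N)
  (al m + be m * (0 + k.+1%:R * ((a m.+1 - a m - 0) / N%:R))) ^+ 2 *
  ((a m.+1 - a m - 0) / N%:R).
Proof.
rewrite /grid_variance grid_sum; apply: eq_bigr => m _.
rewrite big_nat_rev/= add0n [LHS]big_nat [RHS]big_nat.
apply: eq_bigr => k /andP[_ kN]; rewrite subr0 add0r -/(step m).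
have kN' : (N - k.+1 < N)%N by rewrite ltn_subrL.
rewrite grid_coefE// -addnS !grid_timeE//; last exact: ltnW.
have -> : (N%:R - (N - k.+1)%:R : R) = k.+1%:R by rewrite natrB// opprB addrC subrK.
congr (_ * _); rewrite -(natr1 (N - k.+1)); ring.
Qed.

End area_grid_size.

Definition block_functional (w : T) : R := \sum_(0 <= m < M)
  (al m * (B (a m.+1) w - B (a m) w) + be m * path_area (a m) (a m.+1) w).

(** Over a block of length [l], increment and unnormalised area have variances [l] and [l ^+ 3 / 3]
    and covariance [l ^+ 2 / 2]; distinct blocks are independent. *)
Definition block_variance : R := \sum_(0 <= m < M)
  let l := a m.+1 - a m in
  al m ^+ 2 * l + al m * be m * l ^+ 2 + be m ^+ 2 * l ^+ 3 / 3.

Lemma cvg_grid_functional w :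
  grid_functional n w @[n --> \oo] --> block_functional w.
Proof.
under eq_fun do rewrite grid_functionalE.
apply: (@cvg_sum_nat _ (fun m n => al m * (B (a m.+1) w - B (a m) w) + be m *
   \sum_(0 <= k < n.+1) (full_path B w (a m + k.+1%:R * ((a m.+1 - a m) / n.+1%:R)) -
   B (a m) w) * ((a m.+1 - a m) / n.+1%:R))) => m.
apply: cvgD; first exact: cvg_cst.
apply: cvgMl_tmp.
rewrite [path_area _ _ _](_ : _ =
   \int[lam]_(r in `[a m, a m.+1]) (full_path B w r - B (a m) w)).
  apply: (@cvg_riemann_sum _ (fun r => full_path B w r - B (a m) w)) => //.
  by move=> r; apply: cvgB; [exact: cpath|exact: cvg_cst].
apply: eq_Rintegral => r /set_mem; rewrite /= in_itv/= => /andP[ar _].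
by rewrite full_path_ge0// (le_trans (a_ge0 m)).
Qed.

Lemma cvg_grid_variance : grid_variance n @[n --> \oo] --> block_variance.
Proof.
under eq_fun do rewrite grid_varianceE.
apply: (@cvg_sum_nat _ (fun m n => \sum_(0 <= k < n.+1)
  (al m + be m * (0 + k.+1%:R * ((a m.+1 - a m - 0) / n.+1%:R))) ^+ 2 *
  ((a m.+1 - a m - 0) / n.+1%:R))) => m.
have l0 : 0 <= a m.+1 - a m by rewrite subr_ge0.
rewrite /= -Rintegral_sqr_affine//.
apply: (@cvg_riemann_sum _ (fun x => (al m + be m * x) ^+ 2)) => //.
have df (x : R) : is_derive x (1 : R) (fun x => (al m + be m * x) ^+ 2)
    (2 * be m * (al m + be m * x)).
  by apply: is_derive_eq; rewrite /GRing.scale/=; ring.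
exact: is_derive_continuous df.
Qed.

(** Cosines are bounded, so the identity for the discretised areas passes to the limit on both
    sides. *)
Lemma block_cf ph : \int[P]_w cos (block_functional w + ph) =
  cos ph * expR (- (block_variance / 2)).
Proof.
have h1 : \int[P]_w cos (grid_functional n w + ph) @[n --> \oo] -->
    \int[P]_w cos (block_functional w + ph).
  apply: (@cvg_Rintegral_dominated _ _ _ P setT
    (fun n w => cos (grid_functional n w + ph)) _ (cst 1)) => //.
  - move=> n; apply: (measurableT_comp (continuousT_measurable (@continuous_cos R))).
    by apply: measurable_funD => //; exact: measurable_grid_functional.
  - move=> w _; apply: (cvg_comp _ cos); last exact: continuous_cos.
    by apply: cvgD; [exact: cvg_grid_functional|exact: cvg_cst].
  - exact: finite_measure_integrable_cst.
  - by move=> n w _; exact: cos_max.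
have h2 : cos ph * expR (- (grid_variance n / 2)) @[n --> \oo] -->
    cos ph * expR (- (block_variance / 2)).
  apply: cvgMl_tmp; apply: (cvg_comp _ expR); last exact: continuous_expR.
  by apply: cvgN; apply: cvgMr_tmp; exact: cvg_grid_variance.
move: h1; under eq_fun do rewrite grid_cf.
by move/cvg_unique => /(_ (@norm_hausdorff _ _) _ h2).
Qed.

End area_grid.

End area_cf.

Section polynomial_integrals.
Context {R : realType}.
Notation lam := (@lebesgue_measure R).

Lemma continuous_integrable_itv (f : R -> R) (a b : R) : continuous f ->
  lam.-integrable `[a, b] (EFin \o f).
Proof.
move=> cf; apply: continuous_compact_integrable; first exact: segment_compact.
exact: continuous_subspaceT.
Qed.

(** Degree 4 is what products of two quadratic regression coefficients require. *)
Lemma Rintegral_quartic (c0 c1 c2 c3 c4 a b : R) : a <= b ->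
  \int[lam]_(x in `[a, b]) (c0 + c1 * (x - a) + c2 * (x - a) ^+ 2 +
    c3 * (x - a) ^+ 3 + c4 * (x - a) ^+ 4) =
  c0 * (b - a) + c1 * (b - a) ^+ 2 / 2 + c2 * (b - a) ^+ 3 / 3 +
    c3 * (b - a) ^+ 4 / 4 + c4 * (b - a) ^+ 5 / 5.
Proof.
rewrite le_eqVlt => /predU1P[<-|ab].
  by rewrite set_itv1 Rintegral_set1 subrr !expr0n/=; ring.
pose F x : R := c0 * (x - a) + c1 * (x - a) ^+ 2 / 2 + c2 * (x - a) ^+ 3 / 3 +
    c3 * (x - a) ^+ 4 / 4 + c4 * (x - a) ^+ 5 / 5.
pose f x : R := c0 + c1 * (x - a) + c2 * (x - a) ^+ 2 +
    c3 * (x - a) ^+ 3 + c4 * (x - a) ^+ 4.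
pose f' x : R := c1 + 2 * c2 * (x - a) + 3 * c3 * (x - a) ^+ 2 +
    4 * c4 * (x - a) ^+ 3.
have dF (x : R) : is_derive x (1 : R) F (f x).
  by rewrite /F /f; apply: is_derive_eq; rewrite /GRing.scale/=; field.
have df (x : R) : is_derive x (1 : R) f (f' x).
  by rewrite /f /f'; apply: is_derive_eq; rewrite /GRing.scale/=; field.
have cF : continuous F := is_derive_continuous dF.
rewrite /Rintegral (@continuous_FTC2 _ f F a b ab).
- by rewrite /= /F subrr !expr0n/=; ring.
- exact: continuous_subspaceT (is_derive_continuous df).
- split.
  + by move=> x _; case: (dF x).
  + by apply: cvg_at_right_filter; exact: cF.
  + by apply: cvg_at_left_filter; exact: cF.
- by move=> x _; rewrite derive1E; case: (dF x).
Qed.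

Lemma Rintegral_itv_split (f : R -> R) (a c b : R) : a <= c -> c <= b ->
  lam.-integrable `[a, b] (EFin \o f) ->
  \int[lam]_(x in `[a, b]) f x =
  \int[lam]_(x in `[a, c]) f x + \int[lam]_(x in `[c, b]) f x.
Proof.
move=> ac cb intf.
have := @Rintegral_itvB R f (BLeft a) (BRight b) c intf.
rewrite !bnd_simp => /(_ ac cb) E.
have -> : \int[lam]_(x in `[c, b]) f x = \int[lam]_(x in `]c, b]) f x.
  rewrite Rintegral_itv_obnd_cbnd//; apply: integrableS intf => //.
  by apply: subset_itvr; rewrite bnd_simp.
by rewrite -E addrC subrK.
Qed.

End polynomial_integrals.

Section path_area_lemmas.
Context {d : measure_display} {T : measurableType d} {R : realType}.
Notation lam := (@lebesgue_measure R).
Variable B : R -> T -> R.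
Hypothesis cB : forall w, {within `[0, +oo[%classic, continuous (fun t => B t w)}.

Let path_integrable (a b : R) (w : T) : 0 <= a ->
  lam.-integrable `[a, b] (EFin \o (fun r => B r w)).
Proof.
move=> a0; have := continuous_integrable_itv a b (continuous_full_path (@cB w)).
apply: eq_integrable => // r /set_mem; rewrite /= in_itv/= => /andP[ar _].
by rewrite full_path_ge0// (le_trans a0).
Qed.

Let area_integrable (a c b : R) (w : T) : 0 <= a ->
  lam.-integrable `[a, b] (EFin \o (fun r => B r w - B c w)).
Proof.
move=> a0; apply: integrableB_real => //; first exact: path_integrable.
by apply: continuous_integrable_itv => x; exact: cvg_cst.
Qed.

Let itv_length (a b c : R) : a <= b -> \int[lam]_(r in `[a, b]) c = c * (b - a).
Proof.
move=> ab; have := Rintegral_quartic c 0 0 0 0 ab; rewrite !mul0r !addr0 => <-.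
by apply: eq_Rintegral => r _; rewrite !mul0r !addr0.
Qed.

(** The area over [[c, b]] restarts from [B c], which leaves a rectangle of height [B c - B a]. *)
Lemma path_area_split (a c b : R) (w : T) : 0 <= a -> a <= c -> c <= b ->
  path_area B a b w =
  path_area B a c w + (b - c) * (B c w - B a w) + path_area B c b w.
Proof.
move=> a0 ac cb; have c0 := le_trans a0 ac.
rewrite /path_area (Rintegral_itv_split ac cb); last exact: area_integrable.
rewrite -addrA; congr (_ + _); rewrite mulrC -itv_length// -RintegralD//.
- by apply: eq_Rintegral => r _; ring.
- by apply: continuous_integrable_itv => x; exact: cvg_cst.
- exact: area_integrable.
Qed.

(** Convertible with [levy_area] at one coordinate, so the one-dimensional results apply to the
    statement by unfolding. *)
Definition levy1 (a b : R) (w : T) : R := (b - a)^-1 *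
  \int[lam]_(r in `[a, b]) (B r w - B a w - (r - a) / (b - a) * (B b w - B a w)).

Lemma levy1E (a b : R) (w : T) : 0 <= a -> a < b ->
  levy1 a b w = path_area B a b w / (b - a) - (B b w - B a w) / 2.
Proof.
move=> a0 ab; have ba : b - a != 0 by rewrite subr_eq0 gt_eqF.
rewrite /levy1 RintegralB//; last 2 first.
- exact: area_integrable.
- apply: continuous_integrable_itv => r; apply: cvgMr_tmp; apply: cvgMr_tmp.
  by apply: cvgB; [exact: cvg_id|exact: cvg_cst].
rewrite -/(path_area B a b w).
have -> : \int[lam]_(r in `[a, b]) ((r - a) / (b - a) * (B b w - B a w)) =
    (b - a) * (B b w - B a w) / 2.
  have := Rintegral_quartic 0 ((B b w - B a w) / (b - a)) 0 0 0 (ltW ab).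
  rewrite (_ : _ + _ / 5 = (b - a) * (B b w - B a w) / 2); last by field.
  by move=> <-; apply: eq_Rintegral => r _; field.
by field.
Qed.

Hypothesis mB : forall t, 0 <= t -> measurable_fun setT (B t).

(** The integral is a pointwise limit of Riemann sums. This argument works for any sigma-algebra on
    [T], in particular the one generated by a single path. *)
Lemma measurable_Rintegral_continuous (F : R -> T -> R) (a b : R) : a <= b ->
  (forall w, continuous (F ^~ w)) -> (forall r, measurable_fun setT (F r)) ->
  measurable_fun setT (fun w => \int[lam]_(r in `[a, b]) F r w).
Proof.
move=> ab cF mF.
apply: (@measurable_fun_cvg _ _ _ setT (fun n w => \sum_(0 <= k < n.+1)
  F (a + k.+1%:R * ((b - a) / n.+1%:R)) w * ((b - a) / n.+1%:R))).
  by move=> n; apply: measurable_sum => j; exact: measurable_funM.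
by move=> w _; exact: (cvg_riemann_sum (f := F ^~ w)).
Qed.

Lemma measurable_full_path (r : R) : measurable_fun setT (fun w => full_path B w r).
Proof. by apply: mB; rewrite le_max lexx. Qed.

Lemma measurable_path_area (a b : R) : 0 <= a -> a <= b ->
  measurable_fun setT (path_area B a b).
Proof.
move=> a0 ab; rewrite (_ : path_area B a b = fun w =>
    \int[lam]_(r in `[a, b]) (full_path B w r - B a w)).
  apply: measurable_Rintegral_continuous => //.
    by move=> w r; apply: cvgB; [exact: continuous_full_path|exact: cvg_cst].
  by move=> r; apply: measurable_funB; [exact: measurable_full_path|exact: mB].
apply/funext => w; apply: eq_Rintegral => r /set_mem; rewrite /= in_itv/= => /andP[ar _].
by rewrite full_path_ge0// (le_trans a0).
Qed.

Lemma measurable_levy1 (a b : R) : 0 <= a -> a < b -> measurable_fun setT (levy1 a b).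
Proof.
move=> a0 ab; rewrite (_ : levy1 a b = fun w =>
    path_area B a b w / (b - a) - (B b w - B a w) / 2).
  apply: measurable_funB; apply: measurable_funM => //.
    by apply: measurable_path_area => //; exact: ltW.
  by apply: measurable_funB; apply: mB => //; apply: le_trans a0 (ltW ab).
by apply/funext => w; rewrite levy1E.
Qed.

End path_area_lemmas.

(** * Gaussian decomposition of the path *)

Section bridge_decomposition.
Context {d : measure_display} {T : measurableType d} {R : realType}.
Notation lam := (@lebesgue_measure R).
Variable P : probability T R.
Variable B : R -> T -> R.
Hypothesis BM : brownian_motion P B.
Variables s t : R.
Hypothesis s0 : 0 <= s.
Hypothesis st : s < t.

Let cB w : {within `[0, +oo[%classic, continuous (fun t => B t w)}.
Proof. by case: BM. Qed.

Let h := t - s.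
Let k := h / 2.
Let u := (s + t) / 2.

Definition bridge_incr (w : T) : R := B t w - B s w.
Definition bridge_area (w : T) : R := levy1 B s t w.
Definition bridge_skew (w : T) : R := levy1 B s u w - levy1 B u t w.

(* The regression coefficients of [B r - B s] on the three variables above. *)
Definition coef_incr (r : R) : R := (r - s) / h.
Definition coef_area (r : R) : R := 6 * (r - s) * (t - r) / h ^+ 2.
Definition coef_skew (r : R) : R :=
  if r <= u then 3 * (r - s) * (u - r) / k ^+ 2
  else - (3 * (r - u) * (t - r) / k ^+ 2).

Definition residual (r : R) (w : T) : R := B r w - B s w -
  (coef_incr r * bridge_incr w + coef_area r * bridge_area w
   + coef_skew r * bridge_skew w).

Definition residual_var (r : R) : R := (r - s) - coef_incr r ^+ 2 * h -
  coef_area r ^+ 2 * (h / 12) - coef_skew r ^+ 2 * (h / 12).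

Let h0 : 0 < h. Proof. by rewrite subr_gt0. Qed.
Let k0 : 0 < k. Proof. by rewrite divr_gt0. Qed.
Let su : s < u. Proof. by case: (midf_lt st). Qed.
Let ut : u < t. Proof. by case: (midf_lt st). Qed.
Let u0 : 0 <= u. Proof. exact: le_trans s0 (ltW su). Qed.
Let uE : u = s + k. Proof. by rewrite /u /k /h; field. Qed.
Let tE : t = s + 2 * k. Proof. by rewrite /k /h; field. Qed.

(** The last time is the default value of [nth]: the mesh stays constant from index 3 on, hence is
    monotone at every index. *)
Let mesh (x y z w : R) (m : nat) : R := nth w [:: x; y; z] m.

Let mesh_le (x y z w : R) m : x <= y -> y <= z -> z <= w ->
  mesh x y z w m <= mesh x y z w m.+1.
Proof. by move=> xy yz zw; case: m => [|[|[|m]]] //=; rewrite /mesh/= !nth_nil. Qed.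

Let tri (x y z : R) (m : nat) : R := nth 0 [:: x; y; z] m.

Let sum3 (F : nat -> R) : \sum_(0 <= m < 3) F m = F 0%N + F 1%N + F 2%N.
Proof. by rewrite !big_nat_recl//= big_geq// addr0 addrA. Qed.

(** The variance of the linear combination when its four variables are uncorrelated. *)
Let target (r th0 th1 th2 th3 : R) : R := th0 ^+ 2 * residual_var r +
  th1 ^+ 2 * h + th2 ^+ 2 * (h / 12) + th3 ^+ 2 * (h / 12).

(** On the mesh [s, r, u, t] the combination is a block functional. That its block variance equals
    [target] is exactly the vanishing of all covariances, a rational identity in [x] and [k]. *)
Let cf_left (r th0 th1 th2 th3 ph : R) : s <= r -> r <= u ->
  \int[P]_w cos (th0 * residual r w + th1 * bridge_incr w +
    th2 * bridge_area w + th3 * bridge_skew w + ph) =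
  cos ph * expR (- (target r th0 th1 th2 th3 / 2)).
Proof.
move=> sr ru.
(* Expanding the residual leaves [q], [y], [z] on increment, area and skew area. Within a Lévy area
   over a longer interval, the increment of a cell has as coefficient the time from the end of the
   cell to the end of the interval, divided by the length of the interval, minus 1/2; these are the
   entries of [al]. *)
pose q := th1 - th0 * coef_incr r; pose y := th2 - th0 * coef_area r.
pose z := th3 - th0 * coef_skew r.
pose x := r - s.
pose al := tri (th0 + q + y * ((k - x + k) / h - 1 / 2) + z * ((k - x) / k - 1 / 2))
  (q - z / 2) (q - y / 2 + z / 2).
pose be := tri (y / h + z / k) (y / h + z / k) (y / h - z / k).
have hk : h = 2 * k by rewrite /k; field.
have kn : k != 0 by rewrite gt_eqF.
have -> : target r th0 th1 th2 th3 = block_variance 3 (mesh s r u t) al be.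
  rewrite /block_variance sum3 /mesh /al /be /tri /=.
  rewrite /target /residual_var /q /y /z /coef_incr /coef_area /coef_skew ru.
  rewrite (_ : t - r = 2 * k - x); last by rewrite tE /x; ring.
  rewrite (_ : u - r = k - x); last by rewrite uE /x; ring.
  rewrite (_ : t - u = k); last by rewrite tE uE; ring.
  by rewrite -/x !hk; field.
have mle m : mesh s r u t m <= mesh s r u t m.+1 by apply: mesh_le => //; exact: ltW.
rewrite -(@block_cf _ _ _ _ _ BM 3 (mesh s r u t) al be s0 mle).
apply: eq_Rintegral => w _; congr (cos (_ + _)).
rewrite /block_functional sum3 /mesh /al /be /tri /=.
rewrite /residual /bridge_incr /bridge_area /bridge_skew !(levy1E cB)//.
rewrite (path_area_split cB w s0 (le_trans sr ru) (ltW ut)).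
rewrite (path_area_split cB w s0 sr ru).
move: (path_area B s r w) (path_area B r u w) (path_area B u t w) => J0 J1 J2.
rewrite (_ : t - u = k); last by rewrite tE uE; ring.
rewrite (_ : u - s = k); last by rewrite uE; ring.
rewrite (_ : u - r = k - x); last by rewrite uE /x; ring.
rewrite -/h /q /y /z !hk; move: (coef_incr r) (coef_area r) (coef_skew r) => c1 c2 c3.
by move: (B s w) (B r w) (B u w) (B t w) => b0 b1 b2 b3; field.
Qed.

Let cf_right (r th0 th1 th2 th3 ph : R) : u < r -> r <= t ->
  \int[P]_w cos (th0 * residual r w + th1 * bridge_incr w +
    th2 * bridge_area w + th3 * bridge_skew w + ph) =
  cos ph * expR (- (target r th0 th1 th2 th3 / 2)).
Proof.
move=> ur rt.
pose q := th1 - th0 * coef_incr r; pose y := th2 - th0 * coef_area r.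
pose z := th3 - th0 * coef_skew r.
pose x := r - s.
pose al := tri (th0 + q - z / 2)
  (th0 + q + y * ((2 * k - x) / h - 1 / 2) - z * ((2 * k - x) / k - 1 / 2))
  (q - y / 2 + z / 2).
pose be := tri (y / h + z / k) (y / h - z / k) (y / h - z / k).
have hk : h = 2 * k by rewrite /k; field.
have kn : k != 0 by rewrite gt_eqF.
have -> : target r th0 th1 th2 th3 = block_variance 3 (mesh s u r t) al be.
  rewrite /block_variance sum3 /mesh /al /be /tri /=.
  rewrite /target /residual_var /q /y /z /coef_incr /coef_area /coef_skew leNgt ur /=.
  rewrite (_ : t - r = 2 * k - x); last by rewrite tE /x; ring.
  rewrite (_ : r - u = x - k); last by rewrite uE /x; ring.
  rewrite (_ : u - s = k); last by rewrite uE; ring.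
  by rewrite -/x !hk; field.
have mle m : mesh s u r t m <= mesh s u r t m.+1 by apply: mesh_le => //; exact: ltW.
rewrite -(@block_cf _ _ _ _ _ BM 3 (mesh s u r t) al be s0 mle).
apply: eq_Rintegral => w _; congr (cos (_ + _)).
rewrite /block_functional sum3 /mesh /al /be /tri /=.
rewrite /residual /bridge_incr /bridge_area /bridge_skew !(levy1E cB)//.
rewrite (path_area_split cB w s0 (ltW su) (ltW ut)).
rewrite (path_area_split cB w u0 (ltW ur) rt).
move: (path_area B s u w) (path_area B u r w) (path_area B r t w) => J0 J1 J2.
rewrite (_ : t - u = k); last by rewrite tE uE; ring.
rewrite (_ : u - s = k); last by rewrite uE; ring.
rewrite (_ : t - r = 2 * k - x); last by rewrite tE /x; ring.
rewrite -/h /q /y /z !hk; move: (coef_incr r) (coef_area r) (coef_skew r) => c1 c2 c3.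
by move: (B s w) (B r w) (B u w) (B t w) => b0 b1 b2 b3; field.
Qed.

Let joint_cf (r th0 th1 th2 th3 ph : R) : s <= r -> r <= t ->
  \int[P]_w cos (th0 * residual r w + th1 * bridge_incr w +
    th2 * bridge_area w + th3 * bridge_skew w + ph) =
  cos ph * expR (- (target r th0 th1 th2 th3 / 2)).
Proof.
by move=> sr rt; have [ru|ur] := leP r u; [exact: cf_left|exact: cf_right].
Qed.

Let mB r : 0 <= r -> measurable_fun setT (B r).
Proof. by case: BM => mB _ _ _ _; exact: mB. Qed.

Let t0 : 0 <= t. Proof. exact: le_trans s0 (ltW st). Qed.

Lemma measurable_bridge_incr : measurable_fun setT bridge_incr.
Proof. by apply: measurable_funB; exact: mB. Qed.

Lemma measurable_bridge_area : measurable_fun setT bridge_area.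
Proof. exact: measurable_levy1. Qed.

Lemma measurable_bridge_skew : measurable_fun setT bridge_skew.
Proof. by apply: measurable_funB; exact: measurable_levy1. Qed.

Lemma measurable_residual r : s <= r -> measurable_fun setT (residual r).
Proof.
move=> sr; apply: measurable_funB.
  by apply: measurable_funB; apply: mB => //; exact: le_trans sr.
have mi := measurable_bridge_incr; have ma := measurable_bridge_area.
have ms := measurable_bridge_skew.
by do 2 (apply: measurable_funD; last exact: measurable_funM); exact: measurable_funM.
Qed.

(** The joint transform at frequency [(1, 0, 0, 0)] is the mean of a cosine, hence at most 1; no
    inequality between polynomials is studied. *)
Lemma residual_var_ge0 r : s <= r -> r <= t -> 0 <= residual_var r.
Proof.
move=> sr rt; have := joint_cf 1 0 0 0 0 sr rt.
rewrite cos0 mul1r /target expr1n expr0n/= mul1r !mul0r !addr0 => E.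
have : expR (- (residual_var r / 2)) <= 1.
  rewrite -E -[leRHS](_ : \int[P]_w cst 1 w = 1).
    apply: le_Rintegral => //; last by move=> w _; exact: cos_le1.
    - apply: (@integrable_prob_bounded _ _ _ P _ 1); last by move=> w; exact: cos_max.
      apply: (measurableT_comp (continuousT_measurable (@continuous_cos R))).
      rewrite (_ : (fun w => _) = residual r); first exact: measurable_residual.
      by apply/funext => w; rewrite mul1r !mul0r !addr0.
    - exact: finite_measure_integrable_cst.
  rewrite /Rintegral/= integral_cst// mul1e -[RHS]/(fine 1%E).
  by congr fine; exact: probability_setT.
rewrite -[X in _ <= X -> _]expR0 ler_expR => ?.
by lra.
Qed.

Definition bridge_family (r : R) (j : nat) (w : T) : R :=
  nth 0 [:: residual r w; bridge_incr w; bridge_area w; bridge_skew w] j.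

Definition bridge_sd (r : R) (j : nat) : R :=
  Num.sqrt (nth 0 [:: residual_var r; h; h / 12; h / 12] j).

Lemma measurable_bridge_family r j : s <= r -> measurable_fun setT (bridge_family r j).
Proof.
move=> sr; case: j => [|[|[|[|j]]]].
- exact: measurable_residual.
- exact: measurable_bridge_incr.
- exact: measurable_bridge_area.
- exact: measurable_bridge_skew.
- rewrite (_ : bridge_family r _ = cst 0); first exact: measurable_cst.
  by apply/funext => w; rewrite /bridge_family/= nth_nil.
Qed.

Lemma bridge_family_gaussian r : s <= r -> r <= t ->
  gaussian_law P 4 (bridge_family r) (bridge_sd r).
Proof.
move=> sr rt; apply: gaussian_cf_law.
  by move=> j _; exact: measurable_bridge_family.
have sum4 (F : nat -> R) : \sum_(0 <= m < 4) F m = F 0%N + F 1%N + F 2%N + F 3%N.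
  by rewrite !big_nat_recl//= big_geq// addr0 !addrA.
have hh : 0 <= h by exact: ltW.
have h12 : 0 <= h / 12 by rewrite divr_ge0.
move=> th ph; rewrite sum4 /bridge_sd/= !sqr_sqrtr ?residual_var_ge0//.
rewrite -[X in expR (- (X / 2))]/(target r (th 0%N) (th 1%N) (th 2%N) (th 3%N)).
by rewrite -joint_cf//; apply: eq_Rintegral => w _; rewrite sum4.
Qed.

End bridge_decomposition.

(** * Moments against bounded weights *)

(** Monotone convergence: the means of bounded truncations can be computed from the law before
    integrability is known. *)
Lemma ge0_integrable_truncation {d : measure_display} {T : measurableType d}
    {R : realType} (P : probability T R) (f : T -> R) (C : R) :
  measurable_fun setT f -> (forall x, 0 <= f x) ->
  (forall N : nat, \int[P]_x Num.min (f x) N%:R <= C) ->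
  P.-integrable setT (EFin \o f).
Proof.
move=> mf f0 fC.
have mmin (N : nat) : measurable_fun setT (fun x => Num.min (f x) N%:R).
  by apply: measurable_minr.
have min0 (N : nat) x : 0 <= Num.min (f x) N%:R by rewrite le_min f0 ler0n.
have intmin (N : nat) : P.-integrable setT (EFin \o (fun x => Num.min (f x) N%:R)).
  apply: (@integrable_prob_bounded _ _ _ P _ N%:R) => // x.
  by rewrite ger0_norm// ge_min lexx orbT.
apply/integrableP; split; first exact/measurable_EFinP.
under eq_integral do rewrite /= ger0_norm//.
apply: (@le_lt_trans _ _ C%:E); last exact: ltry.
have cvgf x : (Num.min (f x) N%:R)%:E @[N --> \oo] --> (f x)%:E.
  apply: cvg_near_cst; near=> N; congr EFin; apply: min_l.
  apply: le_trans (ltW (truncnS_gt _)) _; rewrite ler_nat.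
  by near: N; exists (Num.truncn (f x)).+1.
rewrite (_ : (fun x => (f x)%:E) = fun x => limn (fun N => (Num.min (f x) N%:R)%:E)).
  rewrite (@monotone_convergence _ _ _ P setT measurableT
    (fun N x => (Num.min (f x) N%:R)%:E)).
  - apply: lime_le.
      apply: ereal_nondecreasing_is_cvgn => m n mn; apply: ge0_le_integral => //=.
      + by move=> x _; rewrite lee_fin.
      + exact/measurable_EFinP.
      + exact/measurable_EFinP.
      + by move=> x _; rewrite lee_fin le_min ge_min lexx/= ge_min ler_nat mn orbT.
    near=> N; have := fC N; rewrite -lee_fin; apply: le_trans.
    by rewrite /Rintegral fineK//; exact: integrable_fin_num (intmin N).
  - by move=> N; exact/measurable_EFinP.
  - by move=> N x _; rewrite lee_fin.
  - move=> x _ m n mn; rewrite lee_fin le_min ge_min lexx/= ge_min ler_nat mn.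
    by rewrite orbT.
by apply/funext => x; apply/esym/cvg_lim.
Unshelve. all: by end_near. Qed.

Section gaussian_monomials.
Context {d : measure_display} {T : measurableType d} {R : realType}.
Notation lam := (@lebesgue_measure R).
Variable P : probability T R.
Variables (n : nat) (X : nat -> T -> R) (s : nat -> R).
Hypothesis mX : forall k, (k < n)%N -> measurable_fun [set: T] (X k).
Hypothesis lawX : gaussian_law P n X s.

Lemma gaussian_law_marginal (k : nat) (B : set R) : (k < n)%N -> measurable B ->
  weighted_law P (cst 1) (X k) B =
  weighted_law lam (normal_pdf 0 1) (fun x => s k * x) B.
Proof.
move=> kn mB; pose B' i := if i == k then B else setT.
have mB' i : measurable (B' i) by rewrite /B'; case: ifP.
have := lawX mB'.
rewrite (eq_bigr (fun i => if i == k then gauss_mean (s i) \1_B else 1)); last first.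
  move=> i _; rewrite /B'; case: ifP => // _.
  rewrite (_ : \1_setT = fun=> 1) ?gauss_mean_cst//.
  by apply/funext => x; rewrite indicT.
rewrite -big_mkcond big_nat1_eq kn leq0n andbT => E.
transitivity (gauss_mean (s k) \1_B) => //; transitivity (if true then gauss_mean (s k) \1_B else 1) => //.
rewrite -E.
apply: eq_Rintegral => w _; rewrite mul1r.
rewrite (eq_bigr (fun i => if i == k then \1_B (X i w) else 1)).
  by rewrite -big_mkcond big_nat1_eq kn.
by move=> i _; rewrite /B'; case: ifP => // _; rewrite indicT.
Qed.

(** [weighted_law_fun] presupposes integrability, so it is applied to [Num.min (x ^+ 2) N%:R], whose
    Gaussian mean is at most [s k ^+ 2]. *)
Lemma integrable_gaussian_sqr (k : nat) : (k < n)%N ->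
  P.-integrable setT (EFin \o (fun w => X k w ^+ 2)).
Proof.
move=> kn; have mk := mX kn.
have intsqr : lam.-integrable setT
    (EFin \o (fun x => normal_pdf 0 1 x * (s k * x) ^+ 2)).
  have := @integrable_gauss_pow R (s k) 2 (cst 1) isT (measurable_cst _) _.
  under eq_fun do rewrite /= mulr1.
  by apply => x; rewrite normr1.
apply: (@ge0_integrable_truncation _ _ _ P _ (s k ^+ 2)).
- exact: measurable_funX.
- by move=> w; exact: sqr_ge0.
move=> N; have mf : measurable_fun setT (fun x : R => Num.min (x ^+ 2) N%:R).
  by apply: measurable_minr => //; exact: measurable_funX.
have f0 (x : R) : 0 <= Num.min (x ^+ 2) N%:R by rewrite le_min sqr_ge0 ler0n.
have fN (x : R) : `|Num.min (x ^+ 2) N%:R| <= N%:R.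
  by rewrite ger0_norm// ge_min lexx orbT.
have int1 : P.-integrable setT (EFin \o cst (1 : R)).
  exact: finite_measure_integrable_cst.
have msc : measurable_fun setT (fun x : R => s k * x) by exact: measurable_funM.
have intg := @integrable_gauss_bounded R (s k) _ _ mf fN.
have := @weighted_law_fun _ _ _ _ _ _ _ P lam (cst 1) (normal_pdf 0 1) (X k)
  (fun x => s k * x) int1 integrable_std_pdf mk msc
  (fun B mB => gaussian_law_marginal kn mB) _ mf.
move=> E; rewrite -(gauss_mean_sqr (s k)).
under eq_Rintegral do rewrite -[Num.min _ _]mul1r.
rewrite E//; last first.
  apply: (@integrable_prob_bounded _ _ _ P _ N%:R) => [|w]; last by rewrite mul1r.
  by apply: measurable_funM => //; exact: (measurableT_comp mf).
apply: le_Rintegral => // x _.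
by rewrite ler_wpM2l ?normal_pdf_ge0// ge_min lexx.
Qed.

Let bound (w : T) : R := 1 + \sum_(0 <= i < n) X i w ^+ 2.

Let bound_ge1 w : 1 <= bound w.
Proof. by rewrite lerDl sumr_ge0// => i _; exact: sqr_ge0. Qed.

Let le_bound i w : (i < n)%N -> `|X i w| <= Num.sqrt (bound w).
Proof.
move=> lin; rewrite -sqrtr_sqr ler_wsqrtr// /bound.
rewrite (bigD1_seq i) ?iota_uniq ?mem_index_iota//=.
rewrite addrCA lerDl addr_ge0// sumr_ge0// => j _; exact: sqr_ge0.
Qed.

Variables (e : nat -> nat) (g : nat -> R -> R).
Hypothesis e2 : (\sum_(0 <= i < n) e i <= 2)%N.
Hypothesis mg : forall i, measurable_fun setT (g i).
Hypothesis g1 : forall i x, `|g i x| <= 1.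

(** Each variable is at most the square root of [bound], which is at least 1, so a monomial of total
    degree at most 2 is at most [bound]. *)
Let int_prefix j : (j <= n)%N -> P.-integrable setT
  (EFin \o (fun w => \prod_(0 <= i < j) (X i w ^+ e i * g i (X i w)))).
Proof.
move=> jn; apply: (@le_integrable_real _ _ _ P setT _ bound) => //.
- rewrite (_ : (fun w => _) = (fun w => \prod_(0 <= i < j)
    (if (i < n)%N then X i w ^+ e i * g i (X i w) else 1))).
    apply: measurable_prod => i _; case: (boolP (i < n)%N) => lin; last exact: measurable_cst.
    apply: measurable_funM; first by apply: measurable_funX; exact: mX.
    by apply: (measurableT_comp (mg i)); exact: mX.
  apply/funext => w; rewrite [LHS]big_nat [RHS]big_nat.
  by apply: eq_bigr => k /andP[_ kj]; rewrite (leq_trans kj jn).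
- move=> w _; rewrite normr_prod.
  apply: (@le_trans _ _ (\prod_(0 <= i < j) Num.sqrt (bound w) ^+ e i)).
    rewrite big_nat [leRHS]big_nat; apply: ler_prod => i /andP[_ ij].
    rewrite normr_ge0/= normrM -[leRHS]mulr1 ler_pM// normrX lerXn2r ?nnegrE//.
    by apply: le_bound; exact: leq_trans ij jn.
  rewrite prodrXr; have sb : 1 <= Num.sqrt (bound w).
    by rewrite -{1}sqrtr1 ler_wsqrtr.
  apply: (@le_trans _ _ (Num.sqrt (bound w) ^+ 2)).
    rewrite ler_weXn2l//; apply: leq_trans e2.
    by rewrite [leqRHS](@big_cat_nat _ _ _ j)//= leq_addr.
  by rewrite sqr_sqrtr// (le_trans ler01).
- apply: integrableD_real => //; first exact: finite_measure_integrable_cst.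
  rewrite (_ : (fun w => _) = (fun w => \sum_(0 <= i < n)
    (if (i < n)%N then X i w ^+ 2 else 0))).
    apply: integrable_sum_real => // i; case: (boolP (i < n)%N) => lin.
      exact: integrable_gaussian_sqr.
    exact: finite_measure_integrable_cst.
  apply/funext => w; rewrite [LHS]big_nat [RHS]big_nat.
  by apply: eq_bigr => k /andP[_ ->].
Qed.

Let e2i i : (i < n)%N -> (e i <= 2)%N.
Proof.
move=> lin; apply: leq_trans e2.
by rewrite (bigD1_seq i) ?iota_uniq ?mem_index_iota//= leq_addr.
Qed.

Lemma integrable_gaussian_monomial : P.-integrable setT
  (EFin \o (fun w => \prod_(0 <= i < n) (X i w ^+ e i * g i (X i w)))).
Proof. exact: int_prefix. Qed.

Lemma gaussian_monomial :
  \int[P]_w \prod_(0 <= i < n) (X i w ^+ e i * g i (X i w)) =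
  \prod_(0 <= i < n) gauss_mean (s i) (fun x => x ^+ e i * g i x).
Proof.
(* Exponents are controlled only below [n]; beyond it the functions are set to 0 to meet the
   integrability hypotheses at every index. *)
pose f i x := if (i < n)%N then x ^+ e i * g i x else 0.
have fE i x : (i < n)%N -> f i x = x ^+ e i * g i x by rewrite /f => ->.
have := @gaussian_law_fun _ _ _ P n X s mX lawX f.
have -> : \prod_(0 <= k < n) gauss_mean (s k) (f k) =
    \prod_(0 <= i < n) gauss_mean (s i) (fun x => x ^+ e i * g i x).
  rewrite [LHS]big_nat [RHS]big_nat; apply: eq_bigr => i /andP[_ lin].
  by congr gauss_mean; apply/funext => x; rewrite fE.
move=> <-.
- apply: eq_Rintegral => w _; rewrite [LHS]big_nat [RHS]big_nat.
  by apply: eq_bigr => i /andP[_ lin]; rewrite fE.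
- move=> i; rewrite /f; case: (boolP (i < n)%N) => lin; last exact: measurable_cst.
  by apply: measurable_funM => //; exact: exprn_measurable.
- move=> i; rewrite /f; case: (boolP (i < n)%N) => lin.
    by apply: integrable_gauss_pow => //; exact: e2i.
  apply: (@integrable_gauss_bounded _ (s i) (cst 0) 0); first exact: measurable_cst.
  by move=> x; rewrite normr0.
- move=> j jn; have := int_prefix jn; apply: eq_integrable => // w _.
  congr EFin; rewrite [LHS]big_nat [RHS]big_nat.
  by apply: eq_bigr => i /andP[_ lij]; rewrite fE// (leq_trans lij jn).
Qed.

End gaussian_monomials.

(** * Joint measurability in time and sample point *)

Section joint_measurability.
Context {d : measure_display} {T : measurableType d} {R : realType}.
Variable B : R -> T -> R.
Hypothesis cB : forall w, {within `[0, +oo[%classic, continuous (fun t => B t w)}.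
Hypothesis mB : forall t, 0 <= t -> measurable_fun setT (B t).

Let clock (n : nat) (r : R) : nat := Num.truncn (n.+1%:R * Num.max 0 r).

Let clock_cvg r : (clock n r)%:R / n.+1%:R @[n --> \oo] --> Num.max 0 r.
Proof.
set x := Num.max 0 r; have x0 : 0 <= x by rewrite le_max lexx.
apply: (@squeeze_cvgr _ _ _ _ (fun n => x - n.+1%:R^-1) (fun=> x)); last 2 first.
- rewrite -[X in _ --> X]subr0; apply: cvgB; first exact: cvg_cst.
  exact: cvg_harmonic.
- exact: cvg_cst.
near=> n; have n0 : 0 < n.+1%:R :> R by rewrite ltr0n.
have /andP[h1 h2] : (clock n r)%:R <= n.+1%:R * x < (clock n r).+1%:R.
  by apply: truncn_itv; rewrite mulr_ge0.
rewrite ler_pdivrMr// [x * _]mulrC h1 andbT.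
rewrite ler_pdivlMr// mulrBl mulVf ?gt_eqF// [x * _]mulrC lerBlDr.
by rewrite natr1 ltW.
Unshelve. all: by end_near. Qed.

(** By continuity the path is the limit of its samples at the times [clock n r / n.+1], which take
    countably many values. *)
Lemma measurable_full_path_joint :
  measurable_fun [set: R * T] (fun z => full_path B z.2 z.1).
Proof.
apply: (@measurable_fun_cvg _ _ _ setT
  (fun n z => B ((clock n z.1)%:R / n.+1%:R) z.2)); last first.
  move=> z _; rewrite -[full_path _ _ _](_ : full_path B z.2 (Num.max 0 z.1) = _).
    have -> : (fun n => B ((clock n z.1)%:R / n.+1%:R) z.2) =
        (fun n => full_path B z.2 ((clock n z.1)%:R / n.+1%:R)).
      by apply/funext => n; rewrite full_path_ge0// divr_ge0.
    apply: (cvg_comp _ (full_path B z.2)); first exact: clock_cvg.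
    exact: (continuous_full_path (@cB z.2)).
  by rewrite /full_path maxA maxxx.
move=> n _ A mA; rewrite setTI.
have mphi : measurable_fun [set: R * T] (fun z : R * T => n.+1%:R * Num.max 0 z.1).
  by apply: measurable_funM => //; exact: measurable_maxr.
(* The event is split according to the value [m] of the clock; on each piece the path is read at a
   fixed time. *)
rewrite (_ : _ @^-1` _ = \bigcup_m
  ((fun z : R * T => n.+1%:R * Num.max 0 z.1) @^-1` `[m%:R, m.+1%:R[ `&`
   (fun z : R * T => B (m%:R / n.+1%:R) z.2) @^-1` A)).
  apply: bigcupT_measurable => m; apply: measurableI.
    by rewrite -[_ @^-1` _]setTI; apply: mphi => //; exact: measurable_itv.
  rewrite -[_ @^-1` _]setTI.
  have mBm : measurable_fun [set: R * T] (fun z : R * T => B (m%:R / n.+1%:R) z.2).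
    by apply: (measurableT_comp (mB _)); first exact: divr_ge0.
  exact: mBm.
have p0 (r : R) : 0 <= n.+1%:R * Num.max 0 r by rewrite mulr_ge0// le_max lexx.
apply/seteqP; split => z /=.
  move=> Az; exists (clock n z.1) => //; split => //=.
  by rewrite in_itv/=; exact: truncn_itv.
move=> [m _ [/=]]; rewrite in_itv/= => zm Am.
by rewrite /clock (truncn_def zm).
Qed.

End joint_measurability.

Section quadratic_form_integral.
Context {R : realType}.
Notation lam := (@lebesgue_measure R).

(** [A], [C] and [E] stand for the increment, area and skew coefficients on one half of the
    interval. There is no square of [E], since those terms cancel. *)
Lemma Rintegral_quadratic_forms (l0 l1 a0 a1 b0 b1 b2 e0 e1 e2 Kaa Kbb Kab Kac Kbc a b : R)
  (f : R -> R) : a <= b ->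
  (forall r, r \in `[a, b]%R -> f r = (let y := r - a in
     let A := a0 + a1 * y in let C := b0 + b1 * y + b2 * y ^+ 2 in
     let E := e0 + e1 * y + e2 * y ^+ 2 in
     l0 + l1 * y + Kaa * A ^+ 2 + Kbb * C ^+ 2 + Kab * A * C + Kac * A * E + Kbc * C * E)) ->
  \int[lam]_(r in `[a, b]) f r = (let l := b - a in
    (l0 + Kaa * a0 ^+ 2 + Kbb * b0 ^+ 2 + Kab * a0 * b0 + Kac * a0 * e0 + Kbc * b0 * e0) * l
  + (l1 + Kaa * (2 * a0 * a1) + Kbb * (2 * b0 * b1) + Kab * (a0 * b1 + a1 * b0)
      + Kac * (a0 * e1 + a1 * e0) + Kbc * (b0 * e1 + b1 * e0)) * l ^+ 2 / 2
  + (Kaa * a1 ^+ 2 + Kbb * (b1 ^+ 2 + 2 * b0 * b2) + Kab * (a0 * b2 + a1 * b1)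
      + Kac * (a0 * e2 + a1 * e1) + Kbc * (b0 * e2 + b1 * e1 + b2 * e0)) * l ^+ 3 / 3
  + (Kbb * (2 * b1 * b2) + Kab * (a1 * b2) + Kac * (a1 * e2)
      + Kbc * (b1 * e2 + b2 * e1)) * l ^+ 4 / 4
  + (Kbb * b2 ^+ 2 + Kbc * (b2 * e2)) * l ^+ 5 / 5).
Proof.
move=> ab fE /=; rewrite -Rintegral_quartic//; apply: eq_Rintegral => r /set_mem rab.
by rewrite fE//=; ring.
Qed.

End quadratic_form_integral.

Section conditional_moments.
Context {d : measure_display} {T : measurableType d} {R : realType}.
Notation lam := (@lebesgue_measure R).
Variable P : probability T R.
Variable B : R -> T -> R.
Hypothesis BM : brownian_motion P B.
Variables s t : R.
Hypothesis s0 : 0 <= s.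
Hypothesis st : s < t.

Let h := t - s.
Let W := bridge_incr B s t.
Let H := bridge_area B s t.
Let D := bridge_skew B s t.

Let h0 : 0 < h. Proof. by rewrite subr_gt0. Qed.
Let h12 : 0 < h / 12. Proof. by rewrite divr_gt0. Qed.

Lemma measurable_sg : measurable_fun setT (Num.sg : R -> R).
Proof.
rewrite (_ : Num.sg = fun x : R => \1_(`]0, +oo[) x - \1_(`]-oo, 0[) x).
  by apply: measurable_funB; apply: measurable_indic.
apply/funext => x; rewrite indic_pos indic_neg.
by have [x0|x0|->] := ltgtP x 0; rewrite ?(ltr0_sg x0) ?(gtr0_sg x0) ?sgr0 /=; ring.
Qed.

Section weights.
Variables g1 g2 g3 : R -> R.
Hypothesis mg1 : measurable_fun setT g1.
Hypothesis mg2 : measurable_fun setT g2.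
Hypothesis mg3 : measurable_fun setT g3.
Hypothesis g1_le : forall x, `|g1 x| <= 1.
Hypothesis g2_le : forall x, `|g2 x| <= 1.
Hypothesis g3_le : forall x, `|g3 x| <= 1.

(** Ordered as [bridge_family]: the residual is not observed and has weight 1, and the skew area is
    observed through its sign only. *)
Let g (i : nat) : R -> R := nth (cst 1) [:: cst 1; g1; g2; g3 \o Num.sg] i.

Let mg i : measurable_fun setT (g i).
Proof.
case: i => [|[|[|[|i]]]]; rewrite /g/= ?nth_nil//.
exact: (measurableT_comp mg3 measurable_sg).
Qed.

Let g_le i x : `|g i x| <= 1.
Proof.
by case: i => [|[|[|[|i]]]]; rewrite /g/= ?nth_nil ?normr1.
Qed.

Definition bridge_weight (w : T) : R := g1 (W w) * g2 (H w) * g3 (Num.sg (D w)).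

Definition incr_moment (e : nat) : R := gauss_mean (Num.sqrt h) (fun x => x ^+ e * g1 x).
Definition area_moment (e : nat) : R :=
  gauss_mean (Num.sqrt (h / 12)) (fun x => x ^+ e * g2 x).
Definition skew_moment (e : nat) : R :=
  gauss_mean (Num.sqrt (h / 12)) (fun x => x ^+ e * g3 (Num.sg x)).

Let prod4 (F : nat -> R) : \prod_(0 <= m < 4) F m = F 0%N * F 1%N * F 2%N * F 3%N.
Proof. by rewrite !big_nat_recl//= big_geq// mulr1 !mulrA. Qed.

Let residual_moment r (e : nat) : R :=
  gauss_mean (Num.sqrt (residual_var s t r)) (fun x => x ^+ e * 1).

Let monomial r (e : nat -> nat) (w : T) : R := \prod_(0 <= i < 4)
  (bridge_family B s t r i w ^+ e i * g i (bridge_family B s t r i w)).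

Let monomialE r e w : monomial r e w = residual B s t r w ^+ e 0%N *
  W w ^+ e 1%N * H w ^+ e 2%N * D w ^+ e 3%N * bridge_weight w.
Proof. by rewrite /monomial prod4 /bridge_family /g /bridge_weight /=; ring. Qed.

Let int_monomial r (e : nat -> nat) : s <= r -> r <= t ->
  (\sum_(0 <= i < 4) e i <= 2)%N ->
  P.-integrable setT (EFin \o monomial r e) /\
  \int[P]_w monomial r e w = residual_moment r (e 0%N) * incr_moment (e 1%N) *
    area_moment (e 2%N) * skew_moment (e 3%N).
Proof.
move=> sr rt e2.
have mX j : (j < 4)%N -> measurable_fun setT (bridge_family B s t r j).
  by move=> _; exact: (measurable_bridge_family BM).
have law := bridge_family_gaussian BM s0 st sr rt.
split; first exact: (integrable_gaussian_monomial mX law e2 mg g_le).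
rewrite (gaussian_monomial mX law e2 mg g_le) prod4.
by rewrite /bridge_sd /g /=.
Qed.

(** Exponents of the product of the members [j] and [l], a square when they coincide. *)
Let pair_exp (j l i : nat) : nat := ((i == j) + (i == l))%N.

Let pair_exp_le j l : (\sum_(0 <= i < 4) pair_exp j l i <= 2)%N.
Proof.
rewrite !big_nat_recl//= big_geq// /pair_exp.
by case: j => [|[|[|[|j]]]]; case: l => [|[|[|[|l]]]].
Qed.

Let residual_moment0 r : residual_moment r 0 = 1.
Proof.
rewrite /residual_moment (_ : (fun x => _) = fun=> 1) ?gauss_mean_cst//.
by apply/funext => x; rewrite mulr1.
Qed.

Let residual_moment1 r : residual_moment r 1 = 0.
Proof.
rewrite /residual_moment (_ : (fun x => _) = id) ?gauss_mean_id//.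
by apply/funext => x; rewrite mulr1.
Qed.

Let residual_moment2 r : s <= r -> r <= t -> residual_moment r 2 = residual_var s t r.
Proof.
move=> sr rt; rewrite /residual_moment (_ : (fun x => _) = fun x => x ^+ 2).
  by rewrite gauss_mean_sqr sqr_sqrtr//; exact: (residual_var_ge0 BM).
by apply/funext => x; rewrite mulr1.
Qed.

(** The square of the decomposition has ten terms; the three linear in the residual vanish because
    it is centered and has weight 1. *)
Lemma weighted_increment_sqr r : s <= r -> r <= t ->
  P.-integrable setT (EFin \o (fun w => (B r w - B s w) ^+ 2 * bridge_weight w)) /\
  \int[P]_w ((B r w - B s w) ^+ 2 * bridge_weight w) =
  let ci := coef_incr s t r in let ca := coef_area s t r in let cs := coef_skew s t r in
  residual_var s t r * incr_moment 0 * area_moment 0 * skew_moment 0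
  + ci ^+ 2 * incr_moment 2 * area_moment 0 * skew_moment 0
  + ca ^+ 2 * incr_moment 0 * area_moment 2 * skew_moment 0
  + cs ^+ 2 * incr_moment 0 * area_moment 0 * skew_moment 2
  + 2 * ci * ca * incr_moment 1 * area_moment 1 * skew_moment 0
  + 2 * ci * cs * incr_moment 1 * area_moment 0 * skew_moment 1
  + 2 * ca * cs * incr_moment 0 * area_moment 1 * skew_moment 1.
Proof.
move=> sr rt /=.
set ci := coef_incr s t r; set ca := coef_area s t r; set cs := coef_skew s t r.
pose L : seq (R * (nat * nat)) := [:: (1, (0, 0)%N); (ci ^+ 2, (1, 1)%N); (ca ^+ 2, (2, 2)%N);
  (cs ^+ 2, (3, 3)%N); (2 * ci, (0, 1)%N); (2 * ca, (0, 2)%N); (2 * cs, (0, 3)%N);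
  (2 * ci * ca, (1, 2)%N); (2 * ci * cs, (1, 3)%N); (2 * ca * cs, (2, 3)%N)].
pose F (p : R * (nat * nat)) w := p.1 * monomial r (pair_exp p.2.1 p.2.2) w.
have intF p : P.-integrable setT (EFin \o F p).
  apply: integrableZl_real => //.
  by have [] := int_monomial sr rt (pair_exp_le p.2.1 p.2.2).
have E w : (B r w - B s w) ^+ 2 * bridge_weight w = \sum_(p <- L) F p w.
  have -> : B r w - B s w = residual B s t r w + (ci * W w + ca * H w + cs * D w).
    by rewrite /residual subrK.
  rewrite /L !big_cons big_nil /F /= !monomialE /pair_exp /=.
  by move: (residual B s t r w) (W w) (H w) (D w) (bridge_weight w) => *; ring.
split.
  rewrite (_ : (fun w => _) = (fun w => \sum_(p <- L) F p w)); last exact/funext.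
  exact: integrable_sum_real.
rewrite (_ : (fun w => _) = (fun w => \sum_(p <- L) F p w)); last exact/funext.
rewrite Rintegral_sum// (eq_bigr (fun p => p.1 * (residual_moment r (pair_exp p.2.1 p.2.2 0) *
   incr_moment (pair_exp p.2.1 p.2.2 1) * area_moment (pair_exp p.2.1 p.2.2 2) *
   skew_moment (pair_exp p.2.1 p.2.2 3)))); last first.
  move=> p _; have [Ip Ep] := int_monomial sr rt (pair_exp_le p.2.1 p.2.2).
  by rewrite /F RintegralZl// Ep.
rewrite /L !big_cons big_nil /= /pair_exp /=.
by rewrite residual_moment0 residual_moment1 residual_moment2//; ring.
Qed.

Lemma weighted_monomial a b : (a + b <= 2)%N ->
  P.-integrable setT (EFin \o (fun w => W w ^+ a * H w ^+ b * bridge_weight w)) /\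
  \int[P]_w (W w ^+ a * H w ^+ b * bridge_weight w) =
  incr_moment a * area_moment b * skew_moment 0.
Proof.
move=> ab; pose e i := nth 0%N [:: 0; a; b]%N i.
have e2 : (\sum_(0 <= i < 4) e i <= 2)%N.
  by rewrite !big_nat_recl//= big_geq// /e/= !addn0 add0n.
(* The residual has exponent 0, so the choice of time [s] is immaterial. *)
have := int_monomial (lexx s) (ltW st) e2; rewrite residual_moment0 mul1r.
rewrite (_ : monomial s e = fun w => W w ^+ a * H w ^+ b * bridge_weight w)//.
by apply/funext => w; rewrite monomialE /e/= expr0 mul1r mulr1.
Qed.

(** The factor [x ^+ 0] keeps the shape of [gauss_mean_sg]. *)
Definition sign_moment : R :=
  gauss_mean (Num.sqrt (h / 12)) (fun x => x ^+ 0 * (Num.sg x * g3 (Num.sg x))).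

Let sd0 : 0 < Num.sqrt (h / 12). Proof. by rewrite sqrtr_gt0. Qed.

(** The square of the skew area is independent of its sign; this proportionality produces the
    cancellation of the squared skew coefficient. *)
Lemma skew_moment2 : skew_moment 2 = h / 12 * skew_moment 0.
Proof.
rewrite /skew_moment !gauss_mean_sg// half_moment2 half_moment0 sqr_sqrtr; last exact: ltW.
by rewrite sqrrN expr1n !expr0; ring.
Qed.

Lemma skew_moment1 :
  skew_moment 1 = 2 * Num.sqrt (h / 12) * (Num.sqrt (2 * pi))^-1 * sign_moment.
Proof.
rewrite /skew_moment /sign_moment !gauss_mean_sg// (@gauss_mean_sg _ _ 0 (fun y => y * g3 y))//.
by rewrite half_moment1 half_moment0 !expr0 !expr1; field; rewrite sqrtr_eq0 -ltNge mulr_gt0// pi_gt0.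
Qed.

Lemma bridge_weight_measurable : measurable_fun setT bridge_weight.
Proof.
have mW := measurable_bridge_incr BM s0 st.
have mH := measurable_bridge_area BM s0 st.
have mD := measurable_bridge_skew BM s0 st.
apply: measurable_funM.
  by apply: measurable_funM; [exact: (measurableT_comp mg1)|exact: (measurableT_comp mg2)].
apply: (measurableT_comp mg3); exact: (measurableT_comp measurable_sg).
Qed.

Lemma bridge_weight_le w : `|bridge_weight w| <= 1.
Proof. by rewrite !normrM mulr_ile1// mulr_ile1. Qed.

End weights.

(** Constant weights in the previous formula: the components of the variance add up to [r - s]. This
    feeds the domination for Fubini. *)
Lemma increment_sqr r : s <= r -> r <= t ->
  P.-integrable setT (EFin \o (fun w => (B r w - B s w) ^+ 2)) /\
  \int[P]_w ((B r w - B s w) ^+ 2) = r - s.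
Proof.
move=> sr rt.
have m1 : measurable_fun setT (cst 1 : R -> R) by exact: measurable_cst.
have l1 (x : R) : `|cst (1 : R) x| <= 1 by rewrite normr1.
have := weighted_increment_sqr m1 m1 m1 l1 l1 l1 sr rt.
rewrite (_ : (fun w => _ * _) = (fun w => (B r w - B s w) ^+ 2)); last first.
  by apply/funext => w; rewrite /bridge_weight /= !mulr1.
have M0 v : gauss_mean v (fun x => x ^+ 0 * cst 1 x) = 1.
  by rewrite -[RHS](gauss_mean_cst v); congr gauss_mean; apply/funext => x; rewrite mulr1.
have M1 v : gauss_mean v (fun x => x ^+ 1 * cst 1 x) = 0.
  by rewrite -[RHS](gauss_mean_id v); congr gauss_mean; apply/funext => x; rewrite mulr1.
have M2 v : 0 <= v -> gauss_mean (Num.sqrt v) (fun x => x ^+ 2 * cst 1 x) = v.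
  move=> v0; rewrite -[RHS](sqr_sqrtr v0) -(gauss_mean_sqr (Num.sqrt v)).
  by congr gauss_mean; apply/funext => x; rewrite mulr1.
move=> [I ->]; split => //=.
rewrite /incr_moment /area_moment skew_moment2 /skew_moment !M0 !M1 !M2//; try exact: ltW.
by rewrite /residual_var -/h; ring.
Qed.

Definition bridge_sqint (w : T) : R := \int[lam]_(r in `[s, t]) ((B r w - B s w) ^+ 2).

Let cB w : {within `[0, +oo[%classic, continuous (fun t => B t w)}.
Proof. by case: BM. Qed.

Let mB r : 0 <= r -> measurable_fun setT (B r).
Proof. by case: BM => mB _ _ _ _; exact: mB. Qed.

(** Extended by 0 off [[s, t]], and through [full_path] at negative times, so that Fubini applies on
    the whole product space. *)
Let sq (w : T) (r : R) : R := (full_path B w r - B s w) ^+ 2 * \1_(`[s, t]) r.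

Let sqE w r : s <= r -> r <= t -> sq w r = (B r w - B s w) ^+ 2.
Proof.
move=> sr rt; rewrite /sq full_path_ge0 ?(le_trans s0)// indicE mem_set ?mulr1//.
by rewrite /= in_itv/= sr.
Qed.

Let sqE0 w r : ~~ (s <= r <= t) -> sq w r = 0.
Proof. by move=> srt; rewrite /sq indicE memNset ?mulr0//= in_itv/=; exact/negP. Qed.

Let sq_ge0 w r : 0 <= sq w r.
Proof. by rewrite mulr_ge0// ?sqr_ge0// indicE. Qed.

Let int_sq_r w : lam.-integrable setT (EFin \o sq w).
Proof.
have cf : continuous (fun r => (full_path B w r - B s w) ^+ 2).
  move=> r; apply: (cvg_comp (fun r => full_path B w r - B s w) (fun x => x ^+ 2)).
    by apply: cvgB; [exact: (continuous_full_path (@cB w))|exact: cvg_cst].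
  exact: exprn_continuous.
have := continuous_integrable_itv s t cf.
move=> /integrable_mkcond -/(_ (measurable_itv _)); apply: eq_integrable => // r _ /=.
by rewrite /patch /sq indicE; case: ifP; rewrite ?mulr1 ?mulr0.
Qed.

Let sqint_sq w : \int[lam]_r sq w r = bridge_sqint w.
Proof.
rewrite /bridge_sqint [RHS]Rintegral_mkcond; apply: eq_Rintegral => r _.
rewrite patchE; case: ifPn => [/set_mem|rst].
  by rewrite /= in_itv/= => /andP[sr rt]; rewrite sqE.
apply: sqE0; apply: contra rst => h'; apply/mem_set.
by rewrite /= in_itv.
Qed.

Let msq : measurable_fun [set: R * T] (fun z => sq z.2 z.1).
Proof.
have mI : measurable_fun setT (\1_(`[s, t]) : R -> R) by exact: measurable_indic.
apply: measurable_funM; last exact: (measurableT_comp mI).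
apply: measurable_funX; apply: measurable_funB.
  exact: measurable_full_path_joint.
exact: (measurableT_comp (mB s0)).
Qed.

Let in_st r : {s <= r /\ r <= t} + {~~ (s <= r <= t)}.
Proof. by case: (boolP (s <= r <= t)) => [/andP|]; [left|right]. Qed.

Let int_sq_w r : P.-integrable setT (EFin \o (sq ^~ r)).
Proof.
have [[sr rt]|nr] := in_st r.
  have [I _] := increment_sqr sr rt; apply: eq_integrable I => // w _ /=.
  by rewrite sqE.
rewrite (_ : _ \o _ = cst 0%E); first exact: integrable0.
by apply/funext => w /=; rewrite sqE0.
Qed.

(** The integrable bound for the exchanges of integrals: the mean of [sq] at [r] in [[s, t]] is
    [r - s], at most [h]. *)
Let hst (r : R) : R := h * \1_(`[s, t]) r.

Let int_hst : lam.-integrable setT (EFin \o hst).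
Proof.
have cf : continuous (fun _ : R => h) by move=> x; exact: cvg_cst.
have := continuous_integrable_itv s t cf.
move=> /integrable_mkcond -/(_ (measurable_itv _)); apply: eq_integrable => // r _ /=.
by rewrite /patch /hst indicE; case: ifP; rewrite ?mulr1 ?mulr0.
Qed.

Let sq_hst r : \int[P]_w sq w r <= hst r.
Proof.
have [[sr rt]|nr] := in_st r.
  under eq_Rintegral do rewrite sqE//.
  have [_ ->] := increment_sqr sr rt; rewrite /hst indicE mem_set.
    by rewrite mulr1 lerD2r.
  by rewrite /= in_itv/= sr.
under eq_Rintegral do rewrite sqE0//.
by rewrite Rintegral_cst// mul0r mulr_ge0 ?(ltW h0)// indicE.
Qed.

Lemma integrable_bridge_sqint : P.-integrable setT (EFin \o bridge_sqint).
Proof.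
rewrite (_ : bridge_sqint = fun w => \int[lam]_r sq w r); last first.
  by apply/funext => w; rewrite sqint_sq.
apply: (@integrable_Rintegral _ _ _ _ _ P lam sq hst) => //.
  have mswap : measurable_fun [set: T * R] (fun z : T * R => (z.2, z.1)).
    exact: measurable_fun_pair.
  exact: (measurableT_comp msq mswap).
move=> r; under eq_Rintegral do rewrite ger0_norm ?sq_ge0//.
exact: sq_hst.
Qed.

Section weighted_square_integral.
Variable q : T -> R.
Hypothesis mq : measurable_fun setT q.
Hypothesis q1 : forall w, `|q w| <= 1.

Let sq_mean r : \int[P]_w (sq w r * q w) =
  ((fun r => \int[P]_w ((B r w - B s w) ^+ 2 * q w)) \_ `[s, t]) r.
Proof.
rewrite patchE; have [[sr rt]|nr] := in_st r.
  rewrite mem_set; last by rewrite /= in_itv/= sr.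
  by apply: eq_Rintegral => w _; rewrite sqE.
rewrite memNset; last by rewrite /= in_itv/=; exact/negP.
under eq_Rintegral do rewrite sqE0// mul0r.
by rewrite Rintegral_cst// mul0r.
Qed.

Let intqw r : P.-integrable setT (EFin \o (fun w => sq w r * q w)).
Proof. exact: (@integrableMb _ _ _ P setT _ _ 1). Qed.

Let intqr w : lam.-integrable setT (EFin \o (fun r => sq w r * q w)).
Proof.
rewrite (_ : (fun r => _) = fun r => q w * sq w r).
  exact: integrableZl_real.
by apply/funext => r; rewrite mulrC.
Qed.

Let mqr : measurable_fun [set: R * T] (fun z => sq z.2 z.1 * q z.2).
Proof. by apply: measurable_funM => //; exact: (measurableT_comp mq). Qed.

Lemma weighted_bridge_sqint : \int[P]_w (bridge_sqint w * q w) =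
  \int[lam]_(r in `[s, t]) \int[P]_w ((B r w - B s w) ^+ 2 * q w).
Proof.
have -> : \int[P]_w (bridge_sqint w * q w) = \int[P]_w \int[lam]_r (sq w r * q w).
  by apply: eq_Rintegral => w _; rewrite RintegralZr// sqint_sq.
rewrite -(@Rintegral_Fubini _ _ _ _ _ lam P (fun r w => sq w r * q w) hst);
  [|exact: mqr|exact: intqw|exact: intqr|exact: int_hst|].
  by rewrite [RHS]Rintegral_mkcond; apply: eq_Rintegral => r _; exact: sq_mean.
move=> r; apply: le_trans (sq_hst r); apply: le_Rintegral => //.
  exact: integrable_norm_real.
by move=> w _; rewrite normrM ger0_norm// ler_piMr.
Qed.

Lemma integrable_weighted_increment : lam.-integrable `[s, t]
  (EFin \o (fun r => \int[P]_w ((B r w - B s w) ^+ 2 * q w))).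
Proof.
apply/integrable_mkcond => //.
rewrite (_ : _ \_ _ = EFin \o (fun r => \int[P]_w (sq w r * q w))); last first.
  by apply/funext => r /=; rewrite sq_mean !patchE; case: ifP.
apply: (@integrable_Rintegral _ _ _ _ _ lam P (fun r w => sq w r * q w) bridge_sqint) => //.
  exact: integrable_bridge_sqint.
move=> w; rewrite -sqint_sq; apply: le_Rintegral => //.
  exact: integrable_norm_real.
by move=> r _; rewrite normrM ger0_norm// ler_piMr.
Qed.

End weighted_square_integral.

End conditional_moments.

(** * The identity for one coordinate *)

Section conditional_identity.
Context {d : measure_display} {T : measurableType d} {R : realType}.
Notation lam := (@lebesgue_measure R).
Variable P : probability T R.
Variable B : R -> T -> R.
Hypothesis BM : brownian_motion P B.
Variables s t : R.
Hypothesis s0 : 0 <= s.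
Hypothesis st : s < t.

Let h := t - s.
Let k := h / 2.
Let u := (s + t) / 2.
Let W := bridge_incr B s t.
Let H := bridge_area B s t.
Let D := bridge_skew B s t.

Let h0 : 0 < h. Proof. by rewrite subr_gt0. Qed.
Let su : s < u. Proof. by case: (midf_lt st). Qed.
Let ut : u < t. Proof. by case: (midf_lt st). Qed.

(** The right-hand side of [weighted_increment_sqr] with its moments replaced by free numbers, so
    that the integral over [r] is pure algebra. *)
Let quad (w0 w1 w2 a0 a1 a2 d0 d1 d2 : R) (r : R) : R :=
  let ci := coef_incr s t r in let ca := coef_area s t r in let cs := coef_skew s t r in
  residual_var s t r * w0 * a0 * d0 + ci ^+ 2 * w2 * a0 * d0 + ca ^+ 2 * w0 * a2 * d0
  + cs ^+ 2 * w0 * a0 * d2 + 2 * ci * ca * w1 * a1 * d0 + 2 * ci * cs * w1 * a0 * d1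
  + 2 * ca * cs * w0 * a1 * d1.

(** Over [[s, t]] the squared increment and area coefficients integrate to [h / 3] and [6 / 5 * h],
    twice their product to [h], and twice the product of increment and skew coefficients to
    [- h / 4]. The area coefficient is symmetric about [u] and the skew one antisymmetric, so their
    product integrates to 0. By the hypothesis on [d2], the constant term is
    [h^2 / 2 - h^2 / 3 - h^2 / 10 = h^2 / 15]. *)
Let Rintegral_quad w0 w1 w2 a0 a1 a2 d0 d1 d2 : d2 = h / 12 * d0 ->
  lam.-integrable `[s, t] (EFin \o quad w0 w1 w2 a0 a1 a2 d0 d1 d2) ->
  \int[lam]_(r in `[s, t]) quad w0 w1 w2 a0 a1 a2 d0 d1 d2 r =
  h / 3 * (w2 * a0 * d0) + h * (w1 * a1 * d0) + 6 / 5 * h * (w0 * a2 * d0)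
  + h ^+ 2 / 15 * (w0 * a0 * d0) - h / 4 * (w1 * a0 * d1).
Proof.
move=> d2E int_quad; rewrite (@Rintegral_itv_split _ _ _ u)//; [|exact: ltW..].
have hn0 : h != 0 by rewrite gt_eqF.
have uE : u = s + h / 2 by rewrite /u /h; field.
have tE : t = s + h by rewrite /h; ring.
pose Kaa := w2 * a0 * d0 - h * w0 * a0 * d0.
pose Kbb := w0 * a2 * d0 - h / 12 * w0 * a0 * d0.
rewrite (@Rintegral_quadratic_forms R 0 (w0 * a0 * d0) 0 (1 / h) 0 (6 / h) (- (6 / h ^+ 2))
  0 (3 / k) (- (3 / k ^+ 2)) Kaa Kbb (2 * w1 * a1 * d0) (2 * w1 * a0 * d1) (2 * w0 * a1 * d1)
  s u _ (ltW su)); last first.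
  move=> r; rewrite in_itv/= => /andP[sr ru].
  rewrite /quad d2E /residual_var /coef_skew -/u ru /coef_incr /coef_area -/h /Kaa /Kbb /k.
  rewrite uE tE; field.
  done.
(* On the right half the polynomials are expanded at [u], with [r - s = k + (r - u)]. *)
rewrite (@Rintegral_quadratic_forms R (k * w0 * a0 * d0) (w0 * a0 * d0) (k / h) (1 / h)
  (6 * k ^+ 2 / h ^+ 2) 0 (- (6 / h ^+ 2))
  0 (- (3 / k)) (3 / k ^+ 2) Kaa Kbb (2 * w1 * a1 * d0) (2 * w1 * a0 * d1) (2 * w0 * a1 * d1)
  u t _ (ltW ut)); last first.
  move=> r; rewrite in_itv/= => /andP[ur rt].
  have -> : quad w0 w1 w2 a0 a1 a2 d0 d1 d2 r =
      let ci := coef_incr s t r in let ca := coef_area s t r in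
      let cs := - (3 * (r - u) * (t - r) / k ^+ 2) in
      (r - s - ci ^+ 2 * h - ca ^+ 2 * (h / 12)) * w0 * a0 * d0 + ci ^+ 2 * w2 * a0 * d0
      + ca ^+ 2 * w0 * a2 * d0
      + 2 * ci * ca * w1 * a1 * d0 + 2 * ci * cs * w1 * a0 * d1
      + 2 * ca * cs * w0 * a1 * d1.
    (* At [r = u] the definition selects the left branch, but both branches vanish there. *)
    have -> : - (3 * (r - u) * (t - r) / k ^+ 2) = coef_skew s t r.
      rewrite /coef_skew -/u; case: ifPn => // ru.
      have -> : r = u by apply/eqP; rewrite eq_le ru.
      by rewrite !subrr !(mulr0, mul0r) oppr0.
    by rewrite /quad d2E /residual_var -/h /=; ring.
  rewrite /= /coef_incr /coef_area -/h /Kaa /Kbb /k.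
  rewrite uE tE; field.
  done.
rewrite /= /Kaa /Kbb /k uE tE; field.
done.
Qed.

Definition bridge_estimate (w : T) : R :=
  3^-1 * h * W w ^+ 2 + h * W w * H w + 6 / 5 * h * H w ^+ 2 + 15^-1 * h ^+ 2
  - (4 * Num.sqrt (6 * pi))^-1 * Num.sg (D w) * h `^ (3 / 2) * W w.

Lemma integrable_bridge_estimate : P.-integrable setT (EFin \o bridge_estimate).
Proof.
have m1 : measurable_fun setT (cst 1 : R -> R) by exact: measurable_cst.
have l1 (x : R) : `|cst (1 : R) x| <= 1 by rewrite normr1.
have msg : measurable_fun setT (Num.sg : R -> R) by exact: measurable_sg.
have sg_le (x : R) : `|Num.sg x| <= 1 by rewrite normr_sg; case: (x != 0).
pose M a b w := W w ^+ a * H w ^+ b * bridge_weight B s t (cst 1) (cst 1) (cst 1) w.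
pose M' w := W w ^+ 1 * H w ^+ 0 * bridge_weight B s t (cst 1) (cst 1) Num.sg w.
have intM a b : (a + b <= 2)%N -> P.-integrable setT (EFin \o M a b).
  by move=> ab; have [] := weighted_monomial BM s0 st m1 m1 m1 l1 l1 l1 ab.
have intM' : P.-integrable setT (EFin \o M').
  by have [] := weighted_monomial BM s0 st m1 m1 msg l1 l1 sg_le (isT : (1 + 0 <= 2)%N).
rewrite (_ : bridge_estimate = fun w => 3^-1 * h * M 2%N 0%N w + h * M 1%N 1%N w
    + 6 / 5 * h * M 0%N 2%N w + 15^-1 * h ^+ 2 * M 0%N 0%N w
    - (4 * Num.sqrt (6 * pi))^-1 * h `^ (3 / 2) * M' w).
  have intZ c a b : (a + b <= 2)%N -> P.-integrable setT (EFin \o (fun w => c * M a b w)).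
    by move=> ab; apply: integrableZl_real => //; exact: intM.
  apply: integrableB_real => //; last exact: integrableZl_real.
  apply: integrableD_real => //; last exact: intZ.
  apply: integrableD_real => //; last exact: intZ.
  by apply: integrableD_real => //; exact: intZ.
apply/funext => w; rewrite /bridge_estimate /M /M' /bridge_weight /= sgr_id.
by ring.
Qed.

Section weights.
Variables g1 g2 g3 : R -> R.
Hypothesis mg1 : measurable_fun setT g1.
Hypothesis mg2 : measurable_fun setT g2.
Hypothesis mg3 : measurable_fun setT g3.
Hypothesis g1_le : forall x, `|g1 x| <= 1.
Hypothesis g2_le : forall x, `|g2 x| <= 1.
Hypothesis g3_le : forall x, `|g3 x| <= 1.

Let weight := bridge_weight B s t g1 g2 g3.
(** Absorbs the sign factor of the estimate into the weight, so that its last term is again a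
    weighted monomial. *)
Let sg3 (x : R) : R := Num.sg x * g3 x.

Let msg3 : measurable_fun setT sg3.
Proof. by apply: measurable_funM => //; exact: measurable_sg. Qed.

Let sg3_le x : `|sg3 x| <= 1.
Proof. by rewrite normrM normr_sg mulr_ile1//; case: (x != 0). Qed.

Let sg_weight w : bridge_weight B s t g1 g2 sg3 w = Num.sg (D w) * weight w.
Proof. by rewrite /weight /bridge_weight /sg3 sgr_id; ring. Qed.

(** The origin of the constant: [h / 4] from the integrated cross term, times the mean absolute
    value of the skew area. Then [Num.sqrt (h / 12)] is [Num.sqrt h / (2 * Num.sqrt 3)], and the
    roots of 3 and [2 * pi] combine. *)
Let constE : h / 4 * (2 * Num.sqrt (h / 12) * (Num.sqrt (2 * pi))^-1) =
  (4 * Num.sqrt (6 * pi))^-1 * h `^ (3 / 2).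
Proof.
have p0 : 0 < pi :> R by exact: pi_gt0.
have -> : h `^ (3 / 2) = h * Num.sqrt h.
  rewrite (_ : 3 / 2 = 1 + 2^-1); last by field.
  rewrite powRD; last by rewrite gt_eqF// implybT.
  by rewrite powRr1 ?ltW// powR12_sqrt// ltW.
have -> : Num.sqrt (h / 12) = Num.sqrt h / (2 * Num.sqrt 3).
  rewrite sqrtrM; last exact: ltW.
  rewrite sqrtrV// (_ : 12 = 2 ^+ 2 * 3); last by ring.
  by rewrite sqrtrM// sqrtr_sqr ger0_norm.
have -> : Num.sqrt (6 * pi) = Num.sqrt 3 * Num.sqrt (2 * pi) :> R.
  rewrite (_ : 6 * pi = 3 * (2 * pi)); last by ring.
  by rewrite sqrtrM.
by field; rewrite !sqrtr_eq0 -!ltNge ?mulr_gt0 ?ltr0n.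
Qed.

(** Independence reduces both sides to the same linear combination of products of moments of the
    three weights. *)
Lemma weighted_bridge_estimate :
  \int[P]_w (bridge_sqint B s t w * weight w) = \int[P]_w (bridge_estimate w * weight w).
Proof.
have mq : measurable_fun setT weight.
  exact: (bridge_weight_measurable BM s0 st).
have q1 w : `|weight w| <= 1 by exact: bridge_weight_le.
rewrite (weighted_bridge_sqint BM s0 st mq q1).
have intI := integrable_weighted_increment BM s0 st mq q1.
pose I a b := weighted_monomial BM s0 st mg1 mg2 mg3 g1_le g2_le g3_le (a := a) (b := b).
have [J10 E10'] := weighted_monomial BM s0 st mg1 mg2 msg3 g1_le g2_le sg3_le
  (isT : (1 + 0 <= 2)%N).
have sgE : skew_moment s t sg3 0 = sign_moment s t g3.
  by rewrite /skew_moment /sign_moment; congr gauss_mean; apply/funext => x; rewrite /sg3 sgr_id.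
have quadE r : r \in [set` `[s, t]%R] -> \int[P]_w ((B r w - B s w) ^+ 2 * weight w) =
    quad (incr_moment s t g1 0) (incr_moment s t g1 1) (incr_moment s t g1 2)
     (area_moment s t g2 0) (area_moment s t g2 1) (area_moment s t g2 2)
     (skew_moment s t g3 0) (skew_moment s t g3 1) (skew_moment s t g3 2) r.
  move=> /set_mem; rewrite /= in_itv/= => /andP[sr rt].
  by have [_ ->] := weighted_increment_sqr BM s0 st mg1 mg2 mg3 g1_le g2_le g3_le sr rt.
apply: etrans; first by apply: eq_Rintegral => r rst; apply: (quadE r rst).
rewrite Rintegral_quad; last 2 first.
- exact: skew_moment2.
- by apply: eq_integrable intI => // r rst /=; rewrite quadE.
rewrite skew_moment1// -/h; set q := sign_moment s t g3.
have [J00 E00] := I 0%N 0%N isT.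
have [J20 E20] := I 2%N 0%N isT.
have [J11 E11] := I 1%N 1%N isT.
have [J02 E02] := I 0%N 2%N isT.
pose M a b w := W w ^+ a * H w ^+ b * weight w.
pose M' w := W w ^+ 1 * H w ^+ 0 * bridge_weight B s t g1 g2 sg3 w.
(* The fifth term, with the sign, is the default value of [nth], both here and in [F]. *)
pose c i := nth (- ((4 * Num.sqrt (6 * pi))^-1 * h `^ (3 / 2)))
  [:: 3^-1 * h; h; 6 / 5 * h; 15^-1 * h ^+ 2] i.
pose F i := nth M' [:: M 2%N 0%N; M 1%N 1%N; M 0%N 2%N; M 0%N 0%N] i.
pose L := [:: 0; 1; 2; 3; 4]%N.
rewrite (_ : (fun w => bridge_estimate w * weight w) = fun w => \sum_(i <- L) c i * F i w); last first.
  apply/funext => w; rewrite /L !big_cons big_nil /F /c /= /M /M' sg_weight /bridge_estimate.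
  by ring.
have intF i : P.-integrable setT (EFin \o F i).
  by case: i => [|[|[|[|i]]]] //=; rewrite /F /= nth_nil.
have intL i : P.-integrable setT (EFin \o (fun w => c i * F i w)).
  exact: integrableZl_real.
rewrite Rintegral_sum// (eq_bigr (fun i => c i * \int[P]_w F i w)); last first.
  by move=> i _; rewrite RintegralZl.
rewrite /L !big_cons big_nil /c /F /= E20 E11 E02 E00 E10' sgE -constE -/q.
by field; rewrite sqrtr_eq0 -ltNge mulr_gt0// pi_gt0.
Qed.

End weights.

End conditional_identity.

(** * Conditional expectation and independent coordinates *)

Section sub_sigma_algebra.
Context {d : measure_display} {T : measurableType d} {R : realType}.
Variable P : probability T R.
Variable C : set (set T).
Hypothesis mC : forall A, C A -> measurable A.

Lemma sub_sigma_algebra_measurable : <<s C >> `<=` measurable.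
Proof. by apply: smallest_sub => //; exact: sigma_algebra_measurable. Qed.

Let U := g_sigma_algebraType C.
(** The identity onto [T] with the smaller sigma-algebra: the weighted law of this map is a signed
    measure restricted to [<<s C >>]. *)
Let coarsen : T -> U := id.

Let mcoarsen : measurable_fun setT coarsen.
Proof. by move=> _ A mA; rewrite setTI; exact: sub_sigma_algebra_measurable. Qed.

Lemma coarsen_measurable_fun (f : T -> R) :
  measurable_fun (T := U) setT f -> measurable_fun setT f.
Proof. by move=> mf; exact: (measurableT_comp mf mcoarsen). Qed.

Lemma pi_system_Rintegral (X Y : T -> R) : setI_closed C -> C setT ->
  P.-integrable setT (EFin \o X) -> P.-integrable setT (EFin \o Y) ->
  (forall A, C A -> \int[P]_w (X w * \1_A w) = \int[P]_w (Y w * \1_A w)) ->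
  forall A, <<s C >> A -> \int[P]_w (X w * \1_A w) = \int[P]_w (Y w * \1_A w).
Proof.
move=> CI CT iX iY XY A CA.
exact: (weighted_law_unique iX iY mcoarsen mcoarsen erefl CI (XY _ CT) XY CA).
Qed.

(** On [<<s C >>], independence says that the weights [\1_E] and the constant [fine (P E)] have the
    same weighted law; [F] is then integrated against it. *)
Lemma Rintegral_independent (E : set T) (F : T -> R) : measurable E ->
  (forall A, <<s C >> A -> P (A `&` E) = (P A * P E)%E) ->
  measurable_fun (T := U) setT F -> P.-integrable setT (EFin \o F) ->
  \int[P]_w (F w * \1_E w) = fine (P E) * \int[P]_w F w.
Proof.
move=> mE ind mF iF.
have iE : P.-integrable setT (EFin \o \1_E).
  by apply: (@integrable_prob_bounded _ _ _ _ _ 1) => // w; exact: normr_indic_le1.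
have ic : P.-integrable setT (EFin \o cst (fine (P E))).
  exact: finite_measure_integrable_cst.
have mF' := coarsen_measurable_fun mF.
have iEF : P.-integrable setT (EFin \o (fun w => \1_E w * F w)).
  rewrite (_ : (fun w => _) = fun w => F w * \1_E w); last by apply/funext => w; rewrite mulrC.
  by apply: (@integrableMb _ _ _ P setT _ _ 1) => // w; exact: normr_indic_le1.
rewrite -RintegralZl//.
transitivity (\int[P]_w (\1_E w * F w)); first by apply: eq_Rintegral => w _; rewrite mulrC.
apply: (weighted_law_fun iE ic mcoarsen mcoarsen) => //; last exact: integrableZl_real.
move=> A CA; have mA := sub_sigma_algebra_measurable CA.
have iA : P.-integrable setT (EFin \o (\1_A : T -> R)).
  by apply: (@integrable_prob_bounded _ _ _ _ _ 1) => // w; exact: normr_indic_le1.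
rewrite /weighted_law [RHS]RintegralZl//.
transitivity (\int[P]_w \1_(A `&` E) w).
  by apply: eq_Rintegral => w _; rewrite indicI /= mulrC.
rewrite (_ : \int[P]_w \1_A (coarsen w) = \int[P]_w \1_A w)//.
have indic_int D : measurable D -> \int[P]_w \1_D w = fine (P D).
  by move=> mD; rewrite /Rintegral integral_indic// setIT.
by rewrite !indic_int ?ind ?fineM ?fin_num_measure// 1?mulrC//; exact: measurableI.
Qed.

End sub_sigma_algebra.

Lemma Rintegral_mulr_indic {d : measure_display} {T : measurableType d} {R : realType}
    (P : probability T R) (A : set T) (f : T -> R) :
  \int[P]_w (f w * \1_A w) = \int[P]_(w in A) f w.
Proof.
rewrite [RHS]Rintegral_mkcond.
by apply: eq_Rintegral => w _; rewrite patchE indicE; case: ifP; rewrite ?mulr1 ?mulr0.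
Qed.

Section condexp_version.
Context {d : measure_display} {T : measurableType d} {R : realType}.
Variable P : probability T R.
Variable C : set (set T).
Hypothesis mC : forall A, C A -> measurable A.

(** The difference [f] of two versions integrates to 0 over every event of [<<s C >>], in particular
    over the event that it is nonnegative. *)
Lemma is_condexp_ae_eq (X Y Z : T -> R) :
  is_condexp P <<s C >> X Y -> is_condexp P <<s C >> X Z ->
  {ae P, forall w, Y w = Z w}.
Proof.
move=> [iX iY mY eY] [_ iZ mZ eZ].
pose U := g_sigma_algebraType C.
have mYU : measurable_fun (T := U) setT Y by move=> _ B mB; rewrite setTI; exact: mY.
have mZU : measurable_fun (T := U) setT Z by move=> _ B mB; rewrite setTI; exact: mZ.
pose f w := Y w - Z w.
have mfU : measurable_fun (T := U) setT f by exact: measurable_funB.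
have iF : P.-integrable setT (EFin \o f) by exact: integrableB_real.
have eF A : <<s C >> A -> \int[P]_w (f w * \1_A w) = 0.
  move=> CA; have mA := sub_sigma_algebra_measurable mC CA.
  have iA (V : T -> R) : P.-integrable setT (EFin \o V) ->
      P.-integrable setT (EFin \o (fun w => V w * \1_A w)).
    by move=> iV; apply: (@integrableMb _ _ _ P setT _ _ 1) => // w; exact: normr_indic_le1.
  transitivity (\int[P]_w (Y w * \1_A w) - \int[P]_w (Z w * \1_A w)).
    by rewrite -RintegralB//; [|exact: iA..]; apply: eq_Rintegral => w _; rewrite mulrBl.
  by rewrite !Rintegral_mulr_indic /Rintegral eY// eZ// subrr.
pose A := f @^-1` `[0, +oo[.
have CA : <<s C >> A.
  by have := mfU measurableT `[0, +oo[%classic (measurable_itv _); rewrite setTI.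
have abs0 : \int[P]_w `|f w| = 0.
  have mA := sub_sigma_algebra_measurable mC CA.
  have CT : <<s C >> setT by exact: (@measurableT _ U).
  have iA : P.-integrable setT (EFin \o (fun w => f w * \1_A w)).
    by apply: (@integrableMb _ _ _ P setT _ _ 1) => // w; exact: normr_indic_le1.
  (* The absolute value of [f] is [2 * f * \1_A - f]. *)
  transitivity (2 * \int[P]_w (f w * \1_A w) - \int[P]_w (f w * \1_setT w)); last first.
    by rewrite !eF// mulr0 subrr.
  rewrite -RintegralZl// -RintegralB//; last 2 first.
  - exact: integrableZl_real.
  - by under [X in _.-integrable _ (_ \o X)]eq_fun do rewrite indicT mulr1.
  apply: eq_Rintegral => w _; rewrite indicT mulr1 indicE.
  have [fw|fw] := leP 0 (f w).
    rewrite mem_set; last by rewrite /A /= in_itv/= fw.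
    by rewrite ger0_norm// mulr1n mulr1 mulr2n mulrDl mul1r addrK.
  rewrite memNset; last by rewrite /A /= in_itv/= andbT; apply/negP; rewrite -ltNge.
  by rewrite ltr0_norm// mulr0n !mulr0 sub0r.
have mf : measurable_fun setT (EFin \o f) by apply/measurable_EFinP; exact: (coarsen_measurable_fun mC mfU).
have /(ae_eq_integral_abs P measurableT mf) : (\int[P]_w `|(EFin \o f) w| = 0)%E.
  rewrite -[LHS]fineK; first by congr EFin; rewrite -[RHS]abs0.
  by apply: integrable_fin_num => //; exact: integrable_norm_real.
apply: filterS => w /(_ Logic.I) /= [] /eqP.
by rewrite subr_eq0 => /eqP.
Qed.

Lemma condexp_ae_eq (X Y : T -> R) : is_condexp P <<s C >> X Y ->
  {ae P, forall w, condexp P <<s C >> X w = Y w}.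
Proof.
move=> XY; apply: (is_condexp_ae_eq _ XY).
exact: (@xgetPex _ (cst 0) [set Z | is_condexp P <<s C >> X Z] (ex_intro _ Y XY)).
Qed.

End condexp_version.

(** Stated for an arbitrary sigma-algebra and asking for the sign of the skew area only, so that it
    applies to the conditioning sigma-algebra. *)
Lemma measurable_bridge_estimate {d : measure_display} {T : measurableType d}
    {R : realType} (B : R -> T -> R) (s t : R) :
  measurable_fun setT (bridge_incr B s t) -> measurable_fun setT (bridge_area B s t) ->
  measurable_fun setT (Num.sg \o bridge_skew B s t) ->
  measurable_fun setT (bridge_estimate B s t).
Proof.
move=> mW mH mS0.
have mS : measurable_fun setT (fun w => Num.sg (bridge_skew B s t w)) by exact: mS0.
apply: measurable_funB.
  apply: measurable_funD => //; apply: measurable_funD.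
    apply: measurable_funD; apply: measurable_funM => //.
      exact: measurable_funX.
    exact: measurable_funM.
  by apply: measurable_funM => //; exact: measurable_funX.
by apply: measurable_funM => //; apply: measurable_funM => //; exact: measurable_funM.
Qed.

(** * Measurability for any sigma-algebra that makes the path measurable *)

Section path_functional_measurability.
Context {d : measure_display} {T : measurableType d} {R : realType}.
Variable B : R -> T -> R.
Hypothesis cB : forall w, {within `[0, +oo[%classic, continuous (fun t => B t w)}.
Hypothesis mB : forall t, 0 <= t -> measurable_fun setT (B t).
Variables s t : R.
Hypothesis s0 : 0 <= s.
Hypothesis st : s < t.

Let t0 : 0 <= t. Proof. exact: le_trans s0 (ltW st). Qed.

Lemma measurable_path_incr : measurable_fun setT (bridge_incr B s t).
Proof. by apply: measurable_funB; exact: mB. Qed.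

Lemma measurable_path_levy : measurable_fun setT (bridge_area B s t).
Proof. exact: measurable_levy1. Qed.

Lemma measurable_path_sign : measurable_fun setT (Num.sg \o bridge_skew B s t).
Proof.
have [su ut] := midf_lt st.
apply: (measurableT_comp measurable_sg); apply: measurable_funB.
  exact: measurable_levy1.
by apply: measurable_levy1 => //; exact: le_trans s0 (ltW su).
Qed.

Lemma measurable_path_sqint : measurable_fun setT (bridge_sqint B s t).
Proof.
rewrite (_ : bridge_sqint B s t = fun w =>
    \int[@lebesgue_measure R]_(r in `[s, t]) ((full_path B w r - B s w) ^+ 2)).
  apply: measurable_Rintegral_continuous; first exact: ltW.
    move=> w r; apply: (cvg_comp (fun r => full_path B w r - B s w) (fun x => x ^+ 2)).
      by apply: cvgB; [exact: (continuous_full_path (@cB w))|exact: cvg_cst].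
    exact: exprn_continuous.
  move=> r; apply: measurable_funX; apply: measurable_funB; last exact: mB.
  exact: measurable_full_path.
apply/funext => w; apply: eq_Rintegral => r /set_mem; rewrite /= in_itv/= => /andP[sr _].
by rewrite full_path_ge0// (le_trans s0).
Qed.

Lemma measurable_path_estimate : measurable_fun setT (bridge_estimate B s t).
Proof.
apply: measurable_bridge_estimate.
- exact: measurable_path_incr.
- exact: measurable_path_levy.
- exact: measurable_path_sign.
Qed.

Definition bridge_rect (b1 b2 b3 : set R) : set T := bridge_incr B s t @^-1` b1 `&`
  bridge_area B s t @^-1` b2 `&` (Num.sg \o bridge_skew B s t) @^-1` b3.

Lemma measurable_bridge_rect (b1 b2 b3 : set R) : measurable b1 -> measurable b2 ->
  measurable b3 -> measurable (bridge_rect b1 b2 b3).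
Proof.
move=> m1 m2 m3.
have pre (f : T -> R) b : measurable_fun setT f -> measurable b -> measurable (f @^-1` b).
  by move=> mf mb; rewrite -[X in measurable X]setTI; exact: mf.
apply: measurableI; first apply: measurableI; apply: pre => //.
- exact: measurable_path_incr.
- exact: measurable_path_levy.
- exact: measurable_path_sign.
Qed.

Lemma indic_bridge_rect (b1 b2 b3 : set R) (w : T) :
  \1_(bridge_rect b1 b2 b3) w = bridge_weight B s t \1_b1 \1_b2 \1_b3 w :> R.
Proof. by rewrite /bridge_rect !indicI. Qed.

End path_functional_measurability.

(** * Passage to all coordinates *)

Section multidimensional.
Context {disp : measure_display} {T : measurableType disp} {R : realType}.
Variable P : probability T R.
Variable d : nat.
Variable W : 'I_d -> R -> T -> R.
Hypothesis hW : brownian_motion_dim P W.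
Variables s t : R.
Hypothesis s0 : 0 <= s.
Hypothesis st : s < t.

Let BM j : brownian_motion P (W j). Proof. exact: hW.1. Qed.

Let cW j w : {within `[0, +oo[%classic, continuous (fun t => W j t w)}.
Proof. by case: (BM j). Qed.

Let mW j r : 0 <= r -> measurable_fun setT (W j r).
Proof. by case: (BM j) => m _ _ _ _; exact: m. Qed.

Let path_gen j : set (set T) := \bigcup_(r in `[0, +oo[%classic)
  preimage_set_system setT (W j r) measurable.

Let path_gen_measurable j A : path_gen j A -> measurable A.
Proof.
by move=> [r /=]; rewrite in_itv/= andbT => r0 [B mB <-]; exact: mW.
Qed.

Let mW_gen j r : 0 <= r ->
  measurable_fun (T := g_sigma_algebraType (path_gen j)) setT (W j r).
Proof.
move=> r0 _ B mB; apply: sub_gen_smallest; exists r; first by rewrite /= in_itv/= r0.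
by exists B.
Qed.

Let rects : set (set T) := [set A | exists b : 'I_d -> set R * set R * set R,
  (forall j, [/\ measurable (b j).1.1, measurable (b j).1.2 & measurable (b j).2]) /\
  A = \bigcap_(j in [set: 'I_d]) bridge_rect (W j) s t (b j).1.1 (b j).1.2 (b j).2].

Let rects_measurable A : rects A -> measurable A.
Proof.
move=> [b [mb ->]]; apply: fin_bigcap_measurable => // j _.
by have [? ? ?] := mb j; exact: (measurable_bridge_rect (@cW j) (@mW j) s0 st).
Qed.

Let rects_setI : setI_closed rects.
Proof.
move=> _ _ [b [mb ->]] [b' [mb' ->]].
exists (fun j => ((b j).1.1 `&` (b' j).1.1, (b j).1.2 `&` (b' j).1.2, (b j).2 `&` (b' j).2)).
split.
  by move=> j; have [? ? ?] := mb j; have [? ? ?] := mb' j; split; exact: measurableI.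
rewrite -bigcapI; apply: eq_bigcapr => j _.
by rewrite /bridge_rect !preimage_setI /=; apply/seteqP; split => w /=; tauto.
Qed.

Let rectsT : rects setT.
Proof.
exists (fun=> (setT, setT, setT)); split; first by move=> j; split; exact: measurableT.
by apply/seteqP; split.
Qed.

(** The rectangle is [Q i] intersected with an event [E] of the other coordinates. The error
    restricted to [Q i] has mean 0 and is measurable for the path of [W i], so the independent event
    [E] only multiplies its mean by [P E]. *)
Lemma sqint_estimate_rect i A : rects A ->
  \int[P]_w (bridge_sqint (W i) s t w * \1_A w) =
  \int[P]_w (bridge_estimate (W i) s t w * \1_A w).
Proof.
move=> [b [mb ->]].
pose Q j := bridge_rect (W j) s t (b j).1.1 (b j).1.2 (b j).2.
pose E := \bigcap_(j in [set j | j != i]) Q j.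
pose F w := (bridge_sqint (W i) s t w - bridge_estimate (W i) s t w) * \1_(Q i) w.
have mQ j : measurable (Q j) by have [? ? ?] := mb j; exact: (measurable_bridge_rect (@cW j) (@mW j) s0 st).
(* Measurability is rerun on [T] with the sigma-algebra of the path of [W j] alone, where
   independence is available. *)
have gQ j : <<s path_gen j >> (Q j).
  have [? ? ?] := mb j.
  exact: (measurable_bridge_rect (T := g_sigma_algebraType (path_gen j)) (@cW j) (@mW_gen j) s0 st).
have mE : measurable E by apply: fin_bigcap_measurable => //; exact: finite_finset.
have iS := integrable_bridge_sqint (BM i) s0 st.
have iY := integrable_bridge_estimate (BM i) s0 st.
have iM (V : T -> R) D : measurable D -> P.-integrable setT (EFin \o V) ->
    P.-integrable setT (EFin \o (fun w => V w * \1_D w)).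
  by move=> mD iV; apply: (@integrableMb _ _ _ P setT _ _ 1) => // w; exact: normr_indic_le1.
have iF : P.-integrable setT (EFin \o F).
  by apply: iM => //; exact: integrableB_real.
have F0 : \int[P]_w F w = 0.
  transitivity (\int[P]_w (bridge_sqint (W i) s t w * \1_(Q i) w) -
      \int[P]_w (bridge_estimate (W i) s t w * \1_(Q i) w)).
    by rewrite -RintegralB//; [|exact: iM..]; apply: eq_Rintegral => w _; rewrite /F mulrBl.
  have [m1 m2 m3] := mb i.
  under eq_Rintegral do rewrite indic_bridge_rect.
  under [X in _ - X]eq_Rintegral do rewrite indic_bridge_rect.
  rewrite (weighted_bridge_estimate (BM i) s0 st) ?subrr//;
    solve [exact: measurable_indic|by move=> x; exact: normr_indic_le1].
have ind D' : <<s path_gen i >> D' -> P (D' `&` E) = (P D' * P E)%E.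
  move=> gD'.
  (* Mutual independence is applied with [D] in place of [Q i]; the case [D = setT] then identifies
     the remaining product with [P E]. *)
  have split_i D : <<s path_gen i >> D ->
      P (D `&` E) = (P D * \prod_(j < d | j != i) P (Q j))%E.
    move=> gD; have := hW.2 (fun j => if j == i then D else Q j).
    have -> : \bigcap_(j in [set: 'I_d]) (if j == i then D else Q j) = D `&` E.
      apply/seteqP; split => w /=.
        move=> H; split; first by have := H i I; rewrite eqxx.
        by move=> j /= /negPf ji; have := H j I; rewrite ji.
      by move=> [Dw Ew] j _; case: (eqVneq j i) => // /Ew.
    move=> ->; last by move=> j; case: eqP => [->|_]; [exact: gD|exact: gQ].
    rewrite (bigD1 i)//= eqxx; congr (_ * _)%E; apply: eq_bigr => j /negPf ->//.
  rewrite split_i//; congr (_ * _)%E.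
  have gT : <<s path_gen i >> setT by exact: (@measurableT _ (g_sigma_algebraType (path_gen i))).
  by rewrite -[E in RHS]setTI split_i// probability_setT mul1e.
have mF : measurable_fun (T := g_sigma_algebraType (path_gen i)) setT F.
  apply: measurable_funM; last by apply: measurable_indic; exact: gQ.
  apply: measurable_funB.
    exact: (measurable_path_sqint (T := g_sigma_algebraType (path_gen i)) (@cW i) (@mW_gen i) s0 st).
  exact: (measurable_path_estimate (T := g_sigma_algebraType (path_gen i)) (@cW i) (@mW_gen i) s0 st).
have := Rintegral_independent (@path_gen_measurable i) mE ind mF iF.
rewrite F0 mulr0 => FE.
apply/eqP; rewrite -subr_eq0; apply/eqP; rewrite -[RHS]FE.
have QE : \bigcap_(j in [set: 'I_d]) Q j = Q i `&` E.
  apply/seteqP; split => w /=; first by move=> H; split=> [|j _]; exact: H.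
  by move=> [Qw Ew] j _; have [->|/Ew] := eqVneq j i.
rewrite -RintegralB//; last 2 first.
- by apply: iM => //; apply: fin_bigcap_measurable => [|j _]; [exact: finite_finset|exact: mQ].
- by apply: iM => //; apply: fin_bigcap_measurable => [|j _]; [exact: finite_finset|exact: mQ].
by apply: eq_Rintegral => w _; rewrite QE indicI /F /=; ring.
Qed.

Let C : set (set T) := sigma_gen setT (incr W s t) `|` sigma_gen setT (levy_area W s t)
  `|` sigma_gen setT (levy_sign W s t).

Let C_rects : C `<=` <<s rects >>.
Proof.
(* [k] puts an event into one of the three slots of a rectangle; all other slots, including those of
   other coordinates, are [setT]. *)
have sub (V : 'I_d -> T -> R) (k : set R -> set R * set R * set R) :
    (forall B, measurable B -> [/\ measurable (k B).1.1, measurable (k B).1.2 & measurable (k B).2]) ->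
    (forall j B, bridge_rect (W j) s t (k B).1.1 (k B).1.2 (k B).2 = V j @^-1` B) ->
    sigma_gen setT V `<=` <<s rects >>.
  move=> mk kV; apply: smallest_sub; first exact: smallest_sigma_algebra.
  move=> _ [j _ [B mB <-]]; rewrite setTI; apply: sub_gen_smallest.
  exists (fun l => k (if l == j then B else setT)); split.
    by move=> l; apply: mk; case: ifP.
  apply/seteqP; split => w; last by move=> /(_ j I); rewrite eqxx kV.
  by move=> Vw l _; rewrite kV; case: eqP => // ->.
move=> A [[]|].
- apply: (sub _ (fun B => (B, setT, setT))) => [B mB|j B].
    by split => //; exact: measurableT.
  by rewrite /bridge_rect /= !preimage_setT !setIT.
- apply: (sub _ (fun B => (setT, B, setT))) => [B mB|j B].
    by split => //; exact: measurableT.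
  by rewrite /bridge_rect /= !preimage_setT setIT setTI.
- apply: (sub _ (fun B => (setT, setT, B))) => [B mB|j B].
    by split => //; exact: measurableT.
  by rewrite /bridge_rect /= !preimage_setT !setTI.
Qed.

Let C_measurable A : C A -> measurable A.
Proof. by move=> /C_rects; exact: sub_sigma_algebra_measurable. Qed.

Lemma bridge_estimate_condexp i :
  is_condexp P <<s C >> (bridge_sqint (W i) s t) (bridge_estimate (W i) s t).
Proof.
have iS := integrable_bridge_sqint (BM i) s0 st.
have iY := integrable_bridge_estimate (BM i) s0 st.
split => //.
  have gen (V : 'I_d -> T -> R) : sigma_gen setT V `<=` C ->
      measurable_fun (T := g_sigma_algebraType C) setT (V i).
    move=> VC _ B mB; apply: sub_gen_smallest; apply: VC; apply: sub_gen_smallest.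
    by exists i => //; exists B.
  move=> B mB; rewrite -[X in <<s C >> X]setTI.
  apply: (measurable_bridge_estimate (T := g_sigma_algebraType C)) => //.
  - by apply: (gen (incr W s t)) => A CA; left; left.
  - by apply: (gen (levy_area W s t)) => A CA; left; right.
  - by apply: (gen (levy_sign W s t)) => A CA; right.
move=> A CA.
have mA := sub_sigma_algebra_measurable C_measurable CA.
(* The integrals are compared on [<<s rects >>], which contains [<<s C >>], whereas measurability of
   the estimate was checked against [C] itself. *)
have rA : <<s rects >> A by apply: smallest_sub CA => //; exact: smallest_sigma_algebra.
have fin (V : T -> R) : P.-integrable setT (EFin \o V) ->
    (\int[P]_(w in A) (V w)%:E = (\int[P]_(w in A) V w)%:E)%E.
  move=> iV; rewrite /Rintegral fineK//; apply: integrable_fin_num => //.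
  exact: integrableS iV.
rewrite (fin _ iY) (fin _ iS); congr EFin; apply/esym.
rewrite -(Rintegral_mulr_indic P A (bridge_sqint _ s t)) -(Rintegral_mulr_indic P A (bridge_estimate _ s t)).
exact: (pi_system_Rintegral rects_measurable rects_setI rectsT iS iY (sqint_estimate_rect i) rA).
Qed.

Lemma condexp_bridge_sqint i :
  {ae P, forall w, condexp P <<s C >> (bridge_sqint (W i) s t) w =
    bridge_estimate (W i) s t w}.
Proof. by apply: condexp_ae_eq => //; exact: bridge_estimate_condexp. Qed.

End multidimensional.

Unset Implicit Arguments.

Theorem mainTheorem2 (disp : measure_display) (T : measurableType disp)
    (R : realType) (P : probability T R) (d : nat) (W : 'I_d -> R -> T -> R)
    (hW : brownian_motion_dim P W) (s t : R) (hs : 0 <= s) (hst : s < t)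
    (i : 'I_d) :
  let h := t - s in
  let G := <<s sigma_gen setT (incr W s t)
               `|` sigma_gen setT (levy_area W s t)
               `|` sigma_gen setT (levy_sign W s t) >> in
  let X := fun w => \int[@lebesgue_measure R]_(r in `[s, t])
                      (incr W s r i w ^+ 2) in
  {ae P, forall w, condexp P G X w =
    3^-1 * h * incr W s t i w ^+ 2
    + h * incr W s t i w * levy_area W s t i w
    + 6 / 5 * h * levy_area W s t i w ^+ 2
    + 15^-1 * h ^+ 2
    - (4 * Num.sqrt (6 * pi))^-1 * levy_sign W s t i w * h `^ (3 / 2)
      * incr W s t i w}.
Proof. by move=> h G X; exact: (condexp_bridge_sqint hW hs hst i). Qed.
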